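(* Assume that: (a) $\|\mathbf g\|_{H^{1/2}(\Gamma)^d}<\eta_n:=\dfrac{\varepsilon_0}{2c_vRe}$; (b) $\varepsilon_0\|\mathbf f\|_{X_0'}+c_v\|\mathbf g\|_{H^{1/2}(\Gamma)^d}^2+\Big(\dfrac{\varepsilon_0+2}{2Re}+\alpha_MC_2^2\Big)\|\mathbf g\|_{H^{1/2}(\Gamma)^d}<\dfrac{\varepsilon_0^2}{2Re^2(c_d+\beta_MC_2C_4S_4)}$; (c) the initial guess $\mathbf w_h^0\in X_{0h}$ satisfies $$|\mathbf w_h^0|_X\le F_1(\mathbf f,\mathbf g):=\frac{2Re}{\varepsilon_0}\Big(\|\mathbf f\|_{X_0'}+\big(\tfrac1{Re}+\alpha_MS_2\big)\|\mathbf g\|_{H^{1/2}(\Gamma)^d}+c_v\|\mathbf g\|_{H^{1/2}(\Gamma)^d}^2\Big).$$ Then there is a constant $c_1>0$, independent of $h$, $i$, $\mathbf f$ and $\mathbf g$, such that if the data are sufficiently small in the sense that $$c_1\big(R_1(\mathbf f,\mathbf g)+\|\mathbf g\|_{H^{1/2}(\Gamma)^d}\big)<\frac{\varepsilon_0}{2Re},\qquad R_1(\mathbf f,\mathbf g)=\frac{2Re}{\varepsilon_0}\Big(\varepsilon_0\|\mathbf f\|_{X_0'}+c_v\|\mathbf g\|_{H^{1/2}(\Gamma)^d}^2+\big(\tfrac1{Re}+\alpha_MC_2^2\big)\|\mathbf g\|_{H^{1/2}(\Gamma)^d}\Big),$$ then the sequence $(\mathbf u_h^{i+1},p_h^{i+1})$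 of solutions of the iterative problem (I) converges in $L^2(\Omega)^d\times L^2(\Omega)$, as $i\to\infty$, to the solution $(\mathbf u_h,p_h)$ of the discrete problem (D). Here $\mathbf u_h^i=\mathbf w_h^i+\mathcal I_{X_h}\mathbf G$ and $\mathbf u_h=\mathbf w_h+\mathcal I_{X_h}\mathbf G$.
   Context: **Domain, data, spaces.** $\Omega\subset\mathbb R^d$ ($d=2,3$) is a bounded polygon/polyhedron with Lipschitz boundary $\Gamma$; $Re>0$; $\mathbf f\in L^2(\Omega)^d$. $X=H^1(\Omega)^d$ with full norm $\|\cdot\|_X$ and semi-norm $|\mathbf v|_X=\|\nabla\mathbf v\|_{L^2}$ (a norm on $X_0$); $X_0=H^1_0(\Omega)^d$, with dual $X_0'$; $M=L^2_0(\Omega)$ (zero-mean functions) with the $L^2$ norm. $(\cdot,\cdot)$ is the $L^2(\Omega)$ scalar product. For $p\le6$, $S_p,C_p>0$ denote constants depending only on $\Omega$ with $\|\mathbf v\|_{L^p}\le S_p\|\mathbf v\|_{H^1}$ on $H^1(\Omega)^d$ and $\|\mathbf v\|_{L^p}\le C_p|\mathbf v|_{H^1}$ on $H^1_0(\Omega)^d$. **Coefficients.** $\varepsilon\in L^\infty(\Omega)\cap W^{1,r}(\Omega)$ with $r>d$, $0<\varepsilon_0\le\varepsilon\le1$; $\alpha,\beta$ are positive on $[\varepsilon_0,1]$, differentiable in $]\varepsilon_0,1[$, with $\alpha',\beta'$ positive and bounded there; thus $\alpha\in[\alpha_m,\alpha_M]$, $\beta\in[\beta_m,\beta_M]$. The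 boundary datum $\mathbf g$ has an extension $\mathbf G\in X$, $\mathbf G|_\Gamma=\mathbf g$, $\operatorname{div}(\varepsilon\mathbf G)=0$, normalised by $\|\mathbf G\|_X\le\|\mathbf g\|_{H^{1/2}(\Gamma)^d}$. **Discretization.** $(\mathcal T_h)_h$ is a regular family of conforming triangulations (triangles/tetrahedra) of $\Omega$ (the ratio of the diameter of each element to that of its inscribed ball is bounded independently of $h$; $h$ is the maximal diameter). With $b_\kappa$ the product of the barycentric coordinates of $\kappa$ and $\mathcal P(\kappa)=\mathbb P_1(\kappa)\oplus\mathrm{span}\{b_\kappa\}$: $X_h=\{\mathbf v_h\in\mathcal C^0(\bar\Omega)^d:\mathbf v_h|_\kappa\in\mathcal P(\kappa)^d\ \forall\kappa\}$, $X_{0h}=X_h\cap X_0$, $M_h=\{q_h\in\mathcal C^0(\bar\Omega):q_h|_\kappa\in\mathbb P_1(\kappa)\ \forall\kappa\}$, $M_{0h}=M_h\cap L^2_0(\Omega)$; $\mathcal I_{X_h}:X\to X_h$ is a finite element interpolation operator. $\varepsilon_h\in M_h$ satisfies $\varepsilon_0\le\varepsilon_h\le1$, $\|\varepsilon-\varepsilon_h\|_{L^\infty(\Omega)}\le Ch\|\varepsilon\|_{W^{1,\infty}(\Omega)}$, $\|\nabla\varepsilon-\nabla\varepsilon_h\|_{L^r(\Omega)}\le Ch\|\varepsilon\|_{W^{2,r}(\Omega)}$, $r>d$. Put $a_h(\mathbf u,\mathbf v)=\frac1{Re}(\varepsilon_h\nabla\mathbf u,\nabla\mathbf v)+(\alpha(\varepsilon_h)\mathbf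 u,\mathbf v)$, $d_h(\mathbf u,\mathbf v,\mathbf w)=(\varepsilon_h(\mathbf u\cdot\nabla)\mathbf v,\mathbf w)+\frac12(\operatorname{div}(\varepsilon_h\mathbf u)\mathbf v,\mathbf w)$, $c_h(\mathbf u,\mathbf v,\mathbf w)=d_h(\mathbf u,\mathbf v,\mathbf w)+(\beta(\varepsilon_h)|\mathbf u|\mathbf v,\mathbf w)$, $b_h(\mathbf v,q)=(\operatorname{div}(\varepsilon_h\mathbf v),q)$, $\ell_h(\mathbf v)=\langle\varepsilon_h\mathbf f,\mathbf v\rangle$. The discrete inf-sup condition $\sup_{\mathbf v_h\in X_{0h}}b_h(\mathbf v_h,q_h)/\|\mathbf v_h\|_{X_0}\ge\gamma_\varepsilon^*\|q_h\|_M$ for all $q_h\in M_{0h}$ holds with $\gamma_\varepsilon^*>0$ independent of $h$. **Constants $c_d,c_v$.** Positive constants independent of $h$ such that $d_h(\mathbf u_h,\mathbf v_h,\mathbf w_h)\le c_d|\mathbf u_h|_X|\mathbf v_h|_X|\mathbf w_h|_X$ and $c_h(\mathbf u_h,\mathbf v_h,\mathbf w_h)\le c_v|\mathbf u_h|_X|\mathbf v_h|_X|\mathbf w_h|_X$ on $X_{0h}$, and the same bounds with $\|\cdot\|_X$ on $X_h$; the same bounds are used when the first or second argument is $\mathbf G$ or of the form $\mathbf v_h+\mathbf G$ with $\mathbf v_h\in X_{0h}$, measured by $\|\mathbf G\|_X$, respectively $|\mathbf v_h|_X+\|\mathbf G\|_X$. **Discrete problem (D).** Find $(\mathbf w_h,p_h)\in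 X_{0h}\times M_{0h}$ with, for all $\mathbf v_h\in X_{0h}$, $q_h\in M_{0h}$, $$a_h(\mathbf w_h,\mathbf v_h)+c_h(\mathbf w_h+\mathbf G,\mathbf w_h+\mathbf G,\mathbf v_h)-b_h(\mathbf v_h,p_h)=\ell_h(\mathbf v_h)-a_h(\mathbf G,\mathbf v_h),\qquad b_h(\mathbf w_h,q_h)=0.$$ **Iterative problem (I).** Given $\mathbf w_h^0\in X_{0h}$ and having $\mathbf w_h^i$, find $(\mathbf w_h^{i+1},p_h^{i+1})\in X_{0h}\times M_{0h}$ with, for all $\mathbf v_h\in X_{0h}$, $q_h\in M_{0h}$, $$a_h(\mathbf w_h^{i+1},\mathbf v_h)+c_h(\mathbf w_h^i+\mathbf G,\mathbf w_h^{i+1},\mathbf v_h)-b_h(\mathbf v_h,p_h^{i+1})=\ell_h(\mathbf v_h)-a_h(\mathbf G,\mathbf v_h)-c_h(\mathbf w_h^i+\mathbf G,\mathbf G,\mathbf v_h),\qquad b_h(\mathbf w_h^{i+1},q_h)=0.$$ *)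

(* Defs.v *)
From HB Require Import structures.
From mathcomp Require Import all_boot all_order all_algebra.
From mathcomp Require Import all_classical all_reals all_analysis.

Set Implicit Arguments.
Unset Strict Implicit.
Unset Printing Implicit Defensive.

Import Order.TTheory GRing.Theory Num.Theory numFieldNormedType.Exports.

Local Open Scope classical_set_scope.
Local Open Scope ring_scope.

(* Borel sigma-algebra of R^n (generated by the coordinates) and Lebesgue
   measure [leb R n], built as an iterated product of [lebesgue_measure]. *)

Definition rv_display : measure_display.
Proof. exact: default_measure_display. Qed.

Section rv_measurable.
Variables (R : realType) (n : nat).

Definition rv_coord (i : 'I_n) (x : 'rV[R]_n) : R := x ord0 i.

Let rv_set0 : g_sigma_preimage rv_coord set0.
Proof. exact: sigma_algebra0. Qed.

Let rv_setC A : g_sigma_preimage rv_coord A -> g_sigma_preimage rv_coord (~` A).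
Proof. exact: sigma_algebraC. Qed.

Let rv_bigcup (F : _^nat) : (forall i, g_sigma_preimage rv_coord (F i)) ->
  g_sigma_preimage rv_coord (\bigcup_i (F i)).
Proof. exact: sigma_algebra_bigcup. Qed.

HB.instance Definition _ := @isMeasurable.Build rv_display 'rV[R]_n
  (g_sigma_preimage rv_coord) rv_set0 rv_setC rv_bigcup.

End rv_measurable.

Lemma measurable_fun_rvP (R : realType) d (T : measurableType d) n
    (f : T -> 'rV[R]_n) :
  (forall i, measurable_fun [set: T] (fun t => f t ord0 i)) ->
  measurable_fun [set: T] f.
Proof.
move=> mf.
suff prefS : g_sigma_preimage (fun i => @rv_coord R n i \o f) `<=` measurable.
  move=> _ A mA; rewrite setTI; apply: prefS; rewrite g_sigma_preimage_comp.
  by exists A => //; rewrite setTI.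
apply: smallest_sub; first exact: sigma_algebra_measurable.
case: n => [|n] in f mf *; first by rewrite big_ord0.
rewrite -bigcup_mkord_ord; apply: bigcup_sub => i Ii.
by move=> A [B mB <-]; exact: mf.
Qed.

Lemma measurable_rv_coord (R : realType) n (i : 'I_n) :
  measurable_fun setT (fun x : 'rV[R]_n => x ord0 i).
Proof.
move=> _ Y mY; rewrite setTI; apply: sub_sigma_algebra => /=.
rewrite -bigcup_seq/=; exists i => /=; first by rewrite mem_index_enum.
by exists Y => //; rewrite setTI.
Qed.

Section lebesgue_step.
Context (R : realType) (n : nat).
Variable mu : {sigma_finite_measure set 'rV[R]_n -> \bar R}.

Definition rv_cons (p : R * 'rV[R]_n) : 'rV[R]_n.+1 := row_mx p.1%:M p.2.

Lemma measurable_rv_cons : measurable_fun setT rv_cons.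
Proof.
apply: measurable_fun_rvP => i.
case: (@split_ordP 1 n i) => j ->.
  rewrite (_ : (fun _ => _) = fst); first exact: measurable_fst.
  by apply/funext => p; rewrite (@row_mxEl R 1 1 n) mxE (ord1 j) eqxx mulr1n.
rewrite (_ : (fun _ => _) = (fun x : 'rV[R]_n => x ord0 j) \o snd); last first.
  by apply/funext => p; rewrite (@row_mxEr R 1 1 n).
by apply: measurableT_comp => //; exact: measurable_rv_coord.
Qed.

Definition rv_uncons (x : 'rV[R]_n.+1) : R * 'rV[R]_n :=
  (x ord0 ord0, @rsubmx R 1 1 n x).

Lemma rv_consK : cancel rv_cons rv_uncons.
Proof.
move=> [a x]; rewrite /rv_uncons /rv_cons row_mxKr; congr pair.
rewrite [LHS](_ : _ = @row_mx R 1 1 n a%:M x ord0 (lshift n ord0)).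
  by rewrite row_mxEl mxE eqxx mulr1n.
by congr (fun_of_matrix _ _ _); exact/val_inj.
Qed.

Lemma measurable_rv_uncons : measurable_fun setT rv_uncons.
Proof.
apply/measurable_fun_pairP; split; first exact: measurable_rv_coord.
apply: measurable_fun_rvP => i.
rewrite (_ : (fun _ => _) = (fun x : 'rV[R]_n.+1 => x ord0 (rshift 1 i))).
  exact: measurable_rv_coord.
by apply/funext => x; rewrite !mxE.
Qed.

Definition lebesgue_step : set 'rV[R]_n.+1 -> \bar R :=
  pushforward (@lebesgue_measure R \x mu)%E rv_cons.

Let lebesgue_step0 : lebesgue_step set0 = 0%E.
Proof. by rewrite /lebesgue_step /pushforward preimage_set0 measure0. Qed.

Let lebesgue_step_ge0 A : (0 <= lebesgue_step A)%E.
Proof. by rewrite /lebesgue_step /pushforward; exact: measure_ge0. Qed.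

Let lebesgue_step_sigma_additive : semi_sigma_additive lebesgue_step.
Proof.
move=> F mF tF mUF; rewrite /lebesgue_step /pushforward preimage_bigcup.
have mpre A : measurable A -> measurable (rv_cons @^-1` A).
  by move=> mA; rewrite -[_ @^-1` _]setTI; exact: measurable_rv_cons.
apply: measure_semi_sigma_additive.
- by move=> k; exact: mpre.
- apply/trivIsetP => /= i j _ _ ij; rewrite -preimage_setI.
  by move/trivIsetP : tF => /(_ _ _ _ _ ij) ->//; rewrite preimage_set0.
- by rewrite -preimage_bigcup; exact: mpre.
Qed.

HB.instance Definition _ := isMeasure.Build _ _ _ lebesgue_step
  lebesgue_step0 lebesgue_step_ge0 lebesgue_step_sigma_additive.

Lemma lebesgue_step_sigma_finite : sigma_finite setT lebesgue_step.
Proof.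
have /sigma_finiteP[F [TF ndF Foo]] := sigma_finiteT (@lebesgue_measure R).
have /sigma_finiteP[G [TG ndG Goo]] := sigma_finiteT mu.
exists (fun k => rv_uncons @^-1` (F k `*` G k)).
  rewrite -preimage_bigcup -[LHS](preimage_setT rv_uncons); congr (_ @^-1` _).
  rewrite -setXTT TF TG predeqE => -[x y]; split.
    move=> [/= [i _ Fix] [k _ Gky]]; exists (maxn i k) => //; split.
    - by move: x Fix; exact/subsetPset/ndF/leq_maxl.
    - by move: y Gky; exact/subsetPset/ndG/leq_maxr.
  by move=> [i _ []/= ? ?]; split; exists i.
move=> k; have [? ?] := Foo k; have [? ?] := Goo k; split.
  by rewrite -[_ @^-1` _]setTI; apply: measurable_rv_uncons => //; exact: measurableX.
rewrite /lebesgue_step /pushforward -comp_preimage.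
rewrite (_ : rv_uncons \o rv_cons = id); last first.
  by apply/funext => p; exact: rv_consK.
by rewrite preimage_id product_measure1E// lte_mul_pinfty// ge0_fin_numE.
Qed.

HB.instance Definition _ := @Measure_isSigmaFinite.Build _ _ _ lebesgue_step
  lebesgue_step_sigma_finite.

End lebesgue_step.
Fixpoint leb (R : realType) (n : nat) :
    {sigma_finite_measure set 'rV[R]_n -> \bar R} :=
  if n is m.+1 then lebesgue_step (leb R m)
  else @dirac _ 'rV[R]_0 (const_mx 0) R.

Section euclidean.
Context {R : realType}.

Definition dotm m n (A B : 'M[R]_(m, n)) : R := \sum_i \sum_j A i j * B i j.

(* The norm MathComp-Analysis puts on matrices is the sup norm. *)
Definition enorm m n (A : 'M[R]_(m, n)) : R := Num.sqrt (dotm A A).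

End euclidean.

(* s-dimensional Hausdorff (outer) measure on R^n, normalised to agree with
   Lebesgue measure on s-planes; [mu_ext] minimises over countable covers. *)
Section hausdorff.
Context (R : realType) (n s : nat).
Local Open Scope ereal_scope.

Definition ediam (A : set 'rV[R]_n) : \bar R :=
  ereal_sup [set (enorm (p.1 - p.2))%:E | p in A `*` A].

Definition hausdorff_gauge (delta : R) (A : set 'rV[R]_n) : \bar R :=
  if `[< A = set0 >] then 0
  else if ediam A <= delta%:E then
    leb R s [set x | (enorm x <= 2^-1)%R] * ediam A ^+ s
  else +oo.

Definition hausdorff_pre (delta : R) (A : set 'rV[R]_n) : \bar R :=
  @mu_ext _ (g_sigma_algebraType [set: set 'rV[R]_n]) R
    (hausdorff_gauge delta) A.

Definition hausdorff (A : set 'rV[R]_n) : \bar R :=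
  ereal_sup [set hausdorff_pre delta A | delta in [set x : R | (0 < x)%R]].

Let gauge0 delta : hausdorff_gauge delta set0 = 0.
Proof. by rewrite /hausdorff_gauge asboolT. Qed.

Let gauge_ge0 delta A : 0 <= hausdorff_gauge delta A.
Proof.
rewrite /hausdorff_gauge; case: asboolP => // /eqP/set0P[x Ax].
case: ifPn => // _; apply: mule_ge0 => //; apply: expe_ge0.
apply: ereal_sup_ubound; exists (x, x) => //=.
rewrite subrr /enorm /dotm big1 ?sqrtr0// => i _.
by rewrite big1// => j _; rewrite mxE mul0r.
Qed.

Let pre_le delta A : (0 < delta)%R -> hausdorff_pre delta A <= hausdorff A.
Proof. by move=> d0; apply: ereal_sup_ubound; exists delta. Qed.

Let hausdorff_ge0 A : 0 <= hausdorff A.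
Proof.
apply: le_trans (pre_le A ltr01).
exact: mu_ext_ge0.
Qed.

Let hausdorff0 : hausdorff set0 = 0.
Proof.
apply/eqP; rewrite eq_le hausdorff_ge0 andbT.
apply: ge_ereal_sup => _ [delta d0 <-].
by rewrite /hausdorff_pre mu_ext0.
Qed.

Let le_hausdorff : {homo hausdorff : A B / A `<=` B >-> A <= B}.
Proof.
move=> A B AB; apply: ge_ereal_sup => _ [delta d0 <-].
apply: le_trans (pre_le B d0).
exact: le_mu_ext.
Qed.

Let hausdorff_sigma_subadditive : sigma_subadditive hausdorff.
Proof.
move=> F; apply: ge_ereal_sup => _ [delta d0 <-].
apply: le_trans (_ : _ <= \sum_(k <oo) hausdorff_pre delta (F k)) _.
  exact: mu_ext_sigma_subadditive.
apply: lee_nneseries => k _; last exact: pre_le.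
by move=> _; exact: mu_ext_ge0.
Qed.

HB.instance Definition _ := isOuterMeasure.Build R 'rV[R]_n hausdorff
  hausdorff0 hausdorff_ge0 le_hausdorff hausdorff_sigma_subadditive.

End hausdorff.

Definition surface_measure (R : realType) (n : nat) :
    {measure set (caratheodory_type (@hausdorff R n n.-1)) -> \bar R} :=
  let mu : {outer_measure set 'rV[R]_n -> \bar R} := @hausdorff R n n.-1 in
  [the {measure set (caratheodory_type mu) -> \bar R} of
     (mu : set (caratheodory_type mu) -> \bar R)].

Section sobolev.
Context {R : realType} {d : nat}.
Local Notation point := ('rV[R]_d).
Local Notation mu := (leb R d).
Implicit Types (Omega : set point) (f g phi : point -> R)
  (v F : point -> point) (p : \bar R).

Definition coordf v (i : 'I_d) : point -> R := fun x => v x ord0 i.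

Definition dotv (x y : point) : R := dotm x y.

Definition partial (i : 'I_d) f : point -> R := 'D_(delta_mx ord0 i) f.

Definition smooth f := forall s : seq 'I_d,
  continuous (foldr partial f s) /\
  forall i x, derivable (foldr partial f s) x (delta_mx ord0 i).

Definition test_fun Omega phi := smooth phi /\
  exists K, [/\ compact K, K `<=` Omega & forall x, ~ K x -> phi x = 0].

Definition integ Omega f : R := \int[mu]_(x in Omega) f x.

Definition normLp Omega p f : \bar R :=
  Lnorm mu p (fun x => (\1_Omega x * f x)%:E).

Definition in_Lp Omega p f :=
  measurable_fun Omega f /\ (normLp Omega p f < +oo)%E.

Definition normL2 Omega f : R := fine (normLp Omega 2%:E f).

Definition in_L1loc Omega f := measurable_fun Omega f /\
  forall K, compact K -> K `<=` Omega -> mu.-integrable K (EFin \o f).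

Definition is_wderiv Omega (i : 'I_d) f g :=
  [/\ in_L1loc Omega f, in_L1loc Omega g &
    forall phi, test_fun Omega phi ->
      integ Omega (fun x => f x * partial i phi x) =
      - integ Omega (fun x => g x * phi x)].

(* A weak derivative is unique up to a null set; [wderiv] picks one, and is 0
   when there is none. *)
Definition wderiv Omega i f : point -> R :=
  xget (fun=> 0) [set g | is_wderiv Omega i f g].

Definition is_wdiv Omega F g :=
  [/\ forall i, in_L1loc Omega (coordf F i), in_L1loc Omega g &
    forall phi, test_fun Omega phi ->
      integ Omega (fun x => \sum_i coordf F i x * partial i phi x) =
      - integ Omega (fun x => g x * phi x)].

Definition wdiv Omega F : point -> R :=
  xget (fun=> 0) [set g | is_wdiv Omega F g].

(* Row i of the Jacobian [wjac v] is the gradient of the i-th component. *)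
Definition wgrad Omega f (x : point) : point := \row_j wderiv Omega j f x.
Definition wjac Omega v (x : point) : 'M[R]_d :=
  \matrix_(i, j) wderiv Omega j (coordf v i) x.
Definition whess Omega f (x : point) : 'M[R]_d :=
  \matrix_(i, j) wderiv Omega i (wderiv Omega j f) x.

Definition in_W1p Omega p f := in_Lp Omega p f /\
  forall i, is_wderiv Omega i f (wderiv Omega i f) /\
            in_Lp Omega p (wderiv Omega i f).

Definition in_W2p Omega p f :=
  in_W1p Omega p f /\ forall i, in_W1p Omega p (wderiv Omega i f).

Definition normW1p Omega p f : \bar R :=
  (normLp Omega p f + normLp Omega p (fun x => enorm (wgrad Omega f x)))%E.

Definition normW2p Omega p f : \bar R :=
  (normW1p Omega p f + normLp Omega p (fun x => enorm (whess Omega f x)))%E.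

Definition in_H10 Omega f := in_W1p Omega 2%:E f /\
  exists phi : nat -> point -> R, (forall n, test_fun Omega (phi n)) /\
    normW1p Omega 2%:E (fun x => phi n x - f x) @[n --> \oo] --> 0%E.

Definition in_L2v Omega v := forall i, in_Lp Omega 2%:E (coordf v i).
Definition in_X Omega v := forall i, in_W1p Omega 2%:E (coordf v i).
Definition in_X0 Omega v := forall i, in_H10 Omega (coordf v i).

Definition semiX Omega v : R := normL2 Omega (fun x => enorm (wjac Omega v x)).
Definition normX Omega v : R :=
  Num.sqrt (normL2 Omega (fun x => enorm (v x)) ^+ 2 + semiX Omega v ^+ 2).

(* The norm in X_0' of the functional v |-> (f, v), with X_0 normed by [semiX]. *)
Definition normX0' Omega (f : point -> point) : R :=
  sup [set integ Omega (fun x => dotv (f x) (v x)) |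
        v in [set v | in_X0 Omega v /\ semiX Omega v <= 1]].

Definition bdry Omega : set point := closure Omega `\` Omega.

(* Sobolev-Slobodeckij (squared) norm of H^{1/2}(Gamma)^d. *)
Definition sqHhalf Omega v : \bar R :=
  (\int[surface_measure R d]_(x in bdry Omega) (enorm (v x) ^+ 2)%:E +
   \int[surface_measure R d]_(x in bdry Omega)
     \int[surface_measure R d]_(y in bdry Omega)
       (enorm (v x - v y) ^+ 2 / enorm (x - y) ^+ d)%:E)%E.

Definition in_Hhalf Omega v :=
  (forall i, measurable_fun
    (bdry Omega : set (caratheodory_type (@hausdorff R d d.-1))) (coordf v i)) /\
  (sqHhalf Omega v < +oo)%E.

Definition normHhalf Omega v : R := Num.sqrt (fine (sqHhalf Omega v)).

(* g is the trace of f in H^1(Omega): the limit in L^2(Gamma) of the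
   restrictions of smooth functions tending to f in H^1(Omega). *)
Definition is_trace Omega f g :=
  exists phi : nat -> point -> R, [/\ forall n, smooth (phi n),
    normW1p Omega 2%:E (fun x => phi n x - f x) @[n --> \oo] --> 0%E &
    (\int[surface_measure R d]_(x in bdry Omega) ((phi n x - g x) ^+ 2)%:E)%E
      @[n --> \oo] --> 0%E].

End sobolev.

Section domain.
Context {R : realType} {d : nat}.
Local Notation point := ('rV[R]_d).
Implicit Types (Omega : set point) (f q : point -> R) (v : point -> point).

(* The rows are the vertices. *)
Definition simplex : Type := 'M[R]_(d.+1, d).
Implicit Types (K : simplex) (T : seq simplex).

Definition affine_mx K : 'M[R]_d.+1 := row_mx (const_mx 1 : 'cV[R]_d.+1) K.

Definition nondegenerate K := affine_mx K \in unitmx.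

(* Barycentric coordinates: the solution of (1, x) = lambda *m (1, K). *)
Definition bary K (x : point) (j : 'I_d.+1) : R :=
  (row_mx (1%:M : 'M[R]_1) x *m invmx (affine_mx K)) ord0 j.

Definition hull K : set point := [set x | forall j, 0 <= bary K x j].

Definition is_vertex K (x : point) := exists k, x = row k K.

(* psi is a Lipschitz function of the coordinates orthogonal to e. *)
Definition lipschitz_boundary Omega := forall x0, bdry Omega x0 ->
  exists (U : set point) (e : point) (psi : point -> R) (L : R),
    [/\ nbhs x0 U, enorm e = 1, forall x t, psi (x + t *: e) = psi x,
        forall x y, `|psi x - psi y| <= L * enorm (x - y) &
        forall x, U x -> Omega x <-> psi x < dotv x e].

Definition polyhedral Omega := exists T, (forall K, K \in T -> nondegenerate K) /\
  closure Omega = \bigcup_(K in [set` T]) hull K.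

Definition polyhedral_domain Omega :=
  [/\ Omega !=set0, open Omega, connected Omega, polyhedral Omega &
      lipschitz_boundary Omega].

(* Two distinct elements meet in the face spanned by their common vertices
   (the empty set if there are none). *)
Definition conforming_triangulation Omega T :=
  [/\ forall K, K \in T -> nondegenerate K,
      closure Omega = \bigcup_(K in [set` T]) hull K &
      forall K K', K \in T -> K' \in T -> K <> K' ->
        ~ (forall j, is_vertex K' (row j K)) /\
        hull K `&` hull K' = [set x | hull K x /\
          forall j, ~ is_vertex K' (row j K) -> bary K x j = 0]].

Definition diam (A : set point) : R :=
  sup [set enorm (p.1 - p.2) | p in A `*` A].

Definition inball_diam (A : set point) : R :=
  sup [set 2 * rho | rho in
    [set rho : R | exists x, [set y | enorm (y - x) <= rho] `<=` A]].

Definition mesh T : R := \big[Num.max/0]_(K <- T) diam (hull K).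

Definition regular_family (H : Type) (T : H -> seq simplex) :=
  exists sigma : R, forall h K, K \in T h ->
    diam (hull K) <= sigma * inball_diam (hull K).

Definition is_P1 K f := exists (a : 'cV[R]_d) (c : R),
  forall x, hull K x -> f x = (x *m a) ord0 ord0 + c.

Definition bubble K (x : point) : R := \prod_j bary K x j.

Definition is_P1_bubble K f := exists (a : 'cV[R]_d) (c b : R),
  forall x, hull K x -> f x = (x *m a) ord0 ord0 + c + b * bubble K x.

Definition in_Xh Omega T v := forall i,
  {within closure Omega, continuous (coordf v i)} /\
  forall K, K \in T -> is_P1_bubble K (coordf v i).

Definition in_X0h Omega T v := in_Xh Omega T v /\ in_X0 Omega v.

Definition in_Mh Omega T q :=
  {within closure Omega, continuous q} /\ forall K, K \in T -> is_P1 K q.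

Definition in_M0h Omega T q :=
  [/\ in_Mh Omega T q, in_Lp Omega 2%:E q & integ Omega q = 0].

End domain.
Arguments simplex : clear implicits.

Section problem.
Context {R : realType} {d : nat}.
Local Notation point := ('rV[R]_d).
Implicit Types (Omega : set point) (q : point -> R) (u v w f g G : point -> point).

Section forms.
Variables (Omega : set point) (Re : R) (alpha beta : R -> R).
Variable eh : point -> R.

Definition form_a u v : R :=
  Re^-1 * integ Omega (fun x => eh x * dotm (wjac Omega u x) (wjac Omega v x)) +
  integ Omega (fun x => alpha (eh x) * dotv (u x) (v x)).

Definition ediv v : point -> R := wdiv Omega (fun x => eh x *: v x).

Definition form_d u v w : R :=
  integ Omega (fun x => eh x * dotv (u x *m (wjac Omega v x)^T) (w x)) +
  2^-1 * integ Omega (fun x => ediv u x * dotv (v x) (w x)).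

Definition form_c u v w : R :=
  form_d u v w +
  integ Omega (fun x => beta (eh x) * enorm (u x) * dotv (v x) (w x)).

Definition form_b v q : R := integ Omega (fun x => ediv v x * q x).

Definition form_l f v : R := integ Omega (fun x => eh x * dotv (f x) (v x)).

Definition fieldD u v : point -> point := fun x => u x + v x.

Definition solves_D (T : seq (simplex R d)) f G w q :=
  [/\ in_X0h Omega T w, in_M0h Omega T q,
      forall v, in_X0h Omega T v ->
        form_a w v + form_c (fieldD w G) (fieldD w G) v - form_b v q =
        form_l f v - form_a G v &
      forall r, in_M0h Omega T r -> form_b w r = 0].

Definition solves_I (T : seq (simplex R d)) f G wi w q :=
  [/\ in_X0h Omega T w, in_M0h Omega T q,
      forall v, in_X0h Omega T v ->
        form_a w v + form_c (fieldD wi G) w v - form_b v q =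
        form_l f v - form_a G v - form_c (fieldD wi G) G v &
      forall r, in_M0h Omega T r -> form_b w r = 0].

End forms.

Definition coefficient (eps0 am aM : R) (a : R -> R) :=
  [/\ forall t, eps0 <= t <= 1 -> 0 < a t,
      forall t, eps0 <= t <= 1 -> am <= a t <= aM &
      exists M : R, forall t, eps0 < t < 1 ->
        derivable a t 1 /\ 0 < derive1 a t <= M].

Definition porosity Omega (eps0 r : R) (eps : point -> R) :=
  [/\ in_Lp Omega +oo%E eps, in_W1p Omega r%:E eps &
      {ae leb R d, forall x, Omega x -> eps0 <= eps x <= 1}].

Definition discrete_porosity Omega (eps0 r C : R) (eps : point -> R)
    (T : seq (simplex R d)) (eh : point -> R) :=
  [/\ in_Mh Omega T eh,
      forall x, closure Omega x -> eps0 <= eh x <= 1,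
      (normLp Omega +oo (fun x => eps x - eh x)%R
         <= (C * mesh T)%R%:E * normW1p Omega +oo eps)%E &
      (normLp Omega r%:E (fun x => enorm (wgrad Omega eps x - wgrad Omega eh x))%R
         <= (C * mesh T)%R%:E * normW2p Omega r%:E eps)%E].

Definition boundary_datum Omega (eps : point -> R) g G :=
  [/\ in_Hhalf Omega g, in_X Omega G,
      forall i, is_trace Omega (coordf G i) (coordf g i),
      is_wdiv Omega (fun x => eps x *: G x) (fun=> 0) &
      normX Omega G <= normHhalf Omega g].

Definition sobolev_constants Omega (S C : R -> R) := forall p, 1 <= p <= 6 ->
  [/\ 0 < S p, 0 < C p,
      forall v, in_X Omega v ->
        (normLp Omega p%:E (fun x => enorm (v x)) <= (S p * normX Omega v)%R%:E)%E &
      forall v, in_X0 Omega v ->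
        (normLp Omega p%:E (fun x => enorm (v x)) <= (C p * semiX Omega v)%R%:E)%E].

Definition inf_sup Omega (eh : point -> R) (T : seq (simplex R d)) (gamma : R) :=
  forall q, in_M0h Omega T q ->
    ((gamma * normL2 Omega q)%R%:E <=
     ereal_sup [set (form_b Omega eh v q / semiX Omega v)%R%:E |
                  v in [set v | in_X0h Omega T v /\ (0 < semiX Omega v)%R]])%E.

(* The arguments G, v and v + G (v in X_0h) with the size m by which they enter
   the bounds on the trilinear forms. *)
Definition sized_arg Omega (T : seq (simplex R d)) G u (m : R) :=
  [\/ in_X0h Omega T u /\ m = semiX Omega u,
      u = G /\ m = normX Omega G |
      exists v, [/\ in_X0h Omega T v, u = fieldD v G &
                    m = semiX Omega v + normX Omega G]].

Definition trilinear_bound Omega (T : seq (simplex R d)) (eps : point -> R)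
    (t : (point -> point) -> (point -> point) -> (point -> point) -> R) (c : R) :=
  [/\ forall u v w, in_X0h Omega T u -> in_X0h Omega T v -> in_X0h Omega T w ->
        t u v w <= c * semiX Omega u * semiX Omega v * semiX Omega w,
      forall u v w, in_Xh Omega T u -> in_Xh Omega T v -> in_Xh Omega T w ->
        t u v w <= c * normX Omega u * normX Omega v * normX Omega w &
      forall g G, boundary_datum Omega eps g G ->
        forall u mu v mv w, sized_arg Omega T G u mu -> sized_arg Omega T G v mv ->
          in_X0h Omega T w -> t u v w <= c * mu * mv * semiX Omega w].

End problem.

(* Main.v *)
From mathcomp Require Import all_boot all_order all_algebra.
From mathcomp Require Import all_classical all_reals all_analysis.
From mathcomp Require Import measurable_realfun ring lra.
Require Import Defs.
Set Implicit Arguments.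
Unset Strict Implicit.
Unset Printing Implicit Defensive.
Import Order.TTheory GRing.Theory Num.Theory numFieldNormedType.Exports.
Local Open Scope classical_set_scope.
Local Open Scope ring_scope.

(** Why the iteration converges.

    Let e_i be the difference of the i-th iterate w_i and of the discrete
    solution w.  Subtracting the two problems gives, for every discrete v,
      a(e_(i+1), v) + c(w_i + G, e_(i+1), v)
        + (c(w_i + G, w + G, v) - c(w + G, w + G, v)) = b(v, p_(i+1) - p)
    (lemma [error_equation]).  For v = e_(i+1) the right-hand side vanishes,
    both fields being discretely divergence free; the second term is
    nonnegative, because the convection form is skew in its last two arguments
    ([form_d_skew]) and the drag is dissipative; the form a is coercive
    ([form_a_coercive]); and the bracket is Lipschitz in the advecting field
    ([form_c_lipschitz]).  Hence, with | | the H^1 seminorm,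
      (eps0 / Re) |e_(i+1)| <= K (|w| + |G|_X) |e_i|
    ([contraction]), and small data make this a contraction of factor 1/2.
    The discrete inf-sup condition then turns the error equation into a bound
    of p_(i+1) - p by |e_i| and |e_(i+1)| ([pressure_error]).

    The constant c_1 has to be independent of the mesh, so |w| must be bounded
    by the data uniformly in the mesh.  Testing the discrete problem with w
    reduces this to the load v |-> (eps_h f, v) ([apriori_bound]).  As f is
    measured in the dual of H^1_0, one needs multiplication by eps_h to be
    bounded on H^1_0 uniformly in the mesh ([form_l_bound]).  The gradient of
    eps_h is uniformly bounded in L^r for some r > d ([kgrad_Lr]); by Young's
    inequality, and the embedding of H^1_0 in L^6 in space or the iterated
    Gagliardo-Nirenberg inequality in the plane,
      int |grad eps_h|^2 phi^2 <= K int |grad phi|^2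
    for test functions phi ([test_power_bound], [kgrad_weight]).  The product
    eps_h phi is only piecewise smooth; mollification shows that it belongs to
    H^1_0 ([kinky_approx]).

    The weak derivatives and divergences in the forms are chosen
    representatives.  They become computable through integration by parts and
    the du Bois-Reymond lemma.  Integration by parts comes from translation
    invariance of the measure: a compactly supported function that is Lipschitz
    along a coordinate direction has a derivative of integral 0 in that
    direction ([integral_directional_derivative]).  It applies to eps_h phi
    because a continuous piecewise affine function is Lipschitz along lines
    ([lipschitz_closed_cover]).  Skew-symmetry needs the derivative of the
    square of an H^1_0 function; it is obtained from test functions converging
    in H^1 and, by the Sobolev inequality, in L^4 ([H10_cv4]). *)

(** * Topology and measure of the space of row vectors *)

Section rv_topology.
Context {R : realType} {n : nat}.
Implicit Types (x y : 'rV[R]_n) (U : set 'rV[R]_n).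

Lemma coord_le_norm x i : `|x ord0 i| <= `|x|.
Proof.
rewrite -[leRHS]/(mx_norm x) mx_normrE; apply/bigmax_geP; right => /=.
by exists (ord0, i).
Qed.

Lemma norm_le_coord x e : 0 <= e -> (forall i, `|x ord0 i| <= e) -> `|x| <= e.
Proof.
move=> e0 xe; rewrite -[leLHS]/(mx_norm x) mx_normrE; apply/bigmax_leP; split => //.
by move=> [i j] _ /=; rewrite ord1.
Qed.

Lemma continuous_rv_coord (i : 'I_n) : continuous (fun x : 'rV[R]_n => x ord0 i).
Proof. exact: coord_continuous. Qed.

Definition box (a b : 'I_n -> R) : set 'rV[R]_n :=
  [set x | forall i, a i < x ord0 i < b i].

Definition cbox (a b : 'I_n -> R) : set 'rV[R]_n :=
  [set x | forall i, a i <= x ord0 i <= b i].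

Lemma measurable_box a b : measurable (box a b).
Proof.
rewrite (_ : box a b = \bigcap_(i in [set: 'I_n])
    (setT `&` (fun y : 'rV[R]_n => y ord0 i) @^-1` `]a i, b i[%classic)).
  by apply: fin_bigcap_measurable => // i _; exact: measurable_rv_coord.
by apply/seteqP; split => [y xy i _|y xy i]; 
  [split => //=; rewrite in_itv/=|have [_ /=] := xy i Logic.I; rewrite in_itv].
Qed.

(** Every point of an open set lies in a box with rational centre and radius
    1/(k+1) whose closure stays in the set. *)
Lemma open_rv_boxes U : open U ->
  exists F : 'rV[rat]_n * nat -> set 'rV[R]_n, U = \bigcup_p F p /\
    forall p, F p = set0 \/ exists a b, F p = box a b /\ cbox a b `<=` U.
Proof.
move=> oU.
pose c (q : 'rV[rat]_n) i : R := ratr (q ord0 i).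
pose r (k : nat) : R := k.+1%:R^-1.
pose A (p : 'rV[rat]_n * nat) i := c p.1 i - r p.2.
pose B (p : 'rV[rat]_n * nat) i := c p.1 i + r p.2.
pose F (p : 'rV[rat]_n * nat) : set 'rV[R]_n :=
  if `[< cbox (A p) (B p) `<=` U >] then box (A p) (B p) else set0.
exists F; split; last first.
  move=> p; rewrite /F; case: asboolP => [h|_]; last by left.
  by right; exists (A p), (B p).
apply/seteqP; split => [x Ux|x [p _]]; last first.
  rewrite /F; case: asboolP => // pU px; apply: pU => i.
  by have /andP[? ?] := px i; rewrite !ltW.
have /nbhs_ballP[e /= e0 xeU] : nbhs x U by exact: open_nbhs_nbhs.
have [k ke] : exists k, r k < e / 2.
  have e20 : 0 < e / 2 by rewrite divr_gt0.
  by have [k _ ke] := @near_infty_natSinv_lt R (PosNum e20); exists k; exact: (ke k (leqnn k)).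
have /choice[q qx] : forall i, exists q : rat, `|ratr q - x ord0 i| < r k.
  move=> i.
  have : (x ord0 i - r k < x ord0 i + r k) by rewrite ltrD2l gtrN ?invr_gt0.
  move=> /rat_in_itvoo[q]; rewrite in_itv/= => /andP[q1 q2]; exists q.
  by rewrite ltr_distl q1 q2.
exists (\row_i q i, k) => //.
have cE i : c (\row_i q i) i = ratr (q i) by rewrite /c mxE.
rewrite /F; case: asboolP => [_|[] y qy].
  move=> i; rewrite /A /B/= cE; have := qx i; rewrite ltr_distl => /andP[h1 h2].
  by apply/andP; split; move: h1 h2; set z : R := ratr _; lra.
apply: xeU; split => // j i; rewrite (ord1 j) /ball/= ltr_distl.
have := qy i; have := qx i; rewrite /A /B/= cE ltr_distl.
by set z : R := ratr _; move=> /andP[h1 h2] /andP[h3 h4]; apply/andP; split; lra.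
Qed.

Lemma open_measurable_rv U : open U -> measurable U.
Proof.
move=> /open_rv_boxes[F [-> HF]].
apply: countable_bigcupT_measurable => [|p]; first exact: countableP.
by have [->//|[a [b [-> _]]]] := HF p; exact: measurable_box.
Qed.

Lemma closed_measurable_rv U : closed U -> measurable U.
Proof. move=> cU; rewrite -(setCK U); apply: measurableC.
by apply: open_measurable_rv; exact: closed_openC. Qed.

Lemma compact_measurable_rv U : compact U -> measurable U.
Proof.
move=> cU; apply: closed_measurable_rv.
by apply: compact_closed => //; exact: (@norm_hausdorff R 'rV[R]_n).
Qed.

Lemma continuous_measurable_rv U (f : 'rV[R]_n -> R) : open U ->
  (forall x, U x -> {for x, continuous f}) -> measurable_fun U f.
Proof.
move=> oU cf; apply: (measurability _ (RGenOpens.measurableE R)) => _ [_ [a [b ->]] <-].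
apply: open_measurable_rv.
rewrite openE => x [Ux Afx]; apply: filterI; first exact: open_nbhs_nbhs.
by apply: cf => //; exact: open_nbhs_nbhs.
Qed.

Lemma continuousT_measurable_rv (f : 'rV[R]_n -> R) : continuous f ->
  measurable_fun setT f.
Proof.
move=> cf; apply: (@continuous_measurable_rv [set: 'rV[R]_n]) => [|x _]; last exact: cf.
exact: openT.
Qed.

Lemma compact_cbox a b : compact (cbox a b).
Proof.
have -> : cbox a b = [set v | forall i, (`[a i, b i]%classic : set R) (v ord0 i)].
  by apply/seteqP; split => x xi i; have := xi i; rewrite /= in_itv.
by apply: (@rV_compact R n (fun i => `[a i, b i]%classic)) => i; exact: segment_compact.
Qed.

Lemma measurable_cbox a b : measurable (cbox a b).
Proof. by apply: compact_measurable_rv; exact: compact_cbox. Qed.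

Lemma bounded_closed_compact_rv U M : closed U -> (forall x, U x -> `|x| <= M) -> compact U.
Proof.
move=> cU UM; apply: bounded_closed_compact => //; exists `|M|; split; first exact: num_real.
by move=> N MN x /UM xM; apply: le_trans xM _; apply: le_trans (ltW MN); exact: ler_norm.
Qed.

Definition open_boxes : set_system 'rV[R]_n := [set A | exists a b, A = box a b].

(** Boxes are stable under intersection; this is what a Dynkin induction from
    boxes to Borel sets asks of a generating family. *)
Lemma measurable_gen_boxes : (measurable : set_system 'rV[R]_n) = <<s open_boxes >>.
Proof.
apply/seteqP; split; last first.
  apply: smallest_sub; first exact: sigma_algebra_measurable.
  by move=> _ [a [b ->]]; exact: measurable_box.
have oG (V : set 'rV[R]_n) : open V -> <<s open_boxes >> V.
  move=> /open_rv_boxes[F [-> HF]].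
  apply: (@countable_bigcupT_measurable _ (g_sigma_algebraType open_boxes)) => [|p].
    exact: countableP.
  have [->|[a [b [-> _]]]] := HF p; first exact: sigma_algebra0.
  by apply: sub_sigma_algebra; exists a, b.
apply: smallest_sub; first exact: smallest_sigma_algebra.
move=> A; rewrite -bigcup_seq/= => -[i _ [B mB <-]]; rewrite setTI.
have {}mB : @measurable _ (g_sigma_algebraType (@RGenOpens.G R)) B.
  by rewrite -(RGenOpens.measurableE R); exact: mB.
have {}mB : (<<s @RGenOpens.G R >>) B by exact: mB.
move: B mB.
apply: smallest_sub => [|_ [x [y ->]]].
  split => [|C HC|F HF].
  - by rewrite /= preimage_set0; exact: sigma_algebra0.
  - by rewrite /= setTD preimage_setC; exact: sigma_algebraC.
  - by rewrite /= preimage_bigcup; exact: sigma_algebra_bigcup.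
apply: oG; apply: open_comp; last exact: interval_open.
by move=> z _; exact: continuous_rv_coord.
Qed.

End rv_topology.

Lemma rv_cons0 (R : realType) n (t : R) (y : 'rV[R]_n) : rv_cons (t, y) ord0 ord0 = t.
Proof. by have := congr1 fst (rv_consK (t, y)). Qed.

Lemma rv_consS (R : realType) n (t : R) (y : 'rV[R]_n) i :
  rv_cons (t, y) ord0 (lift ord0 i) = y ord0 i.
Proof.
rewrite /rv_cons mxE; case: splitP => k; first by rewrite (ord1 k).
by move=> /= -[ik]; congr (y _ _); exact/val_inj.
Qed.

Lemma leb_cbox_fin (R : realType) n (a b : 'I_n -> R) : (leb R n (cbox a b) < +oo)%E.
Proof.
elim: n a b => [|n ih] a b.
  have -> : leb R 0 (cbox a b) = dirac (const_mx 0 : 'rV[R]_0) (cbox a b) :> \bar R by [].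
  by rewrite diracE; case: (_ \in _); rewrite ltry.
rewrite [X in (X < _)%E](_ : _ =
  lebesgue_step (leb R n) (cbox a b))//.
rewrite /lebesgue_step /pushforward.
rewrite (_ : _ @^-1` _ = `[a ord0, b ord0]%classic `*`
   cbox (fun i => a (lift ord0 i)) (fun i => b (lift ord0 i))).
  rewrite product_measure1E//; last exact: measurable_cbox.
  apply: lte_mul_pinfty; [exact: measure_ge0| |exact: ih].
  rewrite -[X in X \is a fin_num]/(lebesgue_measure `[a ord0, b ord0]%classic).
  rewrite lebesgue_measure_itv/=; case: ifP => // _.
apply/seteqP; split => [[t y]/= ty|[t y]/= [] tt yy i].
  split; first by rewrite in_itv/= -[t](rv_cons0 t y); exact: ty.
  by move=> i; rewrite -(rv_consS t y i); exact: ty.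
case: (unliftP ord0 i) => [j ->|->]; last by rewrite rv_cons0; rewrite /= in_itv in tt.
by have -> : rv_cons (t, y) ord0 (lift ord0 j) = y ord0 j := rv_consS t y j; exact: yy.
Qed.

Lemma leb_bounded_fin (R : realType) n (A : set 'rV[R]_n) : measurable A ->
  bounded_set A -> (leb R n A < +oo)%E.
Proof.
move=> mA [M [_ AM]].
apply: le_lt_trans (leb_cbox_fin (fun=> - (M + 1)) (fun=> M + 1)).
apply: le_measure; rewrite ?inE//; first exact: measurable_cbox.
move=> x Ax i; have xM : `|x| <= M + 1 by apply: (AM (M + 1)) => //; rewrite ltrDl.
rewrite -ler_norml.
exact: le_trans (coord_le_norm _ _) xM.
Qed.

Section leb_facts.
Context {R : realType}.
Local Open Scope ereal_scope.

Lemma ge0_integral_leb_step n (f : 'rV[R]_n.+1 -> \bar R) :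
  measurable_fun setT f -> (forall x, 0 <= f x) ->
  \int[leb R n.+1]_x f x =
  \int[@lebesgue_measure R]_t \int[leb R n]_y f (rv_cons (t, y)).
Proof.
move=> mf f0.
rewrite [LHS](_ : _ = \int[pushforward (@lebesgue_measure R \x leb R n) (@rv_cons R n)]_x f x)//.
rewrite ge0_integral_pushforward//=; last exact: measurable_rv_cons.
rewrite preimage_setT fubini_tonelli1//.
by apply: measurableT_comp => //; exact: measurable_rv_cons.
Qed.

Lemma lebesgue_measure_translate (s : R) (A : set R) : measurable A ->
  pushforward (@lebesgue_measure R) (fun t : measurableTypeR R => (t + s)%R : measurableTypeR R) A
   = lebesgue_measure A.
Proof.
move=> mA; apply/esym.
have ms : measurable_fun setT (fun t : measurableTypeR R => (t + s)%R : measurableTypeR R).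
  exact: measurable_funD.
pose m := (measure_function_pushforward__canonical__measure_function_Measure (@lebesgue_measure R) ms).
apply: (lebesgue_measure_unique (mu := m)) => //= _ [[a b]] _ <-; rewrite /pushforward.
rewrite (_ : _ @^-1` _ = `](a - s)%R, (b - s)%R]%classic).
  rewrite !lebesgue_measure_itv/= !lte_fin ltrD2r -EFinD; congr (if _ then _ else _).
  by congr EFin; lra.
by apply/seteqP; split => t /=; rewrite !in_itv/= => /andP[? ?]; apply/andP; split; lra.
Qed.

Lemma ge0_integral_lebesgue_translate (s : R) (f : R -> \bar R) :
  measurable_fun setT f -> (forall x, 0 <= f x) ->
  \int[@lebesgue_measure R]_t f (t + s)%R = \int[@lebesgue_measure R]_t f t.
Proof.
move=> mf f0.
have ms : measurable_fun setT (fun t : measurableTypeR R => (t + s)%R : measurableTypeR R).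
  exact: measurable_funD.
transitivity (\int[pushforward (@lebesgue_measure R) (fun t : measurableTypeR R => (t + s)%R : measurableTypeR R)]_x f x).
  by rewrite ge0_integral_pushforward.
by apply: eq_measure_integral => A mA _; exact: lebesgue_measure_translate.
Qed.

Lemma rv_consD n t s (x y : 'rV[R]_n) :
  (rv_cons (t, x) + rv_cons (s, y) = rv_cons (t + s, x + y))%R.
Proof.
rewrite /rv_cons/= raddfD; apply/rowP => i; rewrite !mxE.
by case: splitP => j _; rewrite !mxE.
Qed.

Lemma rv_unconsK n : cancel (@rv_uncons R n) (@rv_cons R n).
Proof.
move=> x; apply/rowP => i; rewrite /rv_cons /rv_uncons/=.
rewrite mxE; case: splitP => j ij.
  by rewrite mxE (ord1 j) mulr1n; congr (x _ _); apply/val_inj; rewrite /= ij (ord1 j).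
by rewrite mxE; congr (x _ _); apply/val_inj; rewrite /= ij.
Qed.

Lemma measurable_rv_translate n (v : 'rV[R]_n) : measurable_fun setT (fun x : 'rV[R]_n => (x + v)%R).
Proof.
apply: measurable_fun_rvP => i.
rewrite (_ : (fun _ => _) = (fun x : 'rV[R]_n => x ord0 i + v ord0 i)%R); last first.
  by apply/funext => x; rewrite mxE.
by apply: measurable_funD => //; exact: measurable_rv_coord.
Qed.

(** Translation invariance is inherited coordinate by coordinate from the line. *)
Lemma ge0_integral_leb_translate n (v : 'rV[R]_n) (f : 'rV[R]_n -> \bar R) :
  measurable_fun setT f -> (forall x, 0 <= f x) ->
  \int[leb R n]_x f (x + v)%R = \int[leb R n]_x f x.
Proof.
elim: n v f => [|n ih] v f mf f0.
  by apply: eq_integral => x _; congr f; apply/rowP => -[].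
rewrite ge0_integral_leb_step; last 2 first.
- by apply: (measurableT_comp mf); exact: measurable_rv_translate.
- by move=> x; exact: f0.
rewrite (ge0_integral_leb_step mf f0).
have -> : v = rv_cons (rv_uncons v) by rewrite rv_unconsK.
case: (rv_uncons v) => s w.
have mfc : measurable_fun setT (f \o @rv_cons R n).
  by apply: measurableT_comp => //; exact: measurable_rv_cons.
rewrite -[RHS](@ge0_integral_lebesgue_translate s); last 2 first.
- have := @measurable_fun_fubini_tonelli_F _ _ _ _ _ (leb R n) (f \o @rv_cons R n).
  by apply => // x; exact: f0.
- by move=> t; apply: integral_ge0 => y _; exact: f0.
apply: eq_integral => t _.
under eq_integral do rewrite rv_consD.
rewrite (ih w (fun y => f (rv_cons (t + s, y))%R))//.
by apply: (measurableT_comp mfc) => //; exact: measurable_pair1.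
Qed.

Lemma leb_null_sections n (N : set 'rV[R]_n.+1) : measurable N ->
  {ae @lebesgue_measure R, forall t, leb R n [set y | N (rv_cons (t, y))] = 0} ->
  leb R n.+1 N = 0.
Proof.
move=> mN N0.
have mi : measurable_fun setT (EFin \o (\1_N : 'rV[R]_n.+1 -> R)) by exact/measurable_EFinP.
have -> : leb R n.+1 N = \int[leb R n.+1]_x (\1_N x)%:E by rewrite integral_indic// setIT.
rewrite ge0_integral_leb_step; [|exact: mi|by move=> x; rewrite lee_fin].
have ms t : measurable [set y | N (rv_cons (t, y))].
  have mc : measurable_fun setT (fun y => rv_cons (t, y) : 'rV[R]_n.+1).
    by apply: measurableT_comp; [exact: measurable_rv_cons|exact: measurable_pair1].
  by rewrite -[X in measurable X]setTI; exact: (mc measurableT _ mN).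
transitivity (\int[@lebesgue_measure R]_t leb R n [set y | N (rv_cons (t, y))]).
  apply: eq_integral => t _.
  rewrite -[in RHS](setIT [set y | _]) -integral_indic//.
transitivity (\int[@lebesgue_measure R]_t (cst 0 t)); last by rewrite integral0.
apply: ge0_ae_eq_integral => //.
  have := @measurable_fun_fubini_tonelli_F _ _ _ _ _ (leb R n) (fun p => (\1_N (rv_cons p))%:E).
  move=> /(_ _ _); rewrite /fubini_F => h.
  rewrite (_ : (fun t => _) = (fun t => \int[leb R n]_y (\1_N (rv_cons (t, y)))%:E)).
    apply: h; last by move=> x; rewrite lee_fin.
    by apply: (measurableT_comp mi); exact: measurable_rv_cons.
  by apply/funext => t; rewrite -[in LHS](setIT [set y | _]) -integral_indic.
move: N0 => [M [mM M0 NM]]; exists M; split=> //.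
by apply: subset_trans NM => t /= nt N0; apply: nt.
Qed.

Lemma integral_leb_translate n (v : 'rV[R]_n) (f : 'rV[R]_n -> \bar R) :
  measurable_fun setT f ->
  \int[leb R n]_x f (x + v)%R = \int[leb R n]_x f x.
Proof.
move=> mf; rewrite integralE [RHS]integralE; congr (_ - _).
- transitivity (\int[leb R n]_x (f^\+ (x + v)%R)); first by apply: eq_integral => x _; rewrite unlock.
  exact: (ge0_integral_leb_translate v (measurable_funepos mf) (fun x => funepos_ge0 f x)).
- transitivity (\int[leb R n]_x (f^\- (x + v)%R)); first by apply: eq_integral => x _; rewrite unlock.
  exact: (ge0_integral_leb_translate v (measurable_funeneg mf) (fun x => funeneg_ge0 f x)).
Qed.

(** Slice along the first coordinate.  A slice is again given by an affine
    equation; if its linear part vanishes, all slices but one are empty. *)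
Lemma leb_affine_null n (a : 'I_n -> R) (c : R) : (exists i, a i != 0%R) ->
  leb R n [set x | \sum_i a i * x ord0 i + c = 0]%R = 0.
Proof.
elim: n a c => [|n ih] a c [i ai]; first by case: i ai.
have mN : measurable [set x : 'rV[R]_n.+1 | \sum_i a i * x ord0 i + c = 0]%R.
  have mf : measurable_fun setT (fun x : 'rV[R]_n.+1 => \sum_i a i * x ord0 i + c)%R.
    apply: measurable_funD => //; apply: measurable_sum => j.
    by apply: measurable_funM => //; exact: measurable_rv_coord.
  by have := mf measurableT _ (measurable_set1 0%R); rewrite setTI.
apply: leb_null_sections => //.
have secE t : [set y | [set x : 'rV[R]_n.+1 | \sum_i a i * x ord0 i + c = 0]%R (rv_cons (t, y))] =
    [set y : 'rV[R]_n | \sum_j a (lift ord0 j) * y ord0 j + (a ord0 * t + c) = 0]%R.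
  apply/funext => y /=; rewrite big_ord_recl rv_cons0.
  have E (j : 'I_n) : rv_cons (t, y) ord0 (lift ord0 j) = y ord0 j := rv_consS t y j.
  rewrite (eq_bigr (fun j => a (lift ord0 j) * y ord0 j)%R); last by move=> j _; rewrite E.
  by rewrite [(_ + \sum_(_ < _) _)%R]addrC addrA.
have [[j aj]|na] := pselect (exists j, a (lift ord0 j) != 0%R).
  by apply: aeW => t; rewrite secE; apply: ih; exists j.
have a0 : a ord0 != 0%R.
  by case: (unliftP ord0 i) ai => [j -> aj|-> //]; exfalso; apply: na; exists j.
exists [set - c / a ord0]%R; split => //; first exact: lebesgue_measure_set1.
move=> t /= /[!secE] nt; apply: contrapT => tc; apply: nt.
rewrite (_ : [set y | _] = set0) ?measure0//.
rewrite -subset0 => y /=; rewrite big1 ?add0r => [|j _].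
  by move=> atc; apply: tc; have /eqP := atc; rewrite addr_eq0 => /eqP <-; rewrite mulrC mulKf.
by have [->|aj] := eqVneq (a (lift ord0 j)) 0%R; [rewrite mul0r|exfalso; apply: na; exists j].
Qed.

End leb_facts.

(** * Integrals and convergence in the mean *)

(** The discriminant of a nonnegative quadratic; this gives the Cauchy-Schwarz
    inequality without division by a norm that may vanish. *)
Lemma quadratic_ge0 (R : realFieldType) (a b c : R) : 0 <= a -> 0 <= b ->
  (forall t, 0 <= a + 2 * t * c + t ^+ 2 * b) -> c ^+ 2 <= a * b.
Proof.
move=> a0 b0 H.
have [b00|bn0] := eqVneq b 0; last first.
  have bp : 0 < b by rewrite lt_neqAle eq_sym bn0.
  have := H (- c / b); have -> : a + 2 * (- c / b) * c + (- c / b) ^+ 2 * b = a - c ^+ 2 / b by field.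
  by rewrite subr_ge0 ler_pdivrMr.
rewrite b00 mulr0.
have [->|cn0] := eqVneq c 0; first by rewrite expr0n.
have := H (- (a + 1) / (2 * c)); rewrite b00 mulr0 addr0.
have -> : a + 2 * (- (a + 1) / (2 * c)) * c = -1 by field.
by rewrite oppr_ge0 ler10.
Qed.

Section integration.
Context d (T : measurableType d) (R : realType) (mu : {measure set T -> \bar R}).
Variable D : set T.
Hypothesis mD : measurable D.
Implicit Types f g h : T -> R.

Local Notation Int f := (mu.-integrable D (EFin \o f)).
Local Notation I f := (\int[mu]_(x in D) f x).

Lemma int_meas f : Int f -> measurable_fun D f.
Proof. by move/measurable_int/measurable_EFinP. Qed.

Lemma int_dom f g : measurable_fun D f -> Int g ->
  (forall x, D x -> `|f x| <= g x) -> Int f.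
Proof.
move=> mf ig fg; apply: le_integrable ig => //; first exact/measurable_EFinP.
move=> x Dx /=; rewrite lee_fin; apply: le_trans (fg _ Dx) _; exact: ler_norm.
Qed.

Lemma intD f g : Int f -> Int g -> Int (fun x => f x + g x).
Proof. by move=> If Ig; have := integrableD mD If Ig. Qed.

Lemma intB f g : Int f -> Int g -> Int (fun x => f x - g x).
Proof. by move=> If Ig; have := integrableB mD If Ig. Qed.

Lemma intZ k f : Int f -> Int (fun x => k * f x).
Proof. by move=> If; have := integrableZl mD k If. Qed.

Lemma int0 : Int (fun=> 0).
Proof. exact: integrable0. Qed.

Lemma int_sum (J : finType) (F : J -> T -> R) :
  (forall j, Int (F j)) -> Int (fun x => \sum_j F j x).
Proof.
move=> IF; elim: (index_enum J) => [|j s ih].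
  by rewrite (_ : (fun x => _) = fun=> 0); [exact: int0|apply/funext => x; rewrite big_nil].
rewrite (_ : (fun x => _) = fun x => F j x + \sum_(i <- s) F i x); first exact: intD.
by apply/funext => x; rewrite big_cons.
Qed.

Lemma int_abs f : Int f -> Int (fun x => `|f x|).
Proof. by move=> If; have := integrable_abse If. Qed.

Lemma int_eq f g : (forall x, D x -> f x = g x) -> Int f -> Int g.
Proof.
move=> fg; apply: eq_integrable => // x; rewrite inE => Dx /=; rewrite fg//.
Qed.

Lemma eqI f g : (forall x, D x -> f x = g x) -> I f = I g.
Proof. by move=> fg; apply: eq_Rintegral => x; rewrite inE; exact: fg. Qed.

Lemma I_N f : Int f -> I (fun x => - f x) = - I f.
Proof.
move=> If; rewrite -mulN1r -RintegralZl//; apply: eqI => x _; by rewrite mulN1r.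
Qed.

Lemma I_sum (J : finType) (F : J -> T -> R) :
  (forall j, Int (F j)) -> I (fun x => \sum_j F j x) = \sum_j I (F j).
Proof.
move=> IF; have IFs s : Int (fun x => \sum_(j <- s) F j x).
  elim: s => [|j s ih].
    by rewrite (_ : (fun x => _) = fun=> 0); [exact: int0|apply/funext => x; rewrite big_nil].
  rewrite (_ : (fun x => _) = fun x => F j x + \sum_(i <- s) F i x); first exact: intD.
  by apply/funext => x; rewrite big_cons.
elim: (index_enum J) => [|j s ih].
  rewrite big_nil; under eq_Rintegral do rewrite big_nil.
  by rewrite /Rintegral integral0.
rewrite big_cons -ih -RintegralD//.
by apply: eqI => x _; rewrite big_cons.
Qed.

Lemma I_le f g : Int f -> Int g -> (forall x, D x -> f x <= g x) -> I f <= I g.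
Proof. exact: le_Rintegral. Qed.

Lemma int_ae f g : {ae mu, forall x, D x -> f x = g x} -> measurable_fun D g ->
  Int f -> Int g.
Proof.
move=> fg mg If; apply/integrableP; split; first exact/measurable_EFinP.
have /integrableP[mf] := If; apply: le_lt_trans.
rewrite le_eqVlt; apply/orP; left; apply/eqP; apply: ae_eq_integral => //.
- by apply: measurableT_comp => //; exact/measurable_EFinP.
- by apply: measurableT_comp => //; exact: measurable_int If.
- by apply: filterS fg => x /= h Dx; rewrite h.
Qed.

Lemma I_ae f g : {ae mu, forall x, D x -> f x = g x} -> measurable_fun D f ->
  measurable_fun D g -> I f = I g.
Proof.
move=> fg mf mg; rewrite /Rintegral; congr fine; apply: ae_eq_integral => //.
- exact/measurable_EFinP.
- exact/measurable_EFinP.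
- by apply: filterS fg => x /= h Dx; rewrite h.
Qed.

Lemma I_abs_le f g : measurable_fun D f -> Int g ->
  (forall x, D x -> `|f x| <= g x) -> `|I f| <= I g.
Proof.
move=> mf Ig fg; have If := int_dom mf Ig fg.
by apply: le_trans (le_normr_Rintegral mD If) _; apply: I_le => //; exact: int_abs.
Qed.

(** ** Square-integrable functions *)

Definition sqi f := measurable_fun D f /\ Int (fun x => f x ^+ 2).
Definition nsq f : R := I (fun x => f x ^+ 2).

Lemma nsq_ge0 f : 0 <= nsq f.
Proof. by apply: Rintegral_ge0 => x _; exact: sqr_ge0. Qed.

Lemma sqiM f g : sqi f -> sqi g -> Int (fun x => f x * g x).
Proof.
move=> [mf If] [mg Ig]; apply: (@int_dom _ (fun x => f x ^+ 2 + g x ^+ 2)).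
- exact: measurable_funM.
- exact: intD.
- move=> x _; rewrite normrM -(real_normK (num_real (f x))) -(real_normK (num_real (g x))).
  have := sqr_ge0 (`|f x| - `|g x|); have := mulr_ge0 (normr_ge0 (f x)) (normr_ge0 (g x)).
  by nra.
Qed.

Lemma sqiD f g : sqi f -> sqi g -> sqi (fun x => f x + g x).
Proof.
move=> sf sg; split; first by apply: measurable_funD; [exact: sf.1|exact: sg.1].
have h := intD (intD sf.2 sg.2) (intZ 2 (sqiM sf sg)).
by apply: int_eq h => x _; ring.
Qed.

Lemma sqiZ k f : sqi f -> sqi (fun x => k * f x).
Proof.
move=> sf; split; first by apply: measurable_funM => //; exact: sf.1.
by apply: int_eq (intZ (k ^+ 2) sf.2) => x _; ring.
Qed.

Lemma sqiN f : sqi f -> sqi (fun x => - f x).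
Proof.
move=> sf; split; first by apply: measurableT_comp => //; exact: sf.1.
by apply: int_eq sf.2 => x _; ring.
Qed.

Lemma sqiB f g : sqi f -> sqi g -> sqi (fun x => f x - g x).
Proof. by move=> sf sg; have := sqiD sf (sqiN sg). Qed.

Lemma sqi0 : sqi (fun=> 0).
Proof. by split => //; apply: int_eq int0 => x _; ring. Qed.

Lemma sqi_sum (J : finType) (F : J -> T -> R) :
  (forall j, sqi (F j)) -> sqi (fun x => \sum_j F j x).
Proof.
move=> IF; elim: (index_enum J) => [|j s ih].
  by rewrite (_ : (fun x => _) = fun=> 0); [exact: sqi0|apply/funext => x; rewrite big_nil].
rewrite (_ : (fun x => _) = fun x => F j x + \sum_(i <- s) F i x); first exact: sqiD.
by apply/funext => x; rewrite big_cons.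
Qed.

Lemma sqi_dom f g : measurable_fun D f -> sqi g ->
  (forall x, D x -> `|f x| <= `|g x|) -> sqi f.
Proof.
move=> mf sg fg; split => //; apply: int_dom sg.2 _.
  exact: measurable_funX.
move=> x Dx; rewrite normrX -(real_normK (num_real (g x))).
by rewrite lerXn2r ?nnegrE// fg.
Qed.

Lemma sqi_bdM c f g : measurable_fun D f -> (forall x, D x -> `|f x| <= c) ->
  sqi g -> sqi (fun x => f x * g x).
Proof.
move=> mf fc sg; apply: (sqi_dom (g := fun x => c * g x)); last 2 first.
- exact: sqiZ.
- move=> x Dx; rewrite !normrM ler_wpM2r//; apply: le_trans (fc _ Dx) _; exact: ler_norm.
by apply: measurable_funM => //; exact: sg.1.
Qed.

Lemma sqi_ae f g : {ae mu, forall x, D x -> f x = g x} -> measurable_fun D g ->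
  sqi f -> sqi g.
Proof.
move=> fg mg sf; split => //; apply: int_ae sf.2; last exact: measurable_funX.
by apply: filterS fg => x h Dx; rewrite h.
Qed.

Lemma eq_sqi f g : (forall x, D x -> f x = g x) -> sqi f -> sqi g.
Proof.
move=> fg [mf If]; split; first by apply: eq_measurable_fun mf => x; rewrite inE; exact: fg.
by apply: int_eq If => x Dx; rewrite fg.
Qed.

Lemma nsqZ k f : sqi f -> nsq (fun x => k * f x) = k ^+ 2 * nsq f.
Proof.
by move=> sf; rewrite /nsq -RintegralZl//; [apply: eqI => x _; ring|exact: sf.2].
Qed.

Lemma cauchy_schwarz_sqr f g : sqi f -> sqi g ->
  I (fun x => f x * g x) ^+ 2 <= nsq f * nsq g.
Proof.
move=> sf sg; set c := I _; set a := nsq f; set b := nsq g.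
apply: quadratic_ge0 => [||t]; [exact: nsq_ge0|exact: nsq_ge0|].
have -> : a + 2 * t * c + t ^+ 2 * b = nsq (fun x => f x + t * g x).
    rewrite /a /b /c /nsq -RintegralZl//; last exact: sqiM.
    rewrite -RintegralZl//; last exact: sg.2.
    rewrite -RintegralD//; last 2 first.
    - exact: sf.2.
    - by apply: intZ; exact: sqiM.
    rewrite -RintegralD//; last 2 first.
    - by apply: intD; [exact: sf.2|apply: intZ; exact: sqiM].
    - by apply: intZ; exact: sg.2.
    by apply: eqI => x _; ring.
exact: nsq_ge0.
Qed.

Lemma cauchy_schwarz f g : sqi f -> sqi g ->
  `|I (fun x => f x * g x)| <= Num.sqrt (nsq f) * Num.sqrt (nsq g).
Proof.
move=> sf sg; rewrite -sqrtrM ?nsq_ge0// -sqrtr_sqr ler_sqrt ?cauchy_schwarz_sqr//.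
by rewrite mulr_ge0 ?nsq_ge0.
Qed.

(** ** Convergence in the mean of order two *)

Definition cvg2 (f_ : nat -> T -> R) f :=
  [/\ forall n, sqi (f_ n), sqi f & nsq (fun x => f_ n x - f x) @[n --> \oo] --> 0].

Lemma cvg2_cst f : sqi f -> cvg2 (fun=> f) f.
Proof.
move=> sf; split => //; rewrite (_ : (fun n => _) = cst 0); first exact: cvg_cst.
apply/funext => n; rewrite /nsq; under eq_Rintegral do rewrite subrr expr0n.
by rewrite /Rintegral integral0.
Qed.

Lemma nsqD_le f g : sqi f -> sqi g ->
  nsq (fun x => f x + g x) <= 2 * (nsq f + nsq g).
Proof.
move=> sf sg; rewrite /nsq -RintegralD//; [|exact: sf.2|exact: sg.2].
rewrite -RintegralZl//; last by apply: intD; [exact: sf.2|exact: sg.2].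
apply: I_le.
- exact: (sqiD sf sg).2.
- by apply: intZ; apply: intD; [exact: sf.2|exact: sg.2].
- by move=> x _; have := sqr_ge0 (f x - g x); nra.
Qed.

Lemma cvg2_0le (a b : nat -> R) : (forall n, 0 <= a n <= b n) -> b @ \oo --> 0 ->
  a @ \oo --> 0.
Proof.
move=> ab b0; apply: (@squeeze_cvgr _ _ _ _ (cst 0) b) => //; last exact: cvg_cst.
by apply: nearW => n; exact: ab.
Qed.

Lemma cvg2D (f_ g_ : nat -> T -> R) f g : cvg2 f_ f -> cvg2 g_ g ->
  cvg2 (fun n x => f_ n x + g_ n x) (fun x => f x + g x).
Proof.
move=> [sf_ sf cf] [sg_ sg cg]; split => [n||]; [exact: sqiD|exact: sqiD|].
apply: (@cvg2_0le _ (fun n => 2 * (nsq (fun x => f_ n x - f x) + nsq (fun x => g_ n x - g x)))).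
  move=> n; rewrite nsq_ge0/=.
  apply: le_trans (nsqD_le (sqiB (sf_ n) sf) (sqiB (sg_ n) sg)).
  by rewrite le_eqVlt; apply/orP; left; apply/eqP; apply: eqI => x _; ring.
have -> : 0 = 2 * (0 + 0) :> R by ring.
by apply: cvgMr; exact: cvgD.
Qed.

Lemma cvg2_bdM c h (f_ : nat -> T -> R) f : measurable_fun D h -> (forall x, D x -> `|h x| <= c) ->
  cvg2 f_ f -> cvg2 (fun n x => h x * f_ n x) (fun x => h x * f x).
Proof.
move=> mh hc [sf_ sf cf].
split => [n||]; [exact: (sqi_bdM (c := c))|exact: (sqi_bdM (c := c))|].
apply: (@cvg2_0le _ (fun n => c ^+ 2 * nsq (fun x => f_ n x - f x))).
  move=> n; rewrite nsq_ge0/= -nsqZ; last exact: sqiB.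
  have sB := sqiB (sf_ n) sf; apply: I_le.
  - by apply: int_eq (sqi_bdM mh hc sB).2 => x _; ring.
  - exact: (sqiZ _ sB).2.
  - move=> x Dx; rewrite -mulrBr !exprMn ler_wpM2r ?sqr_ge0//.
    by rewrite -(real_normK (num_real (h x))) lerXn2r ?nnegrE ?hc// (le_trans _ (hc _ Dx)).
have -> : 0 = c ^+ 2 * 0 :> R by ring.
exact: cvgMr.
Qed.

Lemma cvg2Z k (f_ : nat -> T -> R) f : cvg2 f_ f -> cvg2 (fun n x => k * f_ n x) (fun x => k * f x).
Proof. by move=> h; exact: (@cvg2_bdM `|k| (fun=> k)). Qed.

Lemma sqrt_cvg0 (a : nat -> R) : a @ \oo --> 0 -> Num.sqrt (a n) @[n --> \oo] --> 0.
Proof.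
by move=> a0; rewrite -[X in _ --> X]sqrtr0; apply: cvg_comp a0 _; exact: sqrt_continuous.
Qed.

Lemma cvg2M (f_ g_ : nat -> T -> R) f g : cvg2 f_ f -> cvg2 g_ g ->
  I (fun x => f_ n x * g_ n x) @[n --> \oo] --> I (fun x => f x * g x).
Proof.
move=> [sf_ sf cf] [sg_ sg cg]; apply/subr_cvg0.
pose a n := Num.sqrt (nsq (fun x => f_ n x - f x)).
pose b n := Num.sqrt (nsq (fun x => g_ n x - g x)).
have a0 : a @ \oo --> 0 by exact: sqrt_cvg0.
have b0 : b @ \oo --> 0 by exact: sqrt_cvg0.
apply/norm_cvg0P.
apply: (@cvg2_0le _ (fun n => a n * b n + (a n * Num.sqrt (nsq g) + Num.sqrt (nsq f) * b n))).
  move=> n; rewrite normr_ge0/=.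
  have -> : I (fun x => f_ n x * g_ n x) - I (fun x => f x * g x) =
     I (fun x => (f_ n x - f x) * (g_ n x - g x)) +
     (I (fun x => (f_ n x - f x) * g x) + I (fun x => f x * (g_ n x - g x))).
    have sfB := sqiB (sf_ n) sf; have sgB := sqiB (sg_ n) sg.
    rewrite -RintegralB//; [|exact: sqiM|exact: sqiM].
    rewrite -RintegralD//; [|exact: sqiM|exact: sqiM].
    rewrite -RintegralD//; [|exact: sqiM|by apply: intD; exact: sqiM].
    by apply: eqI => x _; ring.
  apply: le_trans (ler_normD _ _) _; apply: lerD; first by apply: cauchy_schwarz; exact: sqiB.
  apply: le_trans (ler_normD _ _) _; apply: lerD; apply: cauchy_schwarz => //; exact: sqiB.
have -> : 0 = 0 * 0 + (0 * Num.sqrt (nsq g) + Num.sqrt (nsq f) * 0) :> R by ring.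
apply: cvgD; first exact: cvgM.
by apply: cvgD; [apply: cvgMl|apply: cvgMr].
Qed.

Lemma cvg2_nsq (f_ : nat -> T -> R) f : cvg2 f_ f -> nsq (f_ n) @[n --> \oo] --> nsq f.
Proof. by move=> cf; have := cvg2M cf cf. Qed.

Hypothesis muD : (mu D < +oo)%E.

Lemma int_cst c : Int (fun=> c).
Proof.
apply/integrableP; split; first exact/measurable_EFinP/measurable_cst.
rewrite (_ : (\int[mu]_(x in D) _)%E = (\int[mu]_(x in D) (cst `|c|%:E x))%E)//.
by rewrite integral_cst//=; apply: lte_mul_pinfty.
Qed.

Lemma sqi_bd c f : measurable_fun D f -> (forall x, D x -> `|f x| <= c) -> sqi f.
Proof.
move=> mf fc; split => //; apply: int_dom (int_cst (c ^+ 2)) _; first exact: measurable_funX.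
move=> x Dx; rewrite normrX lerXn2r ?nnegrE ?fc//; exact: le_trans (fc _ Dx).
Qed.

Lemma sqi_int f : sqi f -> Int f.
Proof.
move=> sf; have s1 := sqi_bd (c := 1) (f := fun=> 1).
by apply: int_eq (sqiM sf (s1 _ _)) => [x _||x _]; rewrite ?mulr1// normr1.
Qed.

End integration.

(** * Smooth functions and test functions *)

Section smooth_line.
Context {R : realType}.
Implicit Types (p : {poly R}) (x y t : R).

Lemma exprn_le_expR n y : 0 <= y -> y ^+ n <= n`!%:R * expR y.
Proof.
move=> y0; case: n => [|n].
  by rewrite expr0 fact0 mul1r; apply: le_trans (expR_ge1Dx y); rewrite lerDl.
have n0 : 0 < n.+1`!%:R :> R by rewrite ltr0n fact_gt0.
rewrite -ler_pdivrMl// mulrC.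
by apply: le_trans (expR_ge1Dxn n y0); rewrite lerDr.
Qed.

(** These are, up to constants, all the iterated derivatives of exp(-1/x)
    extended by 0 to x <= 0; the family is stable under derivation. *)
Definition flat p x : R := if 0 < x then p.[x^-1] * expR (- x^-1) else 0.

Definition flat_deriv p : {poly R} := (p - p^`()) * 'X^2.

(** Powers of 1/x lose against exp(-1/x); order 2 is what makes the extension
    by 0 differentiable at 0. *)
Lemma flat_bound p : exists C, forall x, `|flat p x| <= C * x ^+ 2.
Proof.
exists (\sum_(i < size p) `|p`_i| * i.+2`!%:R) => x; rewrite /flat.
have C0 : 0 <= \sum_(i < size p) `|p`_i| * i.+2`!%:R by apply: sumr_ge0 => i _; rewrite mulr_ge0.
case: ifPn => [x0|_]; last by rewrite normr0 mulr_ge0 ?sqr_ge0.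
rewrite normrM (ger0_norm (expR_ge0 _)) horner_coef mulr_suml.
have y0 : 0 < x^-1 by rewrite invr_gt0.
apply: le_trans (_ : (\sum_(i < size p) `|p`_i| * x^-1 ^+ i) * expR (- x^-1) <= _).
  rewrite ler_wpM2r ?expR_ge0//; apply: le_trans (ler_norm_sum _ _ _) _.
  by apply: ler_sum => i _; rewrite normrM normrX (ger0_norm (ltW y0)).
rewrite mulr_suml; apply: ler_sum => i _; rewrite -!mulrA ler_wpM2l//.
rewrite expRN ler_pdivrMr ?expR_gt0//.
rewrite -(ler_pM2r (exprn_gt0 2 y0)) -exprD addn2.
apply: le_trans (exprn_le_expR _ (ltW y0)) _.
rewrite le_eqVlt; apply/orP; left; apply/eqP.
by rewrite exprVn; field; rewrite gt_eqF.
Qed.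

Lemma is_derive_flat p x : is_derive x 1 (flat p) (flat (flat_deriv p) x).
Proof.
have [x0|x0|->] := ltrgtP x 0.
- rewrite [X in is_derive _ _ _ X]/flat ltNge (ltW x0)/=.
  apply: (@near_eq_is_derive _ R R (cst 0) (flat p) x 1 0).
  near=> y; rewrite /flat ltNge; suff -> : y <= 0 by [].
  by apply: ltW; near: y; exact: lt_nbhsl.
- apply: (@near_eq_is_derive _ _ _ (fun y => p.[y^-1] * expR (- y^-1))).
    near=> y; rewrite /flat; suff -> : 0 < y by [].
    by near: y; exact: lt_nbhsr.
  have xn : x != 0 by rewrite gt_eqF.
  have d1 : is_derive x 1 (fun y => y^-1) (- x ^- 2).
    have := @is_deriveV _ id x 1 1 xn (is_derive_id _ _).
    by move/is_derive_eq; apply; rewrite /= [LHS]mulr1.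
  have d2 : is_derive x 1 (fun y => p.[y^-1]) ((p^`()).[x^-1] * - x ^- 2).
    exact: (@is_derive1_comp _ (horner p) (fun y => y^-1)).
  have d3 : is_derive x 1 (fun y => expR (- y^-1)) (expR (- x^-1) * x ^- 2).
    have := @is_derive1_comp _ expR (fun y => - y^-1) x _ _ (is_derive_expR _) (is_deriveN d1).
    by rewrite opprK.
  have := is_deriveM d2 d3; move/is_derive_eq; apply.
  by rewrite /flat x0 /flat_deriv !hornerE /GRing.scale/= -?exprVn; ring.
- apply/is_derive1_caratheodory.
  exists (fun z => flat p z / z); split.
  + move=> z; rewrite [flat p 0]/flat ltxx !subr0.
    have [->|z0] := eqVneq z 0; first by rewrite mulr0 /flat ltxx.
    by rewrite divfK.
  + have [C HC] := flat_bound p; rewrite /prop_for /continuous_at invr0 mulr0.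
    apply/cvgr0_norm_cvg0 || apply/norm_cvg0P.
    apply: (@squeeze_cvgr _ _ _ _ (cst 0) (fun z => C * `|z|)).
    * apply: nearW => z; rewrite normr_ge0/= normrM normfV.
      have [->|z0] := eqVneq z 0; first by rewrite normr0 invr0 !mulr0.
      rewrite ler_pdivrMr ?normr_gt0// -mulrA -expr2 real_normK ?num_real//.
    * exact: cvg_cst.
    * rewrite -[X in _ --> X](mulr0 C); apply: cvgMr.
      by rewrite -[X in _ --> X](@normr0 _ R); apply: cvg_norm; exact: cvg_id.
  + by rewrite invr0 mulr0 /flat ltxx.
Unshelve. all: by end_near. Qed.

Lemma flat1_gt0 x : (0 < flat 1 x) = (0 < x).
Proof. by rewrite /flat; case: ifP => // _; rewrite ?ltxx// hornerC mul1r expR_gt0. Qed.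

Lemma flat1_ge0 x : 0 <= flat 1 x.
Proof. by rewrite /flat; case: ifP => // _; rewrite hornerC mul1r expR_ge0. Qed.

Lemma flat1_neq0 x : (flat 1 x != 0) = (0 < x).
Proof. by rewrite -flat1_gt0 lt_neqAle flat1_ge0 andbT eq_sym. Qed.

End smooth_line.

Lemma is_derive_mul (K : realType) (V : normedModType K) (f g : V -> K) (x v : V) (df dg : K) : is_derive x v f df -> is_derive x v g dg ->
  is_derive x v (fun y => f y * g y) (df * g x + f x * dg).
Proof.
move=> hf hg; have := is_deriveM hf hg; move/is_derive_eq; apply.
by rewrite /GRing.scale/= addrC [g x * _]mulrC.
Qed.

Section smooth_theory.
Context {R : realType} {n : nat}.
Local Notation point := ('rV[R]_n).
Implicit Types (f g : point -> R) (x : point) (i j : 'I_n).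
Local Notation e i := (delta_mx ord0 i : point).

Lemma is_derive_shiftline f x v t df : is_derive (x + t *: v) v f df ->
  is_derive t (1 : R) (fun s => f (x + s *: v)) df.
Proof.
have E : (fun h => h^-1 *: (((fun s => f (x + s *: v)) \o shift t) (h *: (1 : R)) - f (x + t *: v)))
   = (fun h => h^-1 *: ((f \o shift (x + t *: v)) (h *: v) - f (x + t *: v))).
  apply/funext => h /=; congr (_ *: (f _ - _)).
  by rewrite [h *: 1]mulr1 scalerDl addrCA.
move=> [fd <-]; apply: DeriveDef; first by rewrite /derivable E.
by rewrite /derive E.
Qed.

Lemma is_derive_line f x v df : is_derive x v f df <->
  is_derive 0 (1 : R) (fun s => f (x + s *: v)) df.
Proof.
have E : (fun h => h^-1 *: (((fun s => f (x + s *: v)) \o shift 0) (h *: (1 : R)) - f (x + 0 *: v)))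
   = (fun h => h^-1 *: ((f \o shift x) (h *: v) - f x)).
  apply/funext => h /=; congr (_ *: (f _ - f _)); last by rewrite scale0r addr0.
  by rewrite [h *: 1]mulr1 addr0 addrC.
split=> -[fd <-]; apply: DeriveDef.
- by rewrite /derivable E.
- by rewrite /derive E.
- by move: fd; rewrite /derivable E.
- by rewrite /derive E.
Qed.

Lemma smooth_cont f : smooth f -> continuous f.
Proof. by move=> /(_ [::])[]. Qed.

Lemma smooth_is_derive f i x : smooth f -> is_derive x (e i) f (partial i f x).
Proof. by move=> /(_ [::])[_ /(_ i x) h]; apply: DeriveDef. Qed.

Lemma smooth_partial f i : smooth f -> smooth (partial i f).
Proof.
move=> sf s; have := sf (s ++ [:: i]).
by rewrite foldr_cat.
Qed.

(** Smoothness speaks of all iterated partial derivatives.  A class stable under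
    derivation replaces the induction on their order by one derivative. *)
Lemma smooth_coind (P : (point -> R) -> Prop) :
  (forall f, P f -> [/\ continuous f, forall i x, derivable f x (e i) &
     forall i, P (partial i f)]) ->
  forall f, P f -> smooth f.
Proof.
move=> HP f Pf s; have : P (foldr partial f s).
  by elim: s => [//|i s ih] /=; have [_ _] := HP _ ih.
by move=> /HP[].
Qed.

(** Derivatives of products and exponentials are sums and products of members
    again, so that this class is stable under derivation; the class of products
    of two smooth functions would not be. *)
Inductive smooth_alg : (point -> R) -> Prop :=
| SA_smooth f : smooth f -> smooth_alg f
| SA_cst c : smooth_alg (fun=> c)
| SA_add f g : smooth_alg f -> smooth_alg g -> smooth_alg (fun x => f x + g x)
| SA_mul f g : smooth_alg f -> smooth_alg g -> smooth_alg (fun x => f x * g x)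
| SA_exp f : smooth_alg f -> smooth_alg (fun x => expR (f x)).

Lemma is_derive_expR_comp f x v df : is_derive x v f df ->
  is_derive x v (fun y => expR (f y)) (expR (f x) * df).
Proof.
move=> /is_derive_line h; apply/is_derive_line.
have := @is_derive1_comp _ expR (fun s => f (x + s *: v)) 0 _ _ (is_derive_expR _) h.
by rewrite scale0r addr0.
Qed.

Lemma smooth_alg_smooth f : smooth_alg f -> smooth f.
Proof.
apply: smooth_coind => {}f.
have dP (g : point -> R) : (forall x i, exists df, is_derive x (e i) g df) ->
   forall i x, derivable g x (e i).
  by move=> h i x; have [df []] := h x i.
suff : smooth_alg f -> continuous f /\ forall i, exists2 df, smooth_alg df &
   forall x, is_derive x (e i) f (df x).
  move=> h /h[cf df]; split => //.
    by move=> i x; have [d _ /(_ x)[]] := df i.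
  move=> i; have [d sd Hd] := df i.
  by rewrite (_ : partial i f = d)//; apply/funext => x; have [_ <-] := Hd x.
elim=> {f}.
- move=> f sf; split; first exact: smooth_cont.
  move=> i; exists (partial i f); first by apply: SA_smooth; exact: smooth_partial.
  by move=> x; exact: smooth_is_derive.
- move=> c; split; first by move=> x; exact: cst_continuous.
  by move=> i; exists (fun=> 0) => [|x]; [exact: SA_cst|exact: is_derive_cst].
- move=> f g sf [cf Hf] sg [cg Hg]; split.
    by move=> x; apply: continuousD; [exact: cf|exact: cg].
  move=> i; have [df sdf dfE] := Hf i; have [dg sdg dgE] := Hg i.
  exists (fun x => df x + dg x); first exact: SA_add.
  by move=> x; apply: is_deriveD.
- move=> f g sf [cf Hf] sg [cg Hg]; split.
    by move=> x; apply: continuousM; [exact: cf|exact: cg].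
  move=> i; have [df sdf dfE] := Hf i; have [dg sdg dgE] := Hg i.
  exists (fun x => df x * g x + f x * dg x); first by apply: SA_add; exact: SA_mul.
  by move=> x; apply: is_derive_mul.
- move=> f sf [cf Hf]; split.
    by move=> x; apply: continuous_comp; [exact: cf|exact: continuous_expR].
  move=> i; have [df sdf dfE] := Hf i.
  exists (fun x => expR (f x) * df x); first by apply: SA_mul => //; exact: SA_exp.
  by move=> x; exact: is_derive_expR_comp.
Qed.

Lemma smooth_cst c : smooth (fun _ : point => c).
Proof. by apply: smooth_alg_smooth; exact: SA_cst. Qed.

Lemma smoothD f g : smooth f -> smooth g -> smooth (fun x => f x + g x).
Proof. by move=> sf sg; apply: smooth_alg_smooth; apply: SA_add; exact: SA_smooth. Qed.

Lemma smoothM f g : smooth f -> smooth g -> smooth (fun x => f x * g x).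
Proof. by move=> sf sg; apply: smooth_alg_smooth; apply: SA_mul; exact: SA_smooth. Qed.

Lemma smoothZ c f : smooth f -> smooth (fun x => c * f x).
Proof. by move=> sf; apply: smoothM; [exact: smooth_cst|exact: sf]. Qed.

Lemma smooth_exp f : smooth f -> smooth (fun x => expR (f x)).
Proof. by move=> sf; apply: smooth_alg_smooth; apply: SA_exp; exact: SA_smooth. Qed.

Lemma smooth_prod (J : finType) (F : J -> point -> R) :
  (forall k, smooth (F k)) -> smooth (fun x => \prod_k F k x).
Proof.
move=> sF; elim: (index_enum J) => [|j s ih].
  rewrite (_ : (fun x => _) = fun=> 1); first exact: smooth_cst.
  by apply/funext => x; rewrite big_nil.
rewrite (_ : (fun x => _) = fun x => F j x * \prod_(i <- s) F i x); first by apply: smoothM; [exact: sF|exact: ih].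
by apply/funext => x; rewrite big_cons.
Qed.

Lemma is_derive_coord x i j : is_derive x (e j) (fun y : point => y ord0 i) (i == j)%:R.
Proof.
apply/is_derive_line.
rewrite (_ : (fun s => _) = fun s : R => x ord0 i + s * (i == j)%:R); last first.
  by apply/funext => s; rewrite !mxE eqxx eq_sym.
have := is_deriveD (is_derive_cst (x ord0 i) (0 : R) (1 : R)) (is_derive_mul (is_derive_id (0 : R) (1 : R)) (is_derive_cst ((i == j)%:R : R) (0 : R) (1 : R))).
by move/is_derive_eq; apply; rewrite mulr0 mul1r addr0 add0r.
Qed.

Lemma smooth_flat_coord p (c b : R) i : smooth (fun x => flat p (c * x ord0 i + b)).
Proof.
pose P f := exists q r, f = fun x : point => r * flat q (c * x ord0 i + b).
apply: (@smooth_coind P); last first.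
  by exists p, 1; apply/funext => x; rewrite mul1r.
move=> _ [q [r ->]].
have D x j : is_derive x (e j) (fun x : point => r * flat q (c * x ord0 i + b))
    ((r * (c * (i == j)%:R)) * flat (flat_deriv q) (c * x ord0 i + b)).
  have d1 : is_derive x (e j) (fun x : point => c * x ord0 i + b) (c * (i == j)%:R).
    apply: is_derive_eq; first by apply: is_deriveD; apply: is_deriveZ; exact: is_derive_coord.
    by rewrite addr0.
  move/is_derive_line : d1 => d1.
  have := @is_derive1_comp _ (flat q) (fun s => c * (x + s *: e j) ord0 i + b) 0 _ _ (is_derive_flat _ _) d1.
  rewrite scale0r addr0 => d2.
  have d3 : is_derive x (e j) (fun x : point => flat q (c * x ord0 i + b)) (flat (flat_deriv q) (c * x ord0 i + b) * (c * (i == j)%:R)).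
    by apply/is_derive_line.
  have := is_derive_mul (is_derive_cst r x (e j)) d3.
  by move/is_derive_eq; apply; rewrite mul0r add0r/=; ring.
split.
- move=> x; apply: (@continuousM R point (fun=> r) (fun y => flat q (c * y ord0 i + b))).
    exact: cst_continuous.
  apply: (@continuous_comp _ _ _ (fun x : point => c * x ord0 i + b) (flat q)).
    apply: continuousD; last exact: cst_continuous.
    by apply: continuousM; [exact: cst_continuous|exact: continuous_rv_coord].
  apply: differentiable_continuous; apply/derivable1_diffP.
  by have [] := is_derive_flat q (c * x ord0 i + b).
- by move=> j x; have [] := D x j.
- move=> j; exists (flat_deriv q), (r * (c * (i == j)%:R)).
  by apply/funext => x; have [_ <-] := D x j.
Qed.

Definition box_bump (a b : 'I_n -> R) x : R :=
  \prod_i (flat 1 (1 * x ord0 i + - a i) * flat 1 (-1 * x ord0 i + b i)).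

Lemma smooth_box_bump a b : smooth (box_bump a b).
Proof. by apply: smooth_prod => i; apply: smoothM; exact: smooth_flat_coord. Qed.

Lemma box_bump_ge0 a b x : 0 <= box_bump a b x.
Proof. by apply: prodr_ge0 => i _; rewrite mulr_ge0 ?flat1_ge0. Qed.

Lemma box_bump_gt0 a b x : box a b x -> 0 < box_bump a b x.
Proof.
move=> abx; apply: prodr_gt0 => i _; have /andP[ax xb] := abx i.
by rewrite mulr_gt0// flat1_gt0; lra.
Qed.

Lemma box_bump_eq0 a b x : ~ box a b x -> box_bump a b x = 0.
Proof.
move=> nx; apply/eqP/negPn/negP => /negP n0; apply: nx => i.
have : flat 1 (1 * x ord0 i + - a i) * flat 1 (-1 * x ord0 i + b i) != 0.
  by apply/eqP => h; apply: n0; rewrite /box_bump (bigD1 i)//= h mul0r.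
rewrite mulf_eq0 negb_or !flat1_neq0 => /andP[h1 h2].
by apply/andP; split; lra.
Qed.

(** As k grows these functions increase to the indicator of the box: they let
    test functions see the integral over a box. *)
Definition box_approx a b (k : nat) x : R := 1 + -1 * expR (- k%:R * box_bump a b x).

Lemma smooth_box_approx a b k : smooth (box_approx a b k).
Proof.
apply: smoothD; first exact: smooth_cst.
by apply: smoothZ; apply: smooth_exp; apply: smoothZ; exact: smooth_box_bump.
Qed.

Lemma box_approx_eq0 a b k x : ~ box a b x -> box_approx a b k x = 0.
Proof. by move=> nx; rewrite /box_approx box_bump_eq0// mulr0 expR0; ring. Qed.

Lemma box_approx_le1 a b k x : `|box_approx a b k x| <= 1.
Proof.
rewrite /box_approx ler_norml; have h0 := expR_gt0 (- k%:R * box_bump a b x).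
have h1 : expR (- k%:R * box_bump a b x) <= 1.
  by rewrite -[leRHS]expR0 ler_expR mulNr oppr_le0 mulr_ge0// box_bump_ge0.
by apply/andP; split; lra.
Qed.

Lemma box_approx_cvg a b x : box_approx a b k x @[k --> \oo] --> (\1_(box a b) x : R).
Proof.
have [xb|xb] := pselect (box a b x); last first.
  rewrite (_ : (fun k => _) = cst 0); last by apply/funext => k; rewrite box_approx_eq0.
  by rewrite indicE memNset//; exact: cvg_cst.
rewrite indicE mem_set//; have b0 := box_bump_gt0 xb.
rewrite [X in _ --> X](_ : _ = 1 + -1 * 0 :> R); last by rewrite mulr0 addr0.
apply: cvgD; first exact: cvg_cst.
apply: cvgMr.
apply: (@squeeze_cvgr _ _ _ _ (cst 0) (fun k : nat => (box_bump a b x)^-1 * k%:R^-1)).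
- near=> k; rewrite expR_ge0/= mulNr expRN -invfM lef_pV2 ?posrE ?expR_gt0//.
    by apply: le_trans (expR_ge1Dx _); rewrite mulrC lerDr.
  by rewrite mulr_gt0// ltr0n; near: k; exact: nbhs_infty_gt.
- exact: cvg_cst.
- rewrite -[X in _ --> X](mulr0 (box_bump a b x)^-1); apply: cvgMr.
  by rewrite -(cvg_shiftS (fun k : nat => k%:R^-1 : R)); exact: cvg_harmonic.
Unshelve. all: by end_near. Qed.

(** ** Test functions *)

Implicit Types (Omega : set point).

Lemma compact_closed_rv (K : set point) : compact K -> closed K.
Proof. by move=> cK; apply: compact_closed => //; exact: (@norm_hausdorff R 'rV[R]_n). Qed.

Lemma near_out (K : set point) x : compact K -> ~ K x -> \forall y \near x, ~ K y.
Proof.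
by move=> /compact_closed_rv/closed_openC oK nx; exact: open_nbhs_nbhs.
Qed.

Lemma partial_eq0 f i x : (\forall y \near x, f y = 0) -> partial i f x = 0.
Proof.
by move=> h; rewrite /partial (@near_eq_derive _ _ _ f (cst 0))//; exact: derive_cst.
Qed.

Lemma test_fun_partial Omega f i : test_fun Omega f -> test_fun Omega (partial i f).
Proof.
move=> [sf [K [cK KO Kf]]]; split; first exact: smooth_partial.
exists K; split => // x nx; apply: partial_eq0.
by apply: filterS (near_out cK nx) => y; exact: Kf.
Qed.

Lemma test_funM Omega f g : test_fun Omega f -> smooth g ->
  test_fun Omega (fun x => f x * g x).
Proof.
move=> [sf [K [cK KO Kf]]] sg; split; first exact: smoothM.
by exists K; split => // x nx; rewrite Kf// mul0r.
Qed.

Lemma test_funZ Omega c f : test_fun Omega f -> test_fun Omega (fun x => c * f x).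
Proof.
move=> [sf [K [cK KO Kf]]]; split; first exact: smoothZ.
by exists K; split => // x nx; rewrite Kf// mulr0.
Qed.

Lemma test_funD Omega f g : test_fun Omega f -> test_fun Omega g ->
  test_fun Omega (fun x => f x + g x).
Proof.
move=> [sf [K [cK KO Kf]]] [sg [L [cL LO Lg]]]; split; first exact: smoothD.
exists (K `|` L); split; [exact: compactU|by rewrite subUset|].
by move=> x /not_orP[? ?]; rewrite Kf// Lg// addr0.
Qed.

Lemma test_fun0 Omega : test_fun Omega (fun=> 0).
Proof.
split; first exact: smooth_cst.
by exists set0; split => //; exact: compact0.
Qed.

Lemma test_fun_box_approx Omega a b k : cbox a b `<=` Omega ->
  test_fun Omega (box_approx a b k).
Proof.
move=> abO; split; first exact: smooth_box_approx.
exists (cbox a b); split => //; first exact: compact_cbox.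
move=> x nx; apply: box_approx_eq0; apply: contra_not nx => abx i.
by have /andP[? ?] := abx i; rewrite !ltW.
Qed.

Lemma compact_bounded_fun (K : set point) f : compact K -> continuous f ->
  exists2 M, 0 <= M & forall x, K x -> `|f x| <= M.
Proof.
move=> cK cf.
have /compact_bounded[M [_ HM]] : compact (f @` K).
  by apply: continuous_compact => //; exact: continuous_subspaceT.
exists (`|M| + 1); first by rewrite addr_ge0.
by move=> x Kx; apply: HM; [rewrite (le_lt_trans (ler_norm M))// ltrDl|exists x].
Qed.

Lemma test_fun_bounded Omega f : test_fun Omega f ->
  exists2 M, 0 <= M & forall x, `|f x| <= M.
Proof.
move=> [sf [K [cK KO Kf]]].
have [M M0 HM] := compact_bounded_fun cK (smooth_cont sf).
exists M => // x; have [/HM//|/Kf ->] := pselect (K x); by rewrite normr0.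
Qed.

Lemma derive_bound_lip f i M : (forall x, is_derive x (e i) f (partial i f x)) ->
  (forall x, `|partial i f x| <= M) ->
  forall x t, `|f (x + t *: e i) - f x| <= M * `|t|.
Proof.
move=> df fM; have key x t : 0 <= t -> `|f (x + t *: e i) - f x| <= M * `|t|.
  move=> t0; have d s : is_derive s (1 : R) (fun s => f (x + s *: e i)) (partial i f (x + s *: e i)).
    exact: is_derive_shiftline.
  have [|s _] := @MVT_segment R (fun s => f (x + s *: e i)) (fun s => partial i f (x + s *: e i)) 0 t t0 (fun s _ => d s).
    apply: continuous_subspaceT => s; apply: differentiable_continuous.
    by apply/derivable1_diffP; have [] := d s.
  by rewrite scale0r addr0 subr0 => ->; rewrite normrM ler_wpM2r.
move=> x t; have [|t0] := leP 0 t; first exact: key.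
have := key (x + t *: e i) (- t); rewrite -addrA -scalerDl subrr scale0r addr0 normrN distrC.
by apply; rewrite oppr_ge0 ltW.
Qed.

Lemma test_fun_lip Omega f i : test_fun Omega f ->
  exists2 M, 0 <= M & forall x t, `|f (x + t *: e i) - f x| <= M * `|t|.
Proof.
move=> tf; have [M M0 HM] := test_fun_bounded (test_fun_partial i tf).
by exists M => //; apply: derive_bound_lip => // x; apply: smooth_is_derive; case: tf.
Qed.

Lemma partialM f g i x : smooth f -> smooth g ->
  partial i (fun y => f y * g y) x = partial i f x * g x + f x * partial i g x.
Proof.
move=> sf sg; have [_] := is_derive_mul (smooth_is_derive i x sf) (smooth_is_derive i x sg).
by [].
Qed.

Lemma partialZ c f i x : smooth f -> partial i (fun y => c * f y) x = c * partial i f x.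
Proof.
move=> sf; rewrite partialM; [|exact: smooth_cst|exact: sf].
by rewrite /partial derive_cst mul0r add0r.
Qed.

Lemma partialD f g i x : smooth f -> smooth g ->
  partial i (fun y => f y + g y) x = partial i f x + partial i g x.
Proof.
move=> sf sg; have [_] := is_deriveD (smooth_is_derive i x sf) (smooth_is_derive i x sg).
by [].
Qed.

End smooth_theory.

(** * Weak derivatives *)

Section weak_derivatives.
Context {R : realType} {d : nat}.
Local Notation point := ('rV[R]_d).
Local Notation mu := (leb R d).
Local Notation e i := (delta_mx ord0 i : point).
Implicit Types (Omega : set point) (f g phi : point -> R) (x v : point) (i : 'I_d).

Lemma norm_delta_le1 i : `|e i| <= 1.
Proof.
apply: norm_le_coord => // j; rewrite mxE eqxx.
by case: (_ == _); rewrite ?normr1// normr0.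
Qed.

Lemma is_derive_seq f i x df : is_derive x (e i) f df ->
  k.+1%:R * (f (x + k.+1%:R^-1 *: e i) - f x) @[k --> \oo] --> df.
Proof.
move=> [fd <-].
have h : (fun h : R => h^-1 *: ((f \o shift x) (h *: e i) - f x)) @ 0^' --> 'D_(e i) f x by exact: fd.
have := (cvgr_dnbhsP _ _ _).1 h (fun k : nat => k.+1%:R^-1 : R).
have -> : (fun k : nat => k.+1%:R^-1^-1 *: ((f \o shift x) (k.+1%:R^-1 *: e i) - f x)) =
   (fun k : nat => k.+1%:R * (f (x + k.+1%:R^-1 *: e i) - f x)).
  by apply/funext => k; rewrite /= invrK [_ *: e i + x]addrC.
apply; split => [k|]; first by rewrite invr_eq0 pnatr_eq0.
exact: cvg_harmonic.
Qed.

Lemma closed_ball_norm (M : R) : closed [set x : point | `|x| <= M].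
Proof.
rewrite (_ : [set x | _] = (fun x : point => `|x|) @^-1` [set t | t <= M])//.
by apply: closed_comp => [x _|]; [exact: norm_continuous|exact: closed_le].
Qed.

(** The difference quotients of F integrate to 0 by translation invariance, and
    they converge boundedly to the directional derivative. *)
Lemma integral_directional_derivative (F g : point -> R) i (M L : R) :
  continuous F -> (forall x, M < `|x| -> F x = 0) ->
  (forall x t, `|F (x + t *: e i) - F x| <= L * `|t|) ->
  {ae mu, forall x, is_derive x (e i) F (g x)} ->
  measurable_fun setT g ->
  mu.-integrable setT (EFin \o g) /\ \int[mu]_x g x = 0.
Proof.
move=> cF F0 FL Fg mg.
have mF : measurable_fun setT F by exact: continuousT_measurable_rv.
pose B := [set x : point | `|x| <= M + 1].
have mB : measurable B by apply: closed_measurable_rv; exact: closed_ball_norm.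
have fB : (mu B < +oo)%E.
  apply: leb_bounded_fin => //; exists (M + 1); split; first exact: num_real.
  by move=> N MN x /= xM; exact: le_trans xM (ltW MN).
have L0 : 0 <= L.
  by have := FL 0 1; rewrite normr1 mulr1; exact: le_trans.
pose f_ (k : nat) (x : point) := k.+1%:R * (F (x + k.+1%:R^-1 *: e i) - F x).
have mtr (k : nat) : measurable_fun setT (fun x : point => F (x + k.+1%:R^-1 *: e i)).
  by apply: (measurableT_comp mF); exact: measurable_rv_translate.
have mf_ k : measurable_fun setT (f_ k).
  by apply: measurable_funM => //; exact: measurable_funB.
have fL k x : `|f_ k x| <= L * \1_B x.
  have [xB|xB] := pselect (B x).
    rewrite indicE mem_set// mulr1 /f_ normrM ger0_norm//.
    rewrite -ler_pdivlMl//; apply: le_trans (FL _ _) _.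
    by rewrite ger0_norm ?invr_ge0// mulrC.
  rewrite indicE memNset// mulr0 /f_.
  have xM : M + 1 < `|x| by rewrite ltNge; apply/negP.
  rewrite !F0 ?subrr ?mulr0 ?normr0//; first by apply: lt_trans xM; rewrite ltrDl.
  have : `|x| <= `|x + k.+1%:R^-1 *: e i| + `|k.+1%:R^-1 *: e i|.
    by rewrite -{1}(addrK (k.+1%:R^-1 *: e i) x); exact: ler_normB.
  have : `|k.+1%:R^-1 *: e i| <= 1.
    rewrite normrZ mulr_ile1 ?norm_delta_le1//.
    by rewrite ger0_norm ?invr_ge0// invf_le1 ?ltr0n// ler1n.
  by move: xM; lra.
have i1 : mu.-integrable setT (EFin \o (\1_B : point -> R)).
  apply/integrableP; split; first by apply/measurable_EFinP.
  under eq_integral do rewrite /= ger0_norm//.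
  by rewrite integral_indic// setIT.
have iF : mu.-integrable setT (EFin \o F).
  have [C C0 HC] := compact_bounded_fun (bounded_closed_compact_rv (@closed_ball_norm (M + 1)) (fun x h => h)) cF.
  apply: (@int_dom _ _ _ mu setT measurableT F (fun x => C * \1_B x)) => //.
    by apply: intZ => //; exact: i1.
  move=> x _; have [xB|xB] := pselect (B x); first by rewrite indicE mem_set// mulr1; exact: HC.
  rewrite F0 ?normr0 ?mulr_ge0//.
  by rewrite (lt_trans (y := M + 1)) ?ltrDl// ltNge; apply/negP.
have trF v : (\int[mu]_x (F (x + v))%:E = \int[mu]_x (F x)%:E)%E.
  by apply: (@integral_leb_translate _ _ v (EFin \o F)); exact/measurable_EFinP.
have itr (k : nat) : mu.-integrable setT (EFin \o (fun x : point => F (x + k.+1%:R^-1 *: e i))).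
  apply/integrableP; split; first exact/measurable_EFinP.
  have /integrableP[_] := iF; apply: le_lt_trans.
  rewrite le_eqVlt; apply/orP; left; apply/eqP.
  apply: (@integral_leb_translate _ _ (k.+1%:R^-1 *: e i) (abse \o (EFin \o F))).
  by apply: measurableT_comp => //; exact/measurable_EFinP.
have f0 k : (\int[mu]_x (EFin \o f_ k) x = 0)%E.
  rewrite (_ : (fun x => _) = (fun x => k.+1%:R%:E * (EFin \o (fun x : point => (F (x + k.+1%:R^-1 *: e i) - F x)%R)) x)%E); last first.
    by apply/funext => x.
  rewrite integralZl//; last exact: intB.
  rewrite (_ : (fun x => _) = (fun x => (F (x + k.+1%:R^-1 *: e i))%:E - (F x)%:E)%E); last first.
    by apply/funext => x /=; rewrite EFinB.
  have -> := integralB measurableT (itr k) iF.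
  rewrite [X in (_ * (X - _))%E](_ : _ = \int[mu]_x (F x)%:E)%E; last exact: trF.
  rewrite subee ?mule0//; exact: integrable_fin_num.
have [|||||ig _ cg] := @dominated_convergence _ _ _ mu setT measurableT (fun k => EFin \o f_ k) (EFin \o g) (fun x => (L * \1_B x)%:E).
- by move=> k; exact/measurable_EFinP.
- exact/measurable_EFinP.
- apply: filterS Fg => x h _; apply: cvg_EFin; first exact: nearW.
  exact: is_derive_seq.
- by apply: intZ => //; exact: i1.
- by apply: aeW => x k _; rewrite lee_fin.
split => //; rewrite /Rintegral.
have -> : (\int[mu]_x (g x)%:E = 0)%E; last by [].
apply: (cvg_unique _ cg) => //.
rewrite [X in X @ _](_ : _ = cst 0%E); first exact: cvg_cst.
by apply/funext => k; exact: f0.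
Qed.

(** ** Testing against smooth functions *)

Definition L1bd Omega f := measurable_fun Omega f /\
  forall K, compact K -> K `<=` Omega -> exists M, forall x, K x -> `|f x| <= M.

Lemma compact_measure_fin (K : set point) : compact K -> (mu K < +oo)%E.
Proof.
move=> cK; apply: leb_bounded_fin; first exact: compact_measurable_rv.
exact: compact_bounded.
Qed.

Section fixed_domain.
Variable Omega : set point.
Hypothesis oO : open Omega.
Let mO : measurable Omega. Proof. exact: open_measurable_rv. Qed.
Local Notation Int f := (mu.-integrable Omega (EFin \o f)).

Lemma l1loc_bd f : L1bd Omega f -> in_L1loc Omega f.
Proof.
move=> [mf bf]; split => // K cK KO; have [M HM] := bf K cK KO.
have mK := compact_measurable_rv cK.
apply: (int_dom mK (g := fun=> M)) => //.
  exact: measurable_funS mf.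
exact: (int_cst mK (compact_measure_fin cK) M).
Qed.

Lemma l1loc_smooth f : smooth f -> in_L1loc Omega f.
Proof.
move=> sf; apply: l1loc_bd; split.
  by apply: measurable_funS (continuousT_measurable_rv (smooth_cont sf)).
move=> K cK _; have [M _ HM] := compact_bounded_fun cK (smooth_cont sf).
by exists M.
Qed.

Lemma l1locD f g : in_L1loc Omega f -> in_L1loc Omega g ->
  in_L1loc Omega (fun x => f x + g x).
Proof.
move=> [mf If] [mg Ig]; split; first exact: measurable_funD.
by move=> K cK KO; apply: intD; [exact: compact_measurable_rv|exact: If|exact: Ig].
Qed.

Lemma l1locZ c f : in_L1loc Omega f -> in_L1loc Omega (fun x => c * f x).
Proof.
move=> [mf If]; split; first exact: measurable_funM.
by move=> K cK KO; apply: intZ; [exact: compact_measurable_rv|exact: If].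
Qed.

Lemma l1locB f g : in_L1loc Omega f -> in_L1loc Omega g ->
  in_L1loc Omega (fun x => f x - g x).
Proof.
move=> lf lg; have := l1locD lf (l1locZ (-1) lg).
by under [X in in_L1loc _ X]eq_fun do rewrite mulN1r.
Qed.

Lemma l1loc_sum (J : finType) (F : J -> point -> R) :
  (forall k, in_L1loc Omega (F k)) -> in_L1loc Omega (fun x => \sum_k F k x).
Proof.
move=> lF; elim: (index_enum J) => [|j s ih].
  under [X in in_L1loc _ X]eq_fun do rewrite big_nil.
  by apply: l1loc_smooth; exact: smooth_cst.
under [X in in_L1loc _ X]eq_fun do rewrite big_cons.
by apply: l1locD; [exact: lF|exact: ih].
Qed.

Lemma l1loc_int_supp f g (K : set point) : in_L1loc Omega f -> continuous g ->
  compact K -> K `<=` Omega -> (forall x, ~ K x -> g x = 0) ->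
  Int (fun x => f x * g x).
Proof.
move=> [mf If] cg cK KO g0; have mK := compact_measurable_rv cK.
have [M M0 HM] := compact_bounded_fun cK cg.
have mg : measurable_fun Omega g by apply: measurable_funS (continuousT_measurable_rv cg).
have IK : mu.-integrable K (EFin \o (fun x => f x * g x)).
  apply: (int_dom mK (g := fun x => M * `|f x|)).
  - by apply: measurable_funS (measurable_funM mf mg).
  - by apply: intZ => //; apply: int_abs; exact: If.
  - by move=> x Kx; rewrite normrM mulrC ler_wpM2r ?HM.
have h := (integrable_mkcond (EFin \o (fun x => f x * g x)) mK).1 IK.
move: (integrableS measurableT mO (@subsetT _ _) h).
apply: eq_integrable => // x _; rewrite patchE/=; case: ifPn => // /negP xK.
by rewrite g0 ?mulr0// => Kx; apply: xK; rewrite inE.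
Qed.

Lemma l1loc_int_test f phi : in_L1loc Omega f -> test_fun Omega phi ->
  Int (fun x => f x * phi x).
Proof.
move=> lf [sp [K [cK KO K0]]].
by apply: l1loc_int_supp lf (smooth_cont sp) cK KO K0.
Qed.

Lemma integ_supp f : (forall x, ~ Omega x -> f x = 0) ->
  integ Omega f = \int[mu]_x f x.
Proof.
move=> f0; rewrite /integ Rintegral_mkcond; apply: eq_Rintegral => x _.
by rewrite patchE; case: ifPn => // /negP xO; rewrite f0// => Ox; apply: xO; rewrite inE.
Qed.

Lemma compact_norm_bound (K : set point) : compact K -> exists M, forall x, M < `|x| -> ~ K x.
Proof.
move=> /compact_bounded[M [_ HM]]; exists (M + 1) => x Mx Kx.
by move: Mx; rewrite ltNge => /negP; apply; apply: HM => //; rewrite ltrDl.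
Qed.

Lemma integ_partial_test phi i : test_fun Omega phi -> integ Omega (partial i phi) = 0.
Proof.
move=> tp; have [sp [K [cK KO K0]]] := tp.
have [sdp [K' [cK' KO' K0']]] := test_fun_partial i tp.
rewrite integ_supp; last by move=> x nO; apply: K0' => /KO'.
have [M HM] := compact_norm_bound cK; have [L _ HL] := test_fun_lip i tp.
have [|||||_ ->//] := @integral_directional_derivative phi (partial i phi) i M L.
- exact: smooth_cont.
- by move=> x /HM; exact: K0.
- exact: HL.
- by apply: aeW => x; exact: smooth_is_derive.
- by apply: continuousT_measurable_rv; exact: smooth_cont.
Qed.

Lemma is_wderiv_smooth f i : smooth f -> is_wderiv Omega i f (partial i f).
Proof.
move=> sf; have lf := l1loc_smooth sf; have ldf := l1loc_smooth (smooth_partial i sf).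
split => // phi tp; have [sp _] := tp.
have h := integ_partial_test i (test_funM tp sf).
apply/eqP; rewrite -addr_eq0 /integ -RintegralD//; last 2 first.
- by apply: l1loc_int_test; [exact: lf|exact: test_fun_partial].
- exact: l1loc_int_test.
apply/eqP; rewrite -[RHS]h; apply: eqI => // x _; rewrite partialM//; ring.
Qed.

Lemma is_wderivD i f f' g g' : is_wderiv Omega i f f' -> is_wderiv Omega i g g' ->
  is_wderiv Omega i (fun x => f x + g x) (fun x => f' x + g' x).
Proof.
move=> [lf lf' hf] [lg lg' hg]; split; [exact: l1locD|exact: l1locD|] => phi tp.
have tdp := test_fun_partial i tp.
transitivity (integ Omega (fun x => f x * partial i phi x) +
              integ Omega (fun x => g x * partial i phi x)).
  rewrite /integ -RintegralD//; [|exact: l1loc_int_test|exact: l1loc_int_test].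
  by apply: eqI => // x _; rewrite mulrDl.
rewrite hf// hg// -opprD; congr (- _).
rewrite /integ -RintegralD//; [|exact: l1loc_int_test|exact: l1loc_int_test].
by apply: eqI => // x _; rewrite mulrDl.
Qed.

Lemma is_wderivZ i c f f' : is_wderiv Omega i f f' ->
  is_wderiv Omega i (fun x => c * f x) (fun x => c * f' x).
Proof.
move=> [lf lf' hf]; split; [exact: l1locZ|exact: l1locZ|] => phi tp.
have tdp := test_fun_partial i tp.
transitivity (c * integ Omega (fun x => f x * partial i phi x)).
  rewrite /integ -RintegralZl//; last exact: l1loc_int_test.
  by apply: eqI => // x _; rewrite mulrA.
rewrite hf// mulrN; congr (- _).
rewrite /integ -RintegralZl//; last exact: l1loc_int_test.
by apply: eqI => // x _; rewrite mulrA.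
Qed.

(** ** Du Bois-Reymond lemma *)

(** The functions [box_approx a b k] are bounded test functions converging to
    the indicator of the box. *)
Lemma integ_box_eq0 g a b : in_L1loc Omega g ->
  (forall phi, test_fun Omega phi -> integ Omega (fun x => g x * phi x) = 0) ->
  cbox a b `<=` Omega -> (\int[mu]_(x in box a b) (g x)%:E = 0)%E.
Proof.
move=> lg g0 abO; have [mg Ig] := lg.
have bc : box a b `<=` cbox a b by move=> x abx i; have /andP[? ?] := abx i; rewrite !ltW.
have mb := measurable_box a b; have mc := measurable_cbox a b.
pose f_ (k : nat) (x : point) := (g x * box_approx a b k x)%:E.
have mgc : measurable_fun (cbox a b) g by apply: measurable_funS mg.
have mf_ k : measurable_fun (cbox a b) (f_ k).
  apply/measurable_EFinP; apply: measurable_funM => //.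
  by apply: measurable_funS (continuousT_measurable_rv (smooth_cont (smooth_box_approx a b k))).
have Igc : mu.-integrable (cbox a b) (EFin \o g) by apply: Ig => //; exact: compact_cbox.
have [|||||_ _ cg] := @dominated_convergence _ _ _ mu (cbox a b) mc f_
   (fun x => (g x * \1_(box a b) x)%:E) (fun x => `|g x|%:E).
- exact: mf_.
- by apply/measurable_EFinP; apply: measurable_funM => //; exact: measurable_indic.
- apply: aeW => x _; apply: cvg_EFin; first exact: nearW.
  by apply: cvgMr; exact: box_approx_cvg.
- exact: int_abs.
- apply: aeW => x k _; rewrite lee_fin normrM -[leRHS]mulr1.
  by rewrite ler_wpM2l// box_approx_le1.
have f0 k : (\int[mu]_(x in cbox a b) f_ k x = 0)%E.
  have tk := test_fun_box_approx k abO.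
  have h := g0 _ tk; have Ih := l1loc_int_test lg tk.
  have -> : (\int[mu]_(x in cbox a b) f_ k x = \int[mu]_(x in Omega) (g x * box_approx a b k x)%:E)%E.
    rewrite [LHS]integral_mkcond [RHS]integral_mkcond; apply: eq_integral => x _.
    rewrite !patchE; case: ifPn => [|/negP]; rewrite inE => xab.
      by rewrite mem_set//; exact: abO.
    case: ifPn => // _; rewrite box_approx_eq0 ?mulr0//.
    by apply: contra_not xab; exact: bc.
  move: h; rewrite /integ /Rintegral => h.
  by rewrite -[LHS]fineK ?h//; exact: integrable_fin_num Ih.
have : (\int[mu]_(x in cbox a b) (g x * \1_(box a b) x)%:E = 0)%E.
  apply: (cvg_unique _ cg) => //.
  rewrite [X in X @ _](_ : _ = cst 0%E); first exact: cvg_cst.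
  by apply/funext => k; exact: f0.
move=> <-; rewrite [LHS]integral_mkcond [RHS]integral_mkcond; apply: eq_integral => x _.
rewrite !patchE indicE; case: ifPn => [xab|xab].
  by rewrite mulr1; move: xab; rewrite inE => /bc h; rewrite mem_set.
by rewrite mulr0; case: ifP.
Qed.

(** The Borel sets A for which g has integral 0 over the part of A in the box
    form a Dynkin system, and it contains all boxes. *)
Lemma du_bois_reymond_box g a b : in_L1loc Omega g ->
  (forall phi, test_fun Omega phi -> integ Omega (fun x => g x * phi x) = 0) ->
  cbox a b `<=` Omega -> {ae mu, forall x, box a b x -> g x = 0}.
Proof.
move=> lg g0 abO; have [mg Ig] := lg.
have bc : box a b `<=` cbox a b by move=> x abx i; have /andP[? ?] := abx i; rewrite !ltW.
have mb := measurable_box a b; have mc := measurable_cbox a b.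
have Igb : mu.-integrable (box a b) (EFin \o g).
  by apply: (integrableS mc mb bc); apply: Ig => //; exact: compact_cbox.
have IS A : measurable A -> mu.-integrable (A `&` box a b) (EFin \o g).
  by move=> mA; apply: integrableS Igb => //; exact: measurableI.
pose P A := (\int[mu]_(x in A `&` box a b) (g x)%:E = 0)%E.
have PA A : measurable A -> P A.
  rewrite measurable_gen_boxes.
  apply: (@dynkin_induction _ _ open_boxes P).
  - exact: measurable_gen_boxes.
  - move=> _ _ [a1 [b1 ->]] [a2 [b2 ->]].
    exists (fun i => Num.max (a1 i) (a2 i)), (fun i => Num.min (b1 i) (b2 i)).
    apply/seteqP; split => [x [h1 h2] i|x h].
      by have := h1 i; have := h2 i; rewrite gt_max lt_min => /andP[-> ->] /andP[-> ->].
    by split => i; have := h i; rewrite gt_max lt_min => /andP[/andP[? ?] /andP[? ?]]; apply/andP.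
  - by rewrite /P setTI; exact: integ_box_eq0.
  - move=> _ [a1 [b1 ->]].
    rewrite /P (_ : box a1 b1 `&` box a b = box (fun i => Num.max (a1 i) (a i)) (fun i => Num.min (b1 i) (b i))).
      apply: integ_box_eq0 => // x h; apply: abO => i.
      by have := h i; rewrite ge_max le_min => /andP[/andP[? ?] /andP[? ?]]; apply/andP.
    apply/seteqP; split => [x [h1 h2] i|x h].
      by have := h1 i; have := h2 i; rewrite gt_max lt_min => /andP[-> ->] /andP[-> ->].
    by split => i; have := h i; rewrite gt_max lt_min => /andP[/andP[? ?] /andP[? ?]]; apply/andP.
  - move=> S mS PS; rewrite /P.
    have : (\int[mu]_(x in box a b) (g x)%:E = 0)%E by exact: integ_box_eq0.
    rewrite -{1}(setIT (box a b)) -(setvU S) setIUr integral_setU//; last 4 first.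
    + by apply: measurableI => //; exact: measurableC.
    + exact: measurableI.
    + rewrite -setIUr setvU setIT; exact: measurable_int Igb.
    + apply/disj_setPS => x [[_ nS] [_ Sx]]; exact: nS Sx.
    rewrite [X in (_ + X = _ -> _)%E](_ : _ = 0)%E; last by rewrite setIC; exact: PS.
    by rewrite adde0 setIC.
  - move=> F mF tF PF; rewrite /P setI_bigcupl integral_bigcup//.
    + by apply: eseries0 => k _ _; exact: PF.
    + exact: trivIset_setIr.
    + by move=> k; exact: measurableI.
    + by rewrite -setI_bigcupl; apply: IS; exact: bigcup_measurable.
have h : ae_eq mu (box a b) (EFin \o g) (cst 0%E).
  apply: integral_ae_eq => // E EB mE; rewrite integral0.
  by have := PA _ mE; rewrite /P; have -> : E `&` box a b = E by apply/setIidPl.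
by apply: filterS h => x hx /hx/= [].
Qed.

Lemma ae_forall_countable (T : countType) (P : T -> point -> Prop) :
  (forall t, {ae mu, forall x, P t x}) -> {ae mu, forall x, forall t, P t x}.
Proof.
move=> hP; have h : {ae mu, forall x, forall n : nat, if @unpickle T n is Some t then P t x else True}.
  apply: ae_foralln => n; case: (unpickle n) => [t|]; first exact: hP.
  by apply: aeW.
by apply: filterS h => x hx t; have := hx (pickle t); rewrite pickleK.
Qed.

Lemma du_bois_reymond g : in_L1loc Omega g ->
  (forall phi, test_fun Omega phi -> integ Omega (fun x => g x * phi x) = 0) ->
  {ae mu, forall x, Omega x -> g x = 0}.
Proof.
move=> lg g0; have [F [OF HF]] := open_rv_boxes oO.
have h : {ae mu, forall x, forall p, F p x -> g x = 0}.
  apply: ae_forall_countable => p; have [->|[a [b [-> abO]]]] := HF p.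
    by apply: aeW.
  exact: du_bois_reymond_box abO.
by apply: filterS h => x hx; rewrite OF => -[p _]; exact: hx.
Qed.

Lemma is_wderiv_unique i f g h : is_wderiv Omega i f g -> is_wderiv Omega i f h ->
  {ae mu, forall x, Omega x -> g x = h x}.
Proof.
move=> [lf lg Hg] [_ lh Hh].
have H : {ae mu, forall x, Omega x -> g x - h x = 0}.
  apply: du_bois_reymond; first exact: l1locB.
  move=> phi tp; have := Hg _ tp; rewrite Hh// => /eqP; rewrite eqr_opp => /eqP E.
  transitivity (integ Omega (fun x => g x * phi x) - integ Omega (fun x => h x * phi x)).
    rewrite /integ -RintegralB//; [|exact: l1loc_int_test|exact: l1loc_int_test].
    by apply: eqI => // x _; rewrite mulrBl.
  by rewrite -E subrr.
by apply: filterS H => x H Ox; apply/eqP; rewrite -subr_eq0; apply/eqP; exact: H.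
Qed.

Lemma wderivP i f g : is_wderiv Omega i f g ->
  is_wderiv Omega i f (wderiv Omega i f).
Proof. by move=> h; rewrite /wderiv; apply: (xgetPex (fun=> 0)); exists g. Qed.

Lemma wderivE i f g : is_wderiv Omega i f g ->
  {ae mu, forall x, Omega x -> wderiv Omega i f x = g x}.
Proof. by move=> h; exact: is_wderiv_unique (wderivP h) h. Qed.

Lemma is_wdiv_unique F g h : is_wdiv Omega F g -> is_wdiv Omega F h ->
  {ae mu, forall x, Omega x -> g x = h x}.
Proof.
move=> [lf lg Hg] [_ lh Hh].
have H : {ae mu, forall x, Omega x -> g x - h x = 0}.
  apply: du_bois_reymond; first exact: l1locB.
  move=> phi tp; have := Hg _ tp; rewrite Hh// => /eqP; rewrite eqr_opp => /eqP E.
  transitivity (integ Omega (fun x => g x * phi x) - integ Omega (fun x => h x * phi x)).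
    rewrite /integ -RintegralB//; [|exact: l1loc_int_test|exact: l1loc_int_test].
    by apply: eqI => // x _; rewrite mulrBl.
  by rewrite -E subrr.
by apply: filterS H => x H Ox; apply/eqP; rewrite -subr_eq0; apply/eqP; exact: H.
Qed.

Lemma wdivE F g : is_wdiv Omega F g ->
  {ae mu, forall x, Omega x -> wdiv Omega F x = g x}.
Proof.
move=> h; apply: is_wdiv_unique (h).
by rewrite /wdiv; apply: (xgetPex (fun=> 0)); exists g.
Qed.

Lemma is_wdiv_wderiv F (G : 'I_d -> point -> R) :
  (forall i, is_wderiv Omega i (coordf F i) (G i)) ->
  is_wdiv Omega F (fun x => \sum_i G i x).
Proof.
move=> HF; split.
- by move=> i; have [] := HF i.
- by apply: l1loc_sum => i; have [] := HF i.
move=> phi tp.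
rewrite /integ I_sum//; last first.
  by move=> i; apply: l1loc_int_test; [have [] := HF i|exact: test_fun_partial].
transitivity (\sum_i - integ Omega (fun x => G i x * phi x)).
  by apply: eq_bigr => i _; have [_ _ h] := HF i; exact: h.
rewrite sumrN; congr (- _); rewrite /integ -I_sum//; last first.
  by move=> i; apply: l1loc_int_test => //; have [] := HF i.
by apply: eqI => // x _; rewrite mulr_suml.
Qed.

End fixed_domain.
End weak_derivatives.

(** * The spaces H^1 and H^1_0 *)

Section euclid.
Context {R : realType}.

Lemma dotm_ge0 m n (A : 'M[R]_(m, n)) : 0 <= dotm A A.
Proof. by apply: sumr_ge0 => i _; apply: sumr_ge0 => j _; rewrite -expr2 sqr_ge0. Qed.

Lemma enorm_sqr m n (A : 'M[R]_(m, n)) : enorm A ^+ 2 = dotm A A.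
Proof. by rewrite sqr_sqrtr ?dotm_ge0. Qed.

Lemma enorm_ge0 m n (A : 'M[R]_(m, n)) : 0 <= enorm A.
Proof. exact: sqrtr_ge0. Qed.

Lemma dotv_sum n (x y : 'rV[R]_n) : dotv x y = \sum_i x ord0 i * y ord0 i.
Proof. by rewrite /dotv /dotm big_ord1. Qed.

Lemma enorm_rv_sqr n (x : 'rV[R]_n) : enorm x ^+ 2 = \sum_i x ord0 i ^+ 2.
Proof. by rewrite enorm_sqr -/(dotv x x) dotv_sum. Qed.

Lemma coord_le_enorm n (x : 'rV[R]_n) i : `|x ord0 i| <= enorm x.
Proof.
rewrite -(ler_pXn2r (n := 2)) ?nnegrE ?enorm_ge0// real_normK ?num_real//.
rewrite enorm_rv_sqr (bigD1 i)//= lerDl; apply: sumr_ge0 => j _; exact: sqr_ge0.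
Qed.

End euclid.

Section domain_theory.
Context {R : realType} {d : nat}.
Local Notation point := ('rV[R]_d).
Local Notation mu := (leb R d).
Implicit Types (f g phi : point -> R) (v w : point -> point) (i j : 'I_d).
Variable Omega : set point.
Hypothesis oO : open Omega.
Hypothesis cO : compact (closure Omega).

Lemma domain_measurable : measurable Omega. Proof. exact: open_measurable_rv. Qed.
Let mO := domain_measurable.

Lemma domain_fin : (mu Omega < +oo)%E.
Proof.
apply: le_lt_trans (compact_measure_fin cO).
by apply: le_measure; rewrite ?inE//; [exact: compact_measurable_rv|exact: subset_closure].
Qed.
Let fO := domain_fin.

Local Notation Int f := (mu.-integrable Omega (EFin \o f)).
Local Notation I f := (integ Omega f).
Local Notation sq f := (sqi mu Omega f).
Local Notation nq f := (nsq mu Omega f).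
Local Notation cv f_ f := (cvg2 mu Omega f_ f).

Lemma normLpE p f : p != 0 ->
  normLp Omega p%:E f = ((\int[mu]_(x in Omega) (`|f x| `^ p)%:E) `^ p^-1)%E.
Proof.
move=> p0; rewrite /normLp unlock; apply: (congr1 (fun z => (z `^ p^-1)%E)).
rewrite [RHS]integral_mkcond; apply: eq_integral => x _.
rewrite patchE indicE; case: ifPn => _; rewrite /= ?mul1r// mul0r normr0.
by rewrite powR0.
Qed.

Lemma measurable_pow f p : measurable_fun Omega f -> measurable_fun Omega (fun x => `|f x| `^ p).
Proof.
move=> mf; apply: (@measurableT_comp _ _ _ _ _ _ (fun t : R => t `^ p)).
  exact: measurable_powR.
exact: measurableT_comp.
Qed.

Lemma normLp_lty_int p f : 0 < p -> measurable_fun Omega f ->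
  (normLp Omega p%:E f < +oo)%E -> Int (fun x => `|f x| `^ p).
Proof.
move=> p0 mf; rewrite normLpE ?gt_eqF// => h.
apply/integrableP; split; first by apply/measurable_EFinP; exact: measurable_pow.
under eq_integral do rewrite /= ger0_norm ?powR_ge0//.
by apply: lty_poweRy h; rewrite invr_eq0 gt_eqF.
Qed.

Lemma int_normLp p f : 0 < p -> Int (fun x => `|f x| `^ p) ->
  normLp Omega p%:E f = (I (fun x => `|f x| `^ p) `^ p^-1)%:E.
Proof.
move=> p0 If; rewrite normLpE ?gt_eqF// -poweR_EFin; apply: (congr1 (fun z => (z `^ p^-1)%E)).
by rewrite /integ /Rintegral fineK//; exact: integrable_fin_num If.
Qed.

Lemma normLp_le_int p f c : 0 < p -> 0 <= c -> measurable_fun Omega f ->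
  (normLp Omega p%:E f <= c%:E)%E ->
  Int (fun x => `|f x| `^ p) /\ I (fun x => `|f x| `^ p) <= c `^ p.
Proof.
move=> p0 c0 mf h.
have If : Int (fun x => `|f x| `^ p).
  by apply: normLp_lty_int => //; apply: le_lt_trans h _; exact: ltry.
split => //; move: h; rewrite int_normLp// lee_fin => h.
have I0 : 0 <= I (fun x => `|f x| `^ p) by apply: Rintegral_ge0 => x _; exact: powR_ge0.
have := @ge0_ler_powR R p (ltW p0) _ _ _ _ h; rewrite !nnegrE powR_ge0 => /(_ isT c0).
by rewrite -powRrM mulVf ?gt_eqF// powRr1.
Qed.

Lemma pow2E (a : R) : `|a| `^ 2 = a ^+ 2.
Proof. by rewrite powR_mulrn// real_normK ?num_real. Qed.

Lemma in_Lp2 f : in_Lp Omega 2%:E f <-> sq f.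
Proof.
split=> [[mf nf]|[mf If]].
  split => //; have := normLp_lty_int (ltr0Sn _ 1) mf nf.
  by apply: int_eq => // x _; rewrite pow2E.
split => //; rewrite int_normLp ?ltry//.
by apply: int_eq If => // x _; rewrite pow2E.
Qed.

Lemma normLp2 f : sq f -> normLp Omega 2%:E f = (Num.sqrt (nq f))%:E.
Proof.
move=> [mf If]; rewrite int_normLp//; last by apply: int_eq If => // x _; rewrite pow2E.
have -> : I (fun x => `|f x| `^ 2) = nq f by apply: eqI => // x _; rewrite pow2E.
by rewrite powR12_sqrt ?nsq_ge0.
Qed.

Lemma normL2E f : sq f -> normL2 Omega f = Num.sqrt (nq f).
Proof. by move=> sf; rewrite /normL2 normLp2. Qed.

Lemma sqr_cvg0 (a : nat -> R) : a @ \oo --> 0 -> a n ^+ 2 @[n --> \oo] --> 0.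
Proof.
by move=> a0; rewrite -[X in _ --> X](mulr0 0); under eq_cvg do rewrite expr2; exact: cvgM.
Qed.

Lemma sum_cvg0 (J : finType) (a : J -> nat -> R) : (forall k, a k @ \oo --> 0) ->
  (\sum_k a k n) @[n --> \oo] --> 0.
Proof.
move=> a0; elim: (index_enum J) => [|j s ih].
  by under eq_cvg do rewrite big_nil; exact: cvg_cst.
under eq_cvg do rewrite big_cons.
by have := cvgD (a0 j) ih; rewrite addr0; exact.
Qed.

(** ** The space H^1 *)

Definition H1 f := in_W1p Omega 2%:E f.

Lemma H1P f : H1 f <-> sq f /\ forall i, exists g, is_wderiv Omega i f g /\ sq g.
Proof.
split=> [[/in_Lp2 sf h]|[sf h]].
  by split => // i; have [h1 /in_Lp2 h2] := h i; exists (wderiv Omega i f).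
split; first exact/in_Lp2.
move=> i; have [g [wg sg]] := h i; split; first exact: wderivP wg.
apply/in_Lp2; apply: sqi_ae sg => //.
  by apply: filterS (wderivE oO wg) => x hx /hx ->.
by have [_ []] := wderivP wg.
Qed.

Lemma H1_sq f : H1 f -> sq f. Proof. by move=> /H1P[]. Qed.

Lemma H1_wderiv f i : H1 f -> is_wderiv Omega i f (wderiv Omega i f).
Proof. by move=> [_ /(_ i)[]]. Qed.

Lemma H1_dsq f i : H1 f -> sq (wderiv Omega i f).
Proof. by move=> [_ /(_ i)[_ /in_Lp2]]. Qed.

Lemma H1D f g : H1 f -> H1 g -> H1 (fun x => f x + g x).
Proof.
move=> hf hg; apply/H1P; split; first by apply: sqiD => //; exact: H1_sq.
move=> i; exists (fun x => wderiv Omega i f x + wderiv Omega i g x); split.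
  by apply: is_wderivD => //; exact: H1_wderiv.
by apply: sqiD => //; exact: H1_dsq.
Qed.

Lemma H1Z c f : H1 f -> H1 (fun x => c * f x).
Proof.
move=> hf; apply/H1P; split; first by apply: sqiZ => //; exact: H1_sq.
move=> i; exists (fun x => c * wderiv Omega i f x); split.
  by apply: is_wderivZ => //; exact: H1_wderiv.
by apply: sqiZ => //; exact: H1_dsq.
Qed.

Lemma H1B f g : H1 f -> H1 g -> H1 (fun x => f x - g x).
Proof.
move=> hf hg; have := H1D hf (H1Z (-1) hg).
by under [X in H1 X]eq_fun do rewrite mulN1r.
Qed.

Lemma wderivD f g i : H1 f -> H1 g ->
  {ae mu, forall x, Omega x -> wderiv Omega i (fun x => f x + g x) x =
     wderiv Omega i f x + wderiv Omega i g x}.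
Proof. by move=> hf hg; apply: wderivE => //; apply: is_wderivD => //; exact: H1_wderiv. Qed.

Lemma wderivZ c f i : H1 f ->
  {ae mu, forall x, Omega x -> wderiv Omega i (fun x => c * f x) x = c * wderiv Omega i f x}.
Proof. by move=> hf; apply: wderivE => //; apply: is_wderivZ => //; exact: H1_wderiv. Qed.

Lemma wderivB f g i : H1 f -> H1 g ->
  {ae mu, forall x, Omega x -> wderiv Omega i (fun x => f x - g x) x =
     wderiv Omega i f x - wderiv Omega i g x}.
Proof.
move=> hf hg; apply: wderivE => //.
have := is_wderivD oO (H1_wderiv i hf) (is_wderivZ oO (-1) (H1_wderiv i hg)).
under [X in is_wderiv _ _ X _]eq_fun do rewrite mulN1r.
by under [X in is_wderiv _ _ _ X]eq_fun do rewrite mulN1r.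
Qed.

Lemma sq_cont f : continuous f -> sq f.
Proof.
move=> cf; have [M _ HM] := compact_bounded_fun cO cf.
apply: (sqi_bd mO fO (c := M)); last by move=> x Ox; apply: HM; exact: subset_closure.
by apply: measurable_funS (continuousT_measurable_rv cf).
Qed.

Lemma H1_smooth f : smooth f -> H1 f.
Proof.
move=> sf; apply/H1P; split; first by apply: sq_cont; exact: smooth_cont.
move=> i; exists (partial i f); split; first exact: is_wderiv_smooth.
by apply: sq_cont; apply: smooth_cont; exact: smooth_partial.
Qed.

Lemma wderiv_smooth f i : smooth f ->
  {ae mu, forall x, Omega x -> wderiv Omega i f x = partial i f x}.
Proof. by move=> sf; apply: wderivE => //; exact: is_wderiv_smooth. Qed.

Definition gradsq f : R := \sum_i nq (wderiv Omega i f).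

Lemma gradsqE f : gradsq f = \sum_i nq (wderiv Omega i f).
Proof. by []. Qed.

Lemma gradsq_ge0 f : 0 <= gradsq f.
Proof. by apply: sumr_ge0 => i _; exact: nsq_ge0. Qed.

Lemma nsq_ae f g : {ae mu, forall x, Omega x -> f x = g x} ->
  measurable_fun Omega f -> measurable_fun Omega g -> nq f = nq g.
Proof.
move=> fg mf mg; apply: I_ae => //; [|exact: measurable_funX|exact: measurable_funX].
by apply: filterS fg => x h /h ->.
Qed.

Lemma sq_enorm m n (A : point -> 'M[R]_(m, n)) : (forall k l, sq (fun x => A x k l)) ->
  sq (fun x => enorm (A x)) /\ nq (fun x => enorm (A x)) = \sum_k \sum_l nq (fun x => A x k l).
Proof.
move=> sA.
have Ikl k l : Int (fun x => A x k l ^+ 2) := (sA k l).2.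
have Ik k : Int (fun x => \sum_l A x k l ^+ 2) by exact: int_sum.
have E x : enorm (A x) ^+ 2 = \sum_k \sum_l A x k l ^+ 2.
  by rewrite enorm_sqr /dotm; under eq_bigr do under eq_bigr do rewrite -expr2.
split; last first.
  rewrite /nsq; under eq_Rintegral do rewrite E.
  by rewrite I_sum//; apply: eq_bigr => k _; rewrite I_sum.
split; last by under [X in Int X]eq_fun do rewrite E; exact: int_sum.
apply: (@measurableT_comp _ _ _ _ _ _ (@Num.sqrt R)).
  by apply: continuous_measurable_fun; exact: sqrt_continuous.
have -> : (fun x => dotm (A x) (A x)) = fun x => \sum_k \sum_l A x k l ^+ 2.
  by apply/funext => x; rewrite -enorm_sqr E.
apply: measurable_sum => k; apply: measurable_sum => l.
by apply: measurable_funX; exact: (sA k l).1.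
Qed.

Lemma normW1p_H1 f : H1 f ->
  normW1p Omega 2%:E f = (Num.sqrt (nq f) + Num.sqrt (gradsq f))%:E.
Proof.
move=> hf.
rewrite /normW1p normLp2; last exact: H1_sq.
have sG k l : sq (fun x => wgrad Omega f x k l).
  by under [X in sqi _ _ X]eq_fun do rewrite mxE; exact: H1_dsq.
have [s1 s2] := sq_enorm sG; rewrite normLp2// s2 -EFinD; congr (_ + Num.sqrt _)%:E.
rewrite big_ord1; apply: eq_bigr => i _; congr nsq.
by apply/funext => x; rewrite mxE.
Qed.

(** Convergence in H^1 is split into the L^2 convergence of the function and of
    each derivative, the form in which limits of integrals of products are
    taken. *)
Definition approx (phi : nat -> point -> R) f :=
  [/\ forall n, smooth (phi n), cv phi f &
      forall i, cv (fun n => partial i (phi n)) (wderiv Omega i f)].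

Lemma approxP (phi : nat -> point -> R) f : (forall n, smooth (phi n)) -> H1 f ->
  normW1p Omega 2%:E (fun x => phi n x - f x) @[n --> \oo] --> 0%E <-> approx phi f.
Proof.
move=> sp hf.
have hp n : H1 (fun x => phi n x - f x) by apply: H1B => //; exact: H1_smooth.
have sB n : sq (fun x => phi n x - f x) := H1_sq (hp n).
have gE n : gradsq (fun x => phi n x - f x) =
    \sum_i nq (fun x => partial i (phi n) x - wderiv Omega i f x).
  apply: eq_bigr => i _; apply: nsq_ae.
  - apply: filterS2 (wderivB i (H1_smooth (sp n)) hf) (wderiv_smooth i (sp n)).
    by move=> x h1 h2 Ox; rewrite h1// h2.
  - exact: (H1_dsq i (hp n)).1.
  - apply: measurable_funB; last exact: (H1_dsq i hf).1.
    by apply: (sq_cont _).1; apply: smooth_cont; exact: smooth_partial.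
rewrite (_ : (fun n => _) = (fun n => (Num.sqrt (nq (fun x => phi n x - f x)) +
   Num.sqrt (\sum_i nq (fun x => partial i (phi n) x - wderiv Omega i f x)))%:E)); last first.
  by apply/funext => n; rewrite normW1p_H1// gE.
have sqp n i : sq (partial i (phi n)) by apply: sq_cont; apply: smooth_cont; exact: smooth_partial.
split.
- move=> /fine_cvgP[_ h].
  have h1 : nq (fun x => phi n x - f x) @[n --> \oo] --> 0.
    rewrite (_ : (fun n => nq _) = (fun n => Num.sqrt (nq (fun x => phi n x - f x)) ^+ 2)); last first.
      by apply/funext => n; rewrite sqr_sqrtr ?nsq_ge0.
    apply: sqr_cvg0.
    by apply: cvg2_0le h => n /=; rewrite sqrtr_ge0/= lerDl sqrtr_ge0.
  have h2 : (\sum_i nq (fun x => partial i (phi n) x - wderiv Omega i f x)) @[n --> \oo] --> 0.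
    rewrite (_ : (fun n => \sum_i _) = (fun n => Num.sqrt (\sum_i nq (fun x => partial i (phi n) x - wderiv Omega i f x)) ^+ 2)); last first.
      by apply/funext => n; rewrite sqr_sqrtr// -gE gradsq_ge0.
    apply: sqr_cvg0.
    by apply: cvg2_0le h => n /=; rewrite sqrtr_ge0/= lerDr sqrtr_ge0.
  split => //; first by split => //; [move=> n; apply: H1_sq; exact: H1_smooth|exact: H1_sq].
  move=> i; split => //; first exact: H1_dsq.
  apply: cvg2_0le h2 => n; rewrite nsq_ge0/= (bigD1 i)//= lerDl.
  by apply: sumr_ge0 => j _; exact: nsq_ge0.
- move=> [_ [_ _ h1] h2]; apply: cvg_EFin; first exact: nearW.
  rewrite -[X in _ --> X](addr0 0); apply: cvgD; first exact: sqrt_cvg0.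
  by apply: sqrt_cvg0; apply: sum_cvg0 => i; have [_ _] := h2 i.
Qed.

Lemma approxD (phi psi : nat -> point -> R) f g : H1 f -> H1 g -> approx phi f -> approx psi g ->
  approx (fun n x => phi n x + psi n x) (fun x => f x + g x).
Proof.
move=> hf hg [sp cp dp] [ss cs ds]; split.
- by move=> n; apply: smoothD.
- exact: cvg2D.
move=> i; have [h1 h2 h3] := cvg2D mO (dp i) (ds i).
have E n : (fun x => partial i (phi n) x + partial i (psi n) x) = partial i (fun x => phi n x + psi n x).
  by apply/funext => x; rewrite partialD.
have hD := H1_dsq i (H1D hf hg).
split=> [n||]; [by rewrite -E|exact: hD|].
rewrite (_ : (fun n => _) = (fun n => nq (fun x => partial i (phi n) x + partial i (psi n) x - (wderiv Omega i f x + wderiv Omega i g x))))//.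
apply/funext => n; apply: nsq_ae.
- apply: filterS (wderivD i hf hg) => x h Ox; rewrite h//.
  by have := congr1 (fun F => F x) (E n) => /= ->.
- by apply: measurable_funB; [have := (h1 n).1; rewrite E|exact: hD.1].
- by apply: measurable_funB; [exact: (h1 n).1|exact: h2.1].
Qed.

Lemma approxZ c (phi : nat -> point -> R) f : H1 f -> approx phi f ->
  approx (fun n x => c * phi n x) (fun x => c * f x).
Proof.
move=> hf [sp cp dp]; split.
- by move=> n; apply: smoothZ.
- exact: cvg2Z.
move=> i; have [h1 h2 h3] := cvg2Z mO c (dp i).
have E n : (fun x => c * partial i (phi n) x) = partial i (fun x => c * phi n x).
  by apply/funext => x; rewrite partialZ.
have hD := H1_dsq i (H1Z c hf).
split=> [n||]; [by rewrite -E|exact: hD|].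
rewrite (_ : (fun n => _) = (fun n => nq (fun x => c * partial i (phi n) x - c * wderiv Omega i f x)))//.
apply/funext => n; apply: nsq_ae.
- apply: filterS (wderivZ c i hf) => x h Ox; rewrite h//.
  by have := congr1 (fun F => F x) (E n) => /= ->.
- by apply: measurable_funB; [have := (h1 n).1; rewrite E|exact: hD.1].
- by apply: measurable_funB; [exact: (h1 n).1|exact: h2.1].
Qed.

Lemma H10P f : in_H10 Omega f <-> H1 f /\ exists phi : nat -> point -> R, (forall n, test_fun Omega (phi n)) /\ approx phi f.
Proof.
split=> [[hf [phi [tp cp]]]|[hf [phi [tp cp]]]].
  split => //; exists phi; split => //; apply/approxP => // n; by have [] := tp n.
split => //; exists phi; split => //; apply/approxP => //; by case: cp.
Qed.

Lemma H10D f g : in_H10 Omega f -> in_H10 Omega g -> in_H10 Omega (fun x => f x + g x).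
Proof.
move=> /H10P[hf [phi [tp cp]]] /H10P[hg [psi [ts cs]]]; apply/H10P; split; first exact: H1D.
exists (fun n x => phi n x + psi n x); split; last exact: approxD.
by move=> n; exact: test_funD.
Qed.

Lemma H10Z c f : in_H10 Omega f -> in_H10 Omega (fun x => c * f x).
Proof.
move=> /H10P[hf [phi [tp cp]]]; apply/H10P; split; first exact: H1Z.
exists (fun n x => c * phi n x); split; last exact: approxZ.
by move=> n; exact: test_funZ.
Qed.

Lemma H10_test phi : test_fun Omega phi -> in_H10 Omega phi.
Proof.
move=> tp; have [sp _] := tp; have hp := H1_smooth sp; split => //.
exists (fun=> phi); split => //; apply/approxP => //; split => // [|i].
  by apply: cvg2_cst; exact: H1_sq.
have sd : sq (partial i phi) by apply: sq_cont; apply: smooth_cont; exact: smooth_partial.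
split => //; first exact: H1_dsq.
rewrite (_ : (fun n => _) = cst 0); first exact: cvg_cst.
apply/funext => n.
have -> : nq (fun x => partial i phi x - wderiv Omega i phi x) = nq (fun=> 0).
  apply: nsq_ae => //.
  - by apply: filterS (wderiv_smooth i sp) => x h /h ->; rewrite subrr.
  - by apply: measurable_funB; [exact: sd.1|exact: (H1_dsq i hp).1].
by rewrite /nsq; under eq_Rintegral do rewrite expr0n; rewrite /Rintegral integral0.
Qed.

Lemma trace_approx f g : H1 f -> is_trace Omega f g -> exists phi : nat -> point -> R, approx phi f.
Proof. by move=> hf [phi [sp cp _]]; exists phi; apply/approxP. Qed.

End domain_theory.

(** * Simplices and piecewise smooth functions *)

(** A function that is L-Lipschitz on each member of a finite closed cover of an
    interval is L-Lipschitz across it: starting from the left end, jump to the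
    last point of the member met there, and discard that member. *)
Lemma lipschitz_closed_cover (R : realType) (J : eqType) (s : seq J)
    (A : J -> set R) (f : R -> R) (L a b : R) : a <= b ->
  (forall k, k \in s -> closed (A k)) ->
  (forall k, k \in s -> forall x y, A k x -> A k y -> `|f x - f y| <= L * `|x - y|) ->
  (forall t, a <= t <= b -> exists2 k, k \in s & A k t) ->
  `|f b - f a| <= L * (b - a).
Proof.
elim: {s}(size s) {-2}s (leqnn (size s)) a => [|n ih] s.
  by rewrite leqn0 => /nilP-> a ab _ _ /(_ a); rewrite lexx ab => /(_ isT)[].
move=> sn a ab cA LA cov.
have [k0 k0s Aa] : exists2 k, k \in s & A k a by apply: cov; rewrite lexx.
(* The supremum c of S is the last point of [a, b] in A k0, so that every later
   point is covered by the other members. *)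
pose S := A k0 `&` [set t | a <= t <= b].
have hS : has_sup S.
  split; first by exists a; split => //=; rewrite lexx.
  by exists b => t [_ /andP[]].
set c := sup S.
have ac : a <= c by apply: ub_le_sup; [exact: hS.2|split => //=; rewrite lexx].
have cb : c <= b by apply: ge_sup; [exact: hS.1|move=> t [_ /andP[]]].
have Ac : A k0 c.
  apply: contrapT => nAc.
  have : nbhs c (~` A k0) by apply: open_nbhs_nbhs; split => //; exact/closed_openC/cA.
  move=> /nbhs_ballP[e /= e0 he].
  have [t St ct] := sup_adherent e0 hS.
  apply: (he t) St.1; rewrite /ball/= ger0_norm ?subr_ge0; last by apply: ub_le_sup => //; exact: hS.2.
  by move: ct; rewrite -/c; lra.
have fca : `|f c - f a| <= L * (c - a).
  by have := LA _ k0s _ _ Ac Aa; rewrite [`|c - a|]ger0_norm ?subr_ge0.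
have [->//|cnb] := eqVneq b c.
have {cnb}cb' : c < b by rewrite lt_neqAle eq_sym cnb.
pose s' := [seq k <- s | k != k0].
have s's k : k \in s' -> k \in s by rewrite mem_filter => /andP[].
have cov' t : c < t <= b -> exists2 k, k \in s' & A k t.
  move=> /andP[ct tb]; have [|k ks Akt] := cov t; first by rewrite tb (le_trans ac)// ltW.
  exists k => //; rewrite mem_filter ks andbT; apply: contraTneq isT => kk0.
  have St : S t by split; [rewrite -kk0|rewrite /= tb (le_trans ac)// ltW].
  by have := ub_le_sup hS.2 St; rewrite leNgt ct.
(* The point c is a limit of later points, hence in another member as well:
   the induction hypothesis can start from c. *)
have covc : exists2 k, k \in s' & A k c.
  apply: contrapT => nc.
  have near_nA : \forall t \near c, forall k, k \in s' -> ~ A k t.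
    have : forall k, k \in s' -> closed (A k) /\ ~ A k c.
      by move=> k ks; split; [exact/cA/s's|move=> Akc; apply: nc; exists k].
    elim: s' {s's cov' nc} => [_|k s' ihs h]; first by apply: (filterS _ (@filterT _ (nbhs c) _)) => t _ k.
    have [ck nk] := h k (mem_head _ _).
    have : \forall t \near c, ~ A k t by apply: open_nbhs_nbhs; split => //; exact: closed_openC.
    apply: filterS2 (ihs _) => [t h1 h2 k'|k' k's]; last by apply: h; rewrite inE k's orbT.
    by rewrite inE => /predU1P[->|]; [exact: h2|exact: h1].
  move: near_nA => /nbhs_ballP[e /= e0 he].
  pose t := Num.min b (c + e / 2).
  have ct : c < t by rewrite lt_min cb' ltrDl divr_gt0.
  have [|k ks Ak] := cov' t; first by rewrite ct ge_min lexx.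
  apply: (he t _ k ks Ak); rewrite /ball/= distrC ger0_norm ?subr_ge0 ?(ltW ct)//.
  have : t <= c + e / 2 by rewrite ge_min lexx orbT.
  by move: e0; lra.
have fbc : `|f b - f c| <= L * (b - c).
  apply: (ih s') => //.
  - rewrite -ltnS; apply: leq_trans sn; rewrite size_filter -(count_predC (pred1 k0) s).
    by rewrite -[X in (X < _)%N]add0n ltn_add2r -has_count has_pred1.
  - by move=> k /s's; exact: cA.
  - by move=> k /s's; exact: LA.
  - move=> t /andP[]; rewrite le_eqVlt => /predU1P[<- _|ct tb]; first exact: covc.
    by apply: cov'; rewrite ct.
have -> : f b - f a = (f b - f c) + (f c - f a) by ring.
apply: le_trans (ler_normD _ _) _.
by apply: le_trans (lerD fbc fca) _; rewrite -mulrDr; have -> : b - c + (c - a) = b - a by ring.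
Qed.

Section simplices.
Context {R : realType} {d : nat}.
Local Notation point := ('rV[R]_d).
Implicit Types (K : simplex R d) (x y : point).

Lemma baryE K x j : bary K x j =
  \sum_i (invmx (affine_mx K)) (lift ord0 i) j * x ord0 i + (invmx (affine_mx K)) ord0 j.
Proof.
rewrite /bary mxE big_ord_recl addrC; congr (_ + _).
  apply: eq_bigr => i _; rewrite mulrC; congr (_ * _).
  by rewrite (_ : lift ord0 i = rshift 1 i) ?row_mxEr//; exact: val_inj.
rewrite (_ : ord0 = lshift d ord0 :> 'I_(1 + d)); last exact: val_inj.
by rewrite (@row_mxEl _ 1 1 d) mxE eqxx mul1r; congr (invmx _ _ _); exact: val_inj.
Qed.

Lemma continuous_affine (a : 'I_d -> R) (c : R) :
  continuous (fun x : point => \sum_i a i * x ord0 i + c).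
Proof.
have sC s : continuous (fun x : point => \sum_(i <- s) a i * x ord0 i).
  elim: s => [|i s ih].
    have -> : (fun x : point => \sum_(i <- [::]) a i * x ord0 i) = fun=> 0.
      by apply/funext => x; rewrite big_nil.
    by move=> x; exact: cst_continuous.
  have -> : (fun x : point => \sum_(i <- i :: s) a i * x ord0 i) =
     fun x => a i * x ord0 i + \sum_(i <- s) a i * x ord0 i.
    by apply/funext => x; rewrite big_cons.
  move=> x; apply: (@continuousD _ _ _ (fun x : point => a i * x ord0 i)); last exact: ih.
  apply: (@continuousM _ _ (fun=> a i)); first exact: cst_continuous.
  exact: continuous_rv_coord.
move=> x; apply: (@continuousD _ _ _ (fun x : point => \sum_i a i * x ord0 i) (fun=> c)).
  exact: sC.
exact: cst_continuous.
Qed.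

Lemma continuous_bary K j : continuous (fun x => bary K x j).
Proof.
have -> : (fun x => bary K x j) = fun x : point =>
   \sum_i (invmx (affine_mx K)) (lift ord0 i) j * x ord0 i + (invmx (affine_mx K)) ord0 j.
  by apply/funext => x; exact: baryE.
exact: continuous_affine.
Qed.

Lemma closed_hull K : closed (hull K).
Proof.
have -> : hull K = \bigcap_(j in [set: 'I_d.+1]) (fun x => bary K x j) @^-1` [set t | 0 <= t].
  by apply/seteqP; split => x hx j; [move=> _; exact: hx|exact: hx].
apply: closed_bigI => j _; apply: closed_comp => [x _|]; last exact: closed_ge.
exact: continuous_bary.
Qed.

Lemma bary_interior K x : (forall j, 0 < bary K x j) -> \forall y \near x, hull K y.
Proof.
move=> hx.
have : \forall y \near x, forall j, 0 < bary K y j.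
  apply: (@filter_forall _ _ (fun j y => 0 < bary K y j) (nbhs x)) => j.
  by have := cvgr_gt _ (@continuous_bary K j x); apply.
by apply: filterS => y hy j; exact: ltW.
Qed.

(** A barycentric coordinate is an affine function that is not identically 0:
    its zero set is a hyperplane, or empty. *)
Lemma bary_zero_null K j : nondegenerate K -> leb R d [set x | bary K x j = 0] = 0%E.
Proof.
move=> nK; have [ha|nha] := pselect (exists i, (invmx (affine_mx K)) (lift ord0 i) j != 0).
  rewrite (_ : [set x : point | bary K x j = 0] = [set x | \sum_i (invmx (affine_mx K)) (lift ord0 i) j * x ord0 i +
     (invmx (affine_mx K)) ord0 j = 0]); first exact: leb_affine_null.
  by apply/funext => x /=; rewrite baryE.
have a0 i : (invmx (affine_mx K)) (lift ord0 i) j = 0.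
  by apply/eqP/negPn/negP => h; apply: nha; exists i.
rewrite (_ : [set x : point | bary K x j = 0] = set0) ?measure0// -subset0 => x /=.
rewrite baryE big1 ?add0r => [c0|i _]; last by rewrite a0 mul0r.
have : affine_mx K *m invmx (affine_mx K) = 1%:M by rewrite mulmxV.
move=> /(congr1 (fun M : 'M[R]_(d.+1) => M j j)).
rewrite !mxE eqxx big1 => [/esym/eqP|k _]; first by rewrite oner_eq0.
by case: (unliftP ord0 k) => [i ->|->]; rewrite ?a0 ?c0 mulr0.
Qed.

Lemma hull_vertices K x : nondegenerate K -> hull K x ->
  x = \sum_j bary K x j *: row j K /\ \sum_j bary K x j = 1.
Proof.
move=> nK hx.
have E : row_mx (1%:M : 'M[R]_1) x =
   (\row_j bary K x j) *m (row_mx (const_mx 1 : 'cV[R]_d.+1) K).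
  have -> : (\row_j bary K x j) = row_mx (1%:M : 'M[R]_1) x *m invmx (affine_mx K).
    by apply/rowP => j; rewrite mxE.
  by rewrite -mulmxA mulVmx// mulmx1.
move: E; rewrite mul_mx_row => /eq_row_mx[E1 E2]; split.
  rewrite {1}E2 mulmx_sum_row; apply: eq_bigr => j _; by rewrite mxE.
have := congr1 (fun M : 'M[R]_1 => M ord0 ord0) E1; rewrite !mxE eqxx mulr1n => ->.
by apply: eq_bigr => j _; rewrite !mxE mulr1.
Qed.

Lemma hull_bounded K : nondegenerate K -> exists M, forall x, hull K x -> `|x| <= M.
Proof.
move=> nK; exists (\sum_j `|row j K|) => x hx; have [xE s1] := hull_vertices nK hx.
rewrite {1}xE; apply: le_trans (ler_norm_sum _ _ _) _; apply: ler_sum => j _.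
rewrite normrZ ger0_norm; last exact: hx.
rewrite -[leRHS]mul1r ler_wpM2r// -s1 (bigD1 j)//= lerDl.
by apply: sumr_ge0 => k _; exact: hx.
Qed.

Lemma hulls_bounded (T : seq (simplex R d)) : (forall K, K \in T -> nondegenerate K) ->
  exists M, forall K x, K \in T -> hull K x -> `|x| <= M.
Proof.
elim: T => [_|K T ih nT]; first by exists 0.
have [M1 h1] := ih (fun K' h => nT K' (mem_behead (h : K' \in behead (K :: T)))).
have [M2 h2] := hull_bounded (nT K (mem_head _ _)).
exists (Num.max M1 M2) => K' x; rewrite inE => /predU1P[->|K'T] hx; rewrite le_max.
  by rewrite h2 ?orbT.
by rewrite (h1 K').
Qed.

Lemma closure_compact (Omega : set point) (T : seq (simplex R d)) :
  (forall K, K \in T -> nondegenerate K) ->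
  closure Omega = \bigcup_(K in [set` T]) hull K -> compact (closure Omega).
Proof.
move=> nT OT; have [M HM] := hulls_bounded nT.
apply: (@bounded_closed_compact_rv _ _ _ M); first exact: closed_closure.
by move=> x; rewrite OT => -[K /= KT]; exact: HM.
Qed.

End simplices.

(** ** Lipschitz functions with compact support that are C^1 off a null set *)

Section kinky.
Context {R : realType} {d : nat}.
Local Notation point := ('rV[R]_d).
Local Notation mu := (leb R d).
Local Notation e i := (delta_mx ord0 i : point).
Implicit Types (f F : point -> R) (x : point) (i : 'I_d).

(** The functions eps_h phi, with phi a test function, are of this kind, with N
    the skeleton of the mesh.  Lipschitz continuity is asked along coordinate
    lines only, which is what integration by parts uses. *)
Definition kinky (Omega N : set point) F :=
  [/\ continuous F,
      exists K, [/\ compact K, K `<=` Omega & forall x, ~ K x -> F x = 0],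
      forall i, exists2 L, 0 <= L & forall x t, `|F (x + t *: e i) - F x| <= L * `|t|,
      closed N /\ mu N = 0%E &
      forall x, ~ N x -> forall i, (\forall y \near x, derivable F y (e i)) /\
         {for x, continuous (partial i F)}].

(** On N the derivative is a default value about which nothing is known; the
    indicator makes the result bounded and measurable everywhere. *)
Definition kgrad (N : set point) i F x : R := \1_(~` N) x * partial i F x.

Lemma cvg_norm_le (u : nat -> R) (l C : R) : (forall n, `|u n| <= C) ->
  u @ \oo --> l -> `|l| <= C.
Proof.
move=> uC ul; have h : `|u n| @[n --> \oo] --> `|l| by exact: cvg_norm.
rewrite -(cvg_lim (@Rhausdorff R) h); apply: limr_le; first by apply/cvg_ex; exists `|l|.
exact: nearW.
Qed.

Lemma kgrad_bound N i F L x : 0 <= L -> (forall x t, `|F (x + t *: e i) - F x| <= L * `|t|) ->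
  (~ N x -> derivable F x (e i)) -> `|kgrad N i F x| <= L.
Proof.
move=> L0 FL dF; rewrite /kgrad indicE; have [Nx|Nx] := pselect (N x).
  by rewrite memNset ?mul0r ?normr0//; apply.
rewrite mem_set// mul1r.
have h : is_derive x (e i) F (partial i F x) by apply: DeriveDef => //; exact: dF.
apply: cvg_norm_le (is_derive_seq h) => n.
rewrite normrM ger0_norm// -ler_pdivlMl//; apply: le_trans (FL _ _) _.
by rewrite ger0_norm ?invr_ge0// mulrC.
Qed.

Lemma measurable_on_open_ext (V : set point) f : open V ->
  (forall x, V x -> {for x, continuous f}) ->
  measurable_fun setT (fun x => \1_V x * f x).
Proof.
move=> oV cf; have mV := open_measurable_rv oV.
have h := continuous_measurable_rv oV cf.
have -> : (fun x => \1_V x * f x) = f \_ V.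
  apply/funext => x; rewrite indicE patchE; case: ifP => _; by rewrite ?mul1r// mul0r.
exact/(measurable_restrictT f mV).
Qed.

Lemma measurable_kgrad Omega N F i : kinky Omega N F -> measurable_fun setT (kgrad N i F).
Proof.
move=> [_ _ _ [cN _] H]; apply: measurable_on_open_ext; first exact: closed_openC.
by move=> x Nx; have [] := H x Nx i.
Qed.

(** The product F psi is Lipschitz along lines and has compact support, so that
    its derivative, given off N by the product rule, has integral 0. *)
Lemma kinky_ibp Omega N F psi i : kinky Omega N F -> test_fun setT psi ->
  \int[mu]_x (F x * partial i psi x) = - \int[mu]_x (kgrad N i F x * psi x).
Proof.
move=> kF tp; have [cF [K [cK KO K0]] FL [cN N0] H] := kF.
have [L L0 HL] := FL i.
have [C C0 HC] := compact_bounded_fun cK cF.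
have FC x : `|F x| <= C.
  by have [/HC//|/K0 ->] := pselect (K x); rewrite normr0.
have [P P0 HP] := test_fun_bounded tp; have [Q Q0 HQ] := test_fun_lip i tp.
have [sp _] := tp; have [Q' Q'0 HQ'] := test_fun_bounded (test_fun_partial i tp).
have [M HM] := compact_norm_bound cK.
have mK := measurable_kgrad i kF.
have mF := continuousT_measurable_rv cF.
have mp := continuousT_measurable_rv (smooth_cont sp).
have mdp := continuousT_measurable_rv (smooth_cont (smooth_partial i sp)).
have mNset : measurable N := closed_measurable_rv cN.
have aeN : {ae mu, forall x, ~ N x}.
  by exists N; split => // x /=; rewrite -[X in _ -> X]notK.
have [|||||] := @integral_directional_derivative R d (fun x => F x * psi x)
   (fun x => kgrad N i F x * psi x + F x * partial i psi x) i M (L * P + C * Q).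
- by move=> x; apply: continuousM; [exact: cF|exact: smooth_cont].
- by move=> x /HM h; rewrite K0 ?mul0r.
- move=> x t.
  have -> : F (x + t *: e i) * psi (x + t *: e i) - F x * psi x =
     (F (x + t *: e i) - F x) * psi (x + t *: e i) + F x * (psi (x + t *: e i) - psi x) by ring.
  apply: le_trans (ler_normD _ _) _; rewrite !normrM mulrDl; apply: lerD.
    by rewrite mulrAC; apply: ler_pM.
  by rewrite -mulrA; apply: ler_pM.
- apply: filterS aeN => x Nx.
  have [dF _] := H x Nx i.
  apply: is_derive_mul; last exact: smooth_is_derive.
  rewrite /kgrad indicE mem_set// mul1r; apply: DeriveDef => //; exact: nbhs_singleton dF.
- by apply: measurable_funD; exact: measurable_funM.
move=> _ h0.
have KB : mu.-integrable setT (EFin \o (fun x => F x * partial i psi x)).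
  have hK : mu.-integrable setT (EFin \o (fun x => (C * Q') * \1_K x)).
    apply: intZ => //; apply/integrableP; split; first by apply/measurable_EFinP; exact: measurable_indic (compact_measurable_rv cK).
    under eq_integral do rewrite /= ger0_norm//.
    by rewrite integral_indic//; [rewrite setIT; exact: compact_measure_fin|exact: compact_measurable_rv].
  apply: int_dom hK _ => //; first exact: measurable_funM.
  move=> x _; rewrite normrM indicE; have [Kx|Kx] := pselect (K x).
    by rewrite mem_set// mulr1; apply: ler_pM.
  by rewrite K0// normr0 mul0r memNset// mulr0.
have KB2 : mu.-integrable setT (EFin \o (fun x => kgrad N i F x * psi x)).
  have hK : mu.-integrable setT (EFin \o (fun x => (L * P) * \1_K x)).
    apply: intZ => //; apply/integrableP; split; first by apply/measurable_EFinP; exact: measurable_indic (compact_measurable_rv cK).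
    under eq_integral do rewrite /= ger0_norm//.
    by rewrite integral_indic//; [rewrite setIT; exact: compact_measure_fin|exact: compact_measurable_rv].
  apply: int_dom hK _ => //; first exact: measurable_funM.
  move=> x _; rewrite normrM indicE; have [Kx|Kx] := pselect (K x).
    rewrite mem_set// mulr1; apply: ler_pM => //.
    by apply: kgrad_bound => // nN; have [/nbhs_singleton] := H x nN i.
  rewrite /kgrad (partial_eq0 (f := F)) ?mulr0 ?normr0 ?mul0r ?memNset// ?mulr0//.
  by apply: filterS (near_out cK Kx) => y; exact: K0.
apply/eqP; rewrite -addr_eq0 addrC -RintegralD//; exact/eqP.
Qed.

End kinky.

(** * Continuous piecewise affine functions *)

Section piecewise_affine.
Context {R : realType} {d : nat}.
Local Notation point := ('rV[R]_d).
Local Notation mu := (leb R d).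
Local Notation e i := (delta_mx ord0 i : point).
Implicit Types (f F phi : point -> R) (x : point) (i : 'I_d).

Lemma cvg_near_const f x (r : R) : (\forall y \near x, f y = r) -> f @ x --> r.
Proof.
move=> h A Ar; apply: filterS h => y /= ->; exact: nbhs_singleton Ar.
Qed.

(** The zero sets of the barycentric coordinates are whole hyperplanes, more
    than the faces; the union is still closed and null, and off it every point
    of an element is interior to the element. *)
Definition skeleton (T : seq (simplex R d)) : set point :=
  [set x | exists K, K \in T /\ exists j, bary K x j = 0].

Lemma closed_skeleton T : closed (skeleton T).
Proof.
rewrite -(setCK (skeleton T)); apply: open_closedC; rewrite openE => x nx.
have {}nx K j : K \in T -> bary K x j != 0.
  by move=> KT; apply/eqP => h; apply: nx; exists K; split => //; exists j.
have H : \forall y \near x, forall K, K \in T -> forall j, bary K y j != 0.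
  elim: T nx => [_|K T ih h]; first by apply: (filterS _ (@filterT _ (nbhs x) _)) => y _ K.
  have h1 : \forall y \near x, forall j, bary K y j != 0.
    apply: (@filter_forall _ _ (fun j y => bary K y j != 0) (nbhs x)) => j.
    by have := cvgr_neq0 (bary K x j) (@continuous_bary _ _ K j x); apply; apply: h; exact: mem_head.
  have h2 := ih (fun K' j K'T => h K' j (mem_behead (K'T : K' \in behead (K :: T)))).
  apply: filterS2 h1 h2 => y h1 h2 K'; rewrite inE => /predU1P[->|/h2//].
  exact: h1.
by apply: filterS H => y hy [K [KT [j /eqP]]]; apply/negP; exact: hy.
Qed.

Lemma null_skeleton T : (forall K, K \in T -> nondegenerate K) -> mu (skeleton T) = 0%E.
Proof.
move=> nT.
have H : {ae mu, forall x, forall K, K \in T -> forall j, bary K x j <> 0}.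
  elim: T nT => [_|K T ih h]; first by apply: aeW.
  have h1 : {ae mu, forall x, forall j, bary K x j <> 0}.
    apply: (@ae_forall_countable _ _ 'I_d.+1) => j.
    exists [set x | bary K x j = 0]; split.
    + apply: closed_measurable_rv.
      rewrite (_ : [set x : point | _] = (fun x => bary K x j) @^-1` [set 0])//.
      by apply: closed_comp => [x _|]; [exact: continuous_bary|exact: closed_eq].
    + by apply: bary_zero_null; apply: h; exact: mem_head.
    + by move=> x /= /contrapT.
  have h2 := ih (fun K' K'T => h K' (mem_behead (K'T : K' \in behead (K :: T)))).
  apply: filterS2 h1 h2 => y h1 h2 K'; rewrite inE => /predU1P[->|/h2//].
  exact: h1.
have mN := closed_measurable_rv (@closed_skeleton T).
apply/eqP; rewrite -measure_le0; case: H => A [mA <- NA]; apply: le_measure; rewrite ?inE//.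
by apply: subset_trans NA => x [K [KT [j h0]]] /= h; exact: h K KT j h0.
Qed.

Lemma P1_affine K f : is_P1 K f ->
  exists (a : 'I_d -> R) c, forall x, hull K x -> f x = \sum_i a i * x ord0 i + c.
Proof.
move=> [a [c h]]; exists (fun i => a i ord0), c => x /h ->; congr (_ + _).
by rewrite mxE; apply: eq_bigr => i _; rewrite mulrC.
Qed.

Lemma is_derive_affine (a : 'I_d -> R) c x j :
  is_derive x (e j) (fun y : point => \sum_i a i * y ord0 i + c) (a j).
Proof.
apply/is_derive_line.
have -> : (fun s : R => \sum_i a i * (x + s *: e j) ord0 i + c) =
   (fun s : R => (\sum_i a i * x ord0 i + c) + s * a j).
  apply/funext => s; rewrite addrAC; congr (_ + _).
  have E i : a i * (x + s *: e j) ord0 i = a i * x ord0 i + a i * (s * (i == j)%:R).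
    by rewrite !mxE eqxx mulrDr.
  rewrite (eq_bigr _ (fun i _ => E i)) big_split/=; congr (_ + _).
  rewrite (bigD1 j)//= big1 ?addr0 => [|i ij]; last by rewrite (negbTE ij) !mulr0.
  by rewrite eqxx mulr1 mulrC.
have := is_deriveD (is_derive_cst (\sum_i a i * x ord0 i + c) (0 : R) (1 : R))
  (is_derive_mul (is_derive_id (0 : R) (1 : R)) (is_derive_cst (a j) (0 : R) (1 : R))).
by move/is_derive_eq; apply; rewrite mulr0 mul1r addr0 add0r.
Qed.

Variables (Omega : set point) (T : seq (simplex R d)) (eh : point -> R) (M : R).
Hypothesis oO : open Omega.
Hypothesis nT : forall K, K \in T -> nondegenerate K.
Hypothesis OT : closure Omega = \bigcup_(K in [set` T]) hull K.
Hypothesis Meh : in_Mh Omega T eh.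
Hypothesis ehM : forall x, closure Omega x -> `|eh x| <= M.
Local Notation N := (skeleton T).
Let mO : measurable Omega. Proof. exact: open_measurable_rv. Qed.

Lemma pl_continuous x : Omega x -> {for x, continuous eh}.
Proof.
move=> Ox; have := continuous_subspaceW (@subset_closure _ Omega) Meh.1.
rewrite continuous_open_subspace// => h; apply: h; by rewrite inE.
Qed.

Lemma pl_measurable : measurable_fun Omega eh.
Proof. by apply: continuous_measurable_rv => //; exact: pl_continuous. Qed.

Lemma pl_slopes : exists2 L, 0 <= L & forall K, K \in T -> exists (a : 'I_d -> R) c,
  (forall i, `|a i| <= L) /\ forall x, hull K x -> eh x = \sum_i a i * x ord0 i + c.
Proof.
have [_] := Meh; elim: (T) => [_|K S ih h]; first by exists 0.
have [L L0 HL] := ih (fun K' K'T => h K' (mem_behead (K'T : K' \in behead (K :: S)))).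
have [a [c ac]] := P1_affine (h K (mem_head _ _)).
exists (Num.max L (\sum_i `|a i|)); first by rewrite le_max L0.
move=> K'; rewrite inE => /predU1P[->|/HL[a' [c' [h1 h2]]]].
  exists a, c; split => // i; rewrite le_max; apply/orP; right.
  by rewrite (bigD1 i)//= lerDl; apply: sumr_ge0.
by exists a', c'; split => // i; rewrite le_max h1.
Qed.

Lemma pl_near L x : (forall K, K \in T -> exists (a : 'I_d -> R) c,
    (forall i, `|a i| <= L) /\ forall x, hull K x -> eh x = \sum_i a i * x ord0 i + c) ->
  Omega x -> ~ N x -> exists (a : 'I_d -> R) c, (forall i, `|a i| <= L) /\
    \forall y \near x, eh y = \sum_i a i * y ord0 i + c.
Proof.
move=> HL Ox Nx; have : closure Omega x := subset_closure Ox.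
rewrite OT => -[K /= KT hK]; have [a [c [aL ac]]] := HL K KT.
exists a, c; split => //; apply: filterS (bary_interior (K := K) (x := x) _); first exact: ac.
move=> j; rewrite lt_neqAle hK andbT eq_sym; apply/eqP => h0.
by apply: Nx; exists K; split => //; exists j.
Qed.

Lemma near_derive_affine f x (a : 'I_d -> R) c i :
  (\forall y \near x, f y = \sum_i a i * y ord0 i + c) -> is_derive x (e i) f (a i).
Proof.
move=> h; apply: near_eq_is_derive (is_derive_affine a c x i).
by apply: filterS h => y ->.
Qed.

Lemma pl_partial_near L x i : (forall K, K \in T -> exists (a : 'I_d -> R) c,
    (forall i, `|a i| <= L) /\ forall x, hull K x -> eh x = \sum_i a i * x ord0 i + c) ->
  Omega x -> ~ N x -> exists2 r, `|r| <= L & \forall y \near x, is_derive y (e i) eh r.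
Proof.
move=> HL Ox Nx; have [a [c [aL h]]] := pl_near HL Ox Nx.
exists (a i) => //; have := nbhs_interior h; apply: filterS => y hy.
exact: near_derive_affine hy.
Qed.

(** Along a segment, the parameters at which it runs in a given element, or
    outside Omega, form a finite closed cover; on each member the product is
    Lipschitz with the same constant. *)
Lemma kinky_pl phi : test_fun Omega phi -> kinky Omega N (fun x => eh x * phi x).
Proof.
move=> tp; have [sp [K0 [cK KO K00]]] := tp.
have [L L0 HL] := pl_slopes.
have Kz x : ~ K0 x -> eh x * phi x = 0 by move=> h; rewrite K00 ?mulr0.
split.
- move=> x; have [Ox|nO] := pselect (Omega x).
    by apply: continuousM; [exact: pl_continuous|exact: smooth_cont].
  have nK : ~ K0 x by move=> /KO.
  rewrite /continuous_at Kz//; apply: cvg_near_const.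
  by apply: filterS (near_out cK nK) => y ny; rewrite Kz.
- by exists K0.
- move=> i; have [P P0 HP] := test_fun_bounded tp; have [Q Q0 HQ] := test_fun_lip i tp.
  exists (P * L + `|M| * Q); first by rewrite addr_ge0 ?mulr_ge0.
  have key x t : 0 <= t -> `|eh (x + t *: e i) * phi (x + t *: e i) - eh x * phi x| <= (P * L + `|M| * Q) * t.
    move=> t0; pose f s := eh (x + s *: e i) * phi (x + s *: e i).
    have ctr : continuous (fun s : R => x + s *: e i).
      by move=> s; apply: cvgD; [exact: cvg_cst|apply: cvgZr_tmp; exact: cvg_id].
    (* None stands for the complement of Omega, where phi vanishes. *)
    pose A (k : option (simplex R d)) : set R :=
      if k is Some K then [set s | hull K (x + s *: e i)] else [set s | ~ Omega (x + s *: e i)].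
    have := @lipschitz_closed_cover R _ (None :: [seq Some K | K <- T]) A f (P * L + `|M| * Q) 0 t t0.
    rewrite /f scale0r addr0 subr0; apply.
    + move=> [K|] _ /=.
        rewrite (_ : [set s | _] = (fun s : R => x + s *: e i) @^-1` hull K)//.
        by apply: closed_comp => [s _|]; [exact: ctr|exact: closed_hull].
      rewrite (_ : [set s | _] = (fun s : R => x + s *: e i) @^-1` (~` Omega))//.
      by apply: closed_comp => [s _|]; [exact: ctr|exact: open_closedC].
    + move=> k; rewrite inE => /predU1P[->|/mapP[K KT ->]] u v /=.
        by move=> nu nv; rewrite (K00 _ (fun h => nu (KO _ h))) (K00 _ (fun h => nv (KO _ h))) !mulr0 subrr normr0 mulr_ge0// addr_ge0 ?mulr_ge0.
      move=> hu hv; set y := x + u *: e i; set z := x + v *: e i.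
      have cz : closure Omega z by rewrite OT; exists K.
      have [a [c [aL ac]]] := HL K KT.
      have yz : y = z + (u - v) *: e i by rewrite /y /z scalerBl; apply/rowP => j; rewrite !mxE; ring.
      have deh : `|eh y - eh z| <= L * `|u - v|.
        rewrite (ac y hu) (ac z hv) opprD addrACA subrr addr0 -sumrB (eq_bigr (fun j => a j * ((u - v) * (e i) ord0 j))); last first.
          by move=> j _; rewrite yz !mxE; ring.
        rewrite (bigD1 i)//= big1 ?addr0 => [|j ji]; rewrite !mxE eqxx/= ?eqxx; last first.
          by rewrite (negbTE ji) !mulr0.
        by rewrite mulr1 normrM ler_wpM2r.
      have dphi : `|phi y - phi z| <= Q * `|u - v| by rewrite yz; exact: HQ.
      have -> : eh y * phi y - eh z * phi z = (eh y - eh z) * phi y + eh z * (phi y - phi z) by ring.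
      apply: le_trans (ler_normD _ _) _; rewrite !normrM mulrDl; apply: lerD.
        by rewrite mulrAC -[P * _ * _]mulrA mulrC; apply: ler_pM => //; rewrite mulrC.
      rewrite -mulrA; apply: ler_pM => //; apply: le_trans (ehM cz) _; exact: ler_norm.
    + move=> s _; have [Os|nO] := pselect (Omega (x + s *: e i)); last by exists None; rewrite ?mem_head.
      have : closure Omega (x + s *: e i) by exact: subset_closure.
      rewrite OT => -[K /= KT hK]; exists (Some K) => //.
      by rewrite inE; apply/orP; right; apply/mapP; exists K.
  move=> x t; have [t0|t0] := leP 0 t; first by rewrite [X in _ <= _ * X]ger0_norm// key.
  have := key (x + t *: e i) (- t); rewrite -addrA -scalerDl subrr scale0r addr0 => h.
  by rewrite distrC [X in _ <= _ * X]ltr0_norm//; apply: h; rewrite oppr_ge0 ltW.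
- by split; [exact: closed_skeleton|exact: null_skeleton].
- move=> x Nx i; have [Ox|nO] := pselect (Omega x); last first.
    have nK : ~ K0 x by move=> /KO.
    have h0 : \forall y \near x, eh y * phi y = 0 by apply: filterS (near_out cK nK) => y; exact: Kz.
    have h1 : \forall y \near x, is_derive y (e i) (fun x => eh x * phi x) 0.
      apply: filterS (nbhs_interior h0) => y hy.
      apply: near_eq_is_derive (is_derive_cst (0 : R) y (e i)).
      by apply: filterS hy => z ->.
    split; first by apply: filterS h1 => y [].
    rewrite /prop_for /continuous_at (partial_eq0 i h0).
    by apply: cvg_near_const; apply: filterS h1 => y [_].
  have [r _ hr] := pl_partial_near i HL Ox Nx.
  have h1 : \forall y \near x, is_derive y (e i) (fun x => eh x * phi x) (r * phi y + eh y * partial i phi y).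
    by apply: filterS hr => y hy; apply: is_derive_mul => //; exact: smooth_is_derive.
  split; first by apply: filterS h1 => y [].
  rewrite /prop_for /continuous_at.
  have [_ E] := nbhs_singleton h1; rewrite -[partial i _ x]/('D_(e i) _ x) E.
  have ch : (fun y => r * phi y + eh y * partial i phi y) @ x --> r * phi x + eh x * partial i phi x.
    apply: (@continuousD R R point (fun y => r * phi y) (fun y => eh y * partial i phi y)).
      by apply: (@continuousM R point (fun=> r)); [exact: cst_continuous|exact: smooth_cont].
    by apply: continuousM; [exact: pl_continuous|exact: (smooth_cont (smooth_partial i sp))].
  apply: cvg_trans ch; apply: (@near_eq_cvg _ R (nbhs x) _ (fun y => r * phi y + eh y * partial i phi y) (partial i (fun x => eh x * phi x))).
  by apply: filterS h1 => y [_ <-].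
Qed.

Lemma kgrad_pl_near i x : Omega x -> ~ N x -> \forall y \near x, kgrad N i eh y = partial i eh x.
Proof.
move=> Ox Nx; have [L L0 HL] := pl_slopes; have [r _ hr] := pl_partial_near i HL Ox Nx.
have [_ Ex] := nbhs_singleton hr.
have nN : \forall y \near x, ~ N y by apply: open_nbhs_nbhs; split => //; exact/closed_openC/closed_skeleton.
apply: filterS2 nN hr => y ny [_ Ey]; rewrite /kgrad indicE mem_set// mul1r.
by rewrite /partial Ex Ey.
Qed.

Lemma measurable_kgrad_pl i : measurable_fun Omega (kgrad N i eh).
Proof.
have oV : open (Omega `&` ~` N) by apply: openI => //; exact/closed_openC/closed_skeleton.
have := @measurable_on_open_ext R d _ (kgrad N i eh) oV.
move=> h; have {}h := h _.
have : measurable_fun Omega (fun x => \1_(Omega `&` ~` N) x * kgrad N i eh x).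
  apply: measurable_funS (h _) => // x [Ox Nx].
  have H := kgrad_pl_near i Ox Nx; rewrite /prop_for /continuous_at (nbhs_singleton H).
  exact: cvg_near_const.
apply: eq_measurable_fun => x; rewrite inE => Ox; rewrite indicE /kgrad indicE.
have -> : (x \in Omega `&` ~` N) = (x \in ~` N) by rewrite in_setI mem_set.
by rewrite mulrA -natrM mulnb andbb.
Qed.

Lemma kgrad_pl_bound : exists2 L, 0 <= L & forall i x, Omega x -> `|kgrad N i eh x| <= L.
Proof.
have [L L0 HL] := pl_slopes; exists L => // i x Ox.
rewrite /kgrad indicE; have [Nx|Nx] := pselect (N x); first by rewrite memNset ?mul0r ?normr0//; apply.
rewrite mem_set// mul1r; have [r rL hr] := pl_partial_near i HL Ox Nx.
by have [_ Ex] := nbhs_singleton hr; rewrite /partial Ex.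
Qed.

Lemma kgrad_plM phi i x : smooth phi -> Omega x -> ~ N x ->
  kgrad N i (fun x => eh x * phi x) x = kgrad N i eh x * phi x + eh x * partial i phi x.
Proof.
move=> sp Ox Nx; have [L L0 HL] := pl_slopes; have [r _ hr] := pl_partial_near i HL Ox Nx.
have dr := nbhs_singleton hr; have [_ Ex] := dr.
rewrite /kgrad indicE mem_set// !mul1r.
have [_ h] := is_derive_mul dr (smooth_is_derive i x sp).
by rewrite /partial h Ex.
Qed.

Lemma ae_skeleton : {ae mu, forall x, ~ N x}.
Proof.
exists N; split; [exact: closed_measurable_rv (@closed_skeleton T)|exact: null_skeleton|].
by move=> x /= /contrapT.
Qed.

(** The derivative of eh phi has integral 0 for every test function phi, and
    off the skeleton it is given by the product rule. *)
Lemma pl_wderiv i : compact (closure Omega) -> is_wderiv Omega i eh (kgrad N i eh).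
Proof.
move=> cO; have [L L0 HL] := kgrad_pl_bound.
have l1 : in_L1loc Omega eh.
  apply: l1loc_bd => //; split; first exact: pl_measurable.
  by move=> K cK KO; exists M => x /KO Ox; apply: ehM; exact: subset_closure.
have l2 : in_L1loc Omega (kgrad N i eh).
  apply: l1loc_bd => //; split; first exact: measurable_kgrad_pl.
  by move=> K cK KO; exists L => x /KO; exact: HL.
split => // phi tp; have [sp [K0 [cK KO K00]]] := tp.
have kF := kinky_pl tp.
have [_ _ FL _ H] := kF; have [L' L'0 HL'] := FL i.
have [Mb HMb] := compact_norm_bound cK.
have [|||||_ h0] := @integral_directional_derivative R d (fun x => eh x * phi x)
   (kgrad N i (fun x => eh x * phi x)) i Mb L'.
- by have [] := kF.
- by move=> x /HMb h; rewrite K00// mulr0.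
- exact: HL'.
- apply: filterS ae_skeleton => x Nx; rewrite /kgrad indicE mem_set// mul1r.
  by apply: DeriveDef => //; have [/nbhs_singleton] := H x Nx i.
- exact: measurable_kgrad kF.
move: h0; rewrite -(integ_supp (Omega := Omega)); last first.
  move=> x nO; rewrite /kgrad (partial_eq0 (f := fun x => eh x * phi x)) ?mulr0//.
  by apply: filterS (near_out cK (fun h => nO (KO _ h))) => y ny; rewrite K00 ?mulr0.
have i1 := l1loc_int_test oO l1 (test_fun_partial i tp).
have i2 := l1loc_int_test oO l2 tp.
have i3 := intD mO i2 i1.
have -> : integ Omega (kgrad N i (fun x => eh x * phi x)) =
   integ Omega (fun x => kgrad N i eh x * phi x + eh x * partial i phi x).
  apply: I_ae => //.
  - by apply: filterS ae_skeleton => x Nx Ox; exact: kgrad_plM.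
  - by apply: measurable_funS (measurable_kgrad i kF).
  - exact: int_meas i3.
rewrite /integ RintegralD// => h0; apply/eqP; rewrite -addr_eq0 addrC; exact/eqP.
Qed.

End piecewise_affine.

(** * Regularisation by convolution *)

Lemma leb_box_gt0 (R : realType) n (a b : 'I_n -> R) : (forall i, a i < b i) ->
  (0 < leb R n (box a b))%E.
Proof.
elim: n a b => [|n ih] a b ab.
  have -> : leb R 0 (box a b) = dirac (const_mx 0 : 'rV[R]_0) (box a b) :> \bar R by [].
  by rewrite diracE mem_set ?lte01//; case.
rewrite [X in (_ < X)%E](_ : _ = lebesgue_step (leb R n) (box a b))//.
rewrite /lebesgue_step /pushforward.
rewrite (_ : _ @^-1` _ = `]a ord0, b ord0[%classic `*`
   box (fun i => a (lift ord0 i)) (fun i => b (lift ord0 i))).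
  rewrite product_measure1E//; last exact: measurable_box.
  apply: mule_gt0; last by apply: ih => i; exact: ab.
  rewrite -[X in (_ < X)%E]/(lebesgue_measure `]a ord0, b ord0[%classic).
  by rewrite lebesgue_measure_itv/= lte_fin ab -EFinB lte_fin subr_gt0 ab.
apply/seteqP; split => [[t y]/= ty|[t y]/= [] tt yy i].
  split; first by rewrite in_itv/= -[t](rv_cons0 t y); exact: ty.
  by move=> i; rewrite -(rv_consS t y i); exact: ty.
case: (unliftP ord0 i) => [j ->|->]; last by rewrite rv_cons0; rewrite /= in_itv in tt.
by have -> : rv_cons (t, y) ord0 (lift ord0 j) = y ord0 j := rv_consS t y j; exact: yy.
Qed.

Section mollification.
Context {R : realType} {d : nat}.
Local Notation point := ('rV[R]_d).
Local Notation mu := (leb R d).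
Local Notation e i := (delta_mx ord0 i : point).
Implicit Types (f F k phi : point -> R) (x y z : point) (i : 'I_d).
Local Notation Int f := (mu.-integrable setT (EFin \o f)).

Lemma near_norm_lt x (eps : R) : 0 < eps -> \forall y \near x, `|x - y| < eps.
Proof.
move=> e0; have e20 : 0 < eps / 2 by rewrite divr_gt0.
apply: filterS (nbhsx_ballx x (PosNum e20)%:num _) => //= y [_ xy].
apply: (@le_lt_trans _ _ (eps / 2)); last by rewrite ltr_pdivrMr// ltr_pMr// ltrDl.
apply: norm_le_coord => [|i]; first exact: ltW.
by have := xy ord0 i; rewrite /ball/= !mxE; exact: ltW.
Qed.

Lemma test_fun_lip_norm k : test_fun setT k ->
  exists2 L, 0 <= L & forall x y, `|k x - k y| <= L * `|x - y|.
Proof.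
move=> tk; have /choice[L HL] : forall i, exists L, 0 <= L /\ forall x t, `|k (x + t *: e i) - k x| <= L * `|t|.
  by move=> i; have [L L0 h] := test_fun_lip i tk; exists L.
exists (\sum_i L i); first by apply: sumr_ge0 => i _; exact: (HL i).1.
move=> x y.
have key s : `|k (y + \sum_(i <- s) (x - y) ord0 i *: e i) - k y| <= \sum_(i <- s) L i * `|x - y|.
  elim: s => [|i s ih]; first by rewrite !big_nil addr0 subrr normr0.
  rewrite !big_cons; set w := \sum_(j <- s) _ in ih *.
  have -> : k (y + ((x - y) ord0 i *: e i + w)) - k y =
     (k (y + w + (x - y) ord0 i *: e i) - k (y + w)) + (k (y + w) - k y).
    by rewrite [_ *: _ + w]addrC addrA; ring.
  apply: le_trans (ler_normD _ _) _; apply: lerD => //.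
  apply: le_trans ((HL i).2 _ _) _; rewrite ler_wpM2l ?(HL i).1//.
  exact: coord_le_norm.
have := key (index_enum 'I_d); rewrite -row_sum_delta [y + _]addrC subrK.
by rewrite mulr_suml.
Qed.

(** A quadratic remainder that is uniform in the base point passes under the
    integral sign; this is how convolutions are differentiated. *)
Lemma test_fun_taylor k i : test_fun setT k ->
  exists2 C, 0 <= C & forall x t, `|k (x + t *: e i) - k x - t * partial i k x| <= C * t ^+ 2.
Proof.
move=> tk; have [Q Q0 HQ] := test_fun_lip i (test_fun_partial i tk).
have key x t : 0 <= t -> `|k (x + t *: e i) - k x - t * partial i k x| <= Q * t ^+ 2.
  move=> t0; have dk s : is_derive s (1 : R) (fun s => k (x + s *: e i)) (partial i k (x + s *: e i)).
    by apply: is_derive_shiftline; apply: smooth_is_derive; case: tk.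
  have [|s] := @MVT_segment R (fun s => k (x + s *: e i)) (fun s => partial i k (x + s *: e i)) 0 t t0 (fun s _ => dk s).
    apply: continuous_subspaceT => s; apply: differentiable_continuous.
    by apply/derivable1_diffP; have [] := dk s.
  rewrite in_itv/= scale0r addr0 subr0 => /andP[s0 st] ->.
  rewrite mulrC -mulrBr normrM ger0_norm// expr2 mulrCA ler_wpM2l//.
  by apply: le_trans (HQ _ _) _; rewrite ger0_norm// ler_wpM2l.
exists (2 * Q); first by rewrite mulr_ge0.
move=> x t; have [t0|t0] := leP 0 t.
  by apply: le_trans (key x t t0) _; rewrite ler_wpM2r ?sqr_ge0//; lra.
have := key (x + t *: e i) (- t); rewrite -[_ + _ + - t *: _]addrA -scalerDl subrr scale0r addr0 oppr_ge0 => /(_ (ltW t0)).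
have := HQ x t; set a := partial i k _; set b := partial i k x; set u := k (x + t *: e i); set v := k x.
move=> h1 h2; have -> : u - v - t * b = - (v - u - - t * a) + t * (a - b) by ring.
apply: le_trans (ler_normD _ _) _; rewrite normrN normrM.
have h3 : `|t| * `|a - b| <= Q * t ^+ 2.
  by rewrite -real_normK ?num_real// expr2 mulrCA ler_wpM2l.
by move: h2 h3; rewrite sqrrN; lra.
Qed.

Lemma is_derive_quadratic f x i D C : 0 <= C ->
  (forall t, `|f (x + t *: e i) - f x - t * D| <= C * t ^+ 2) -> is_derive x (e i) f D.
Proof.
move=> C0 h; have H : (fun t : R => t^-1 *: ((f \o shift x) (t *: e i) - f x)) @ 0^' --> D.
  apply/cvgrPdist_le => eps eps0.
  have h1 : \forall t \near (0 : R)^', `|t| < eps / (C + 1).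
    by apply: dnbhs0_lt; rewrite divr_gt0// ltr_wpDl.
  have h2 : \forall t \near (0 : R)^', t != 0 by exact: nbhs_dnbhs_neq.
  apply: filterS2 h1 h2 => t te t0.
  rewrite /= [t *: e i + x]addrC; have := h t; set u := f _; set v := f x => hu.
  have -> : D - t^-1 *: (u - v) = - (t^-1 * (u - v - t * D)).
    have -> : t^-1 * (u - v - t * D) = t^-1 * (u - v) - D by rewrite mulrBr mulrA mulVf// mul1r.
    by rewrite opprB.
  rewrite normrN normrM normfV ler_pdivrMl ?normr_gt0//.
  apply: le_trans hu _; rewrite -real_normK ?num_real// expr2 mulrCA ler_wpM2l//.
  move: te; rewrite ltr_pdivlMr ?ltr_wpDl// => te.
  by have := normr_ge0 t; lra.
by apply: DeriveDef; [apply/cvg_ex; exists D|apply: cvg_lim].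
Qed.

Lemma smooth_translate k x : smooth k -> smooth (fun z => k (z - x)).
Proof.
move=> sk; apply: (@smooth_coind _ _ (fun f => exists2 k, smooth k & f = fun z => k (z - x))); last by exists k.
have D k' z i : smooth k' -> is_derive z (e i) (fun z => k' (z - x)) (partial i k' (z - x)).
  move=> sk'; apply/is_derive_line.
  under [X in is_derive _ _ X]eq_fun do rewrite addrAC.
  by apply/is_derive_line; exact: smooth_is_derive.
move=> _ [k' sk' ->]; split.
- move=> z; apply: (@continuous_comp _ _ _ (fun z => z - x) k'); last exact: smooth_cont.
  by apply: (@continuousB _ _ _ id); [exact: cvg_id|exact: cst_continuous].
- by move=> i z; have [] := D k' z i sk'.
- move=> i; exists (partial i k'); first exact: smooth_partial.
  by apply/funext => z; have [_ <-] := D k' z i sk'.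
Qed.

Lemma partial_translate k x i z : smooth k ->
  partial i (fun z => k (z - x)) z = partial i k (z - x).
Proof.
move=> sk; have h : is_derive z (e i) (fun z => k (z - x)) (partial i k (z - x)).
  apply/is_derive_line; under [X in is_derive _ _ X]eq_fun do rewrite addrAC.
  by apply/is_derive_line; exact: smooth_is_derive.
by have [_ <-] := h.
Qed.

Lemma test_fun_translate k x : test_fun setT k -> test_fun setT (fun z => k (z - x)).
Proof.
move=> [sk [K [cK _ K0]]]; split; first exact: smooth_translate.
exists ((fun z => z + x) @` K); split => //.
  apply: continuous_compact => //; apply: continuous_subspaceT => z.
  by apply: (@continuousD _ _ _ id); [exact: cvg_id|exact: cst_continuous].
move=> z nz; apply: K0 => Kz; apply: nz; exists (z - x) => //; by rewrite subrK.
Qed.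

(** Convolution of F with the reflection of k. *)
Definition moll k F x : R := \int[mu]_z (F z * k (z - x)).

Section fixed_density.
Variable F : point -> R.
Hypothesis iF : Int F.

Lemma moll_int k x : test_fun setT k -> Int (fun z => F z * k (z - x)).
Proof.
move=> tk; have [M M0 HM] := test_fun_bounded tk.
have mk : measurable_fun setT (fun z => k (z - x)).
  by apply: continuousT_measurable_rv; apply: smooth_cont; apply: smooth_translate; case: tk.
apply: (int_dom measurableT (g := fun z => M * `|F z|)).
- by apply: measurable_funM => //; exact: int_meas iF.
- by apply: intZ => //; exact: int_abs.
- by move=> z _; rewrite normrM mulrC ler_wpM2r.
Qed.

(** Derivatives fall on the kernel, so that multiples of convolutions of F with
    test functions form a class stable under derivation. *)
Lemma moll_smooth k : test_fun setT k -> smooth (moll k F) /\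
  forall i x, partial i (moll k F) x = - moll (partial i k) F x.
Proof.
have NF0 : 0 <= \int[mu]_z `|F z| by apply: Rintegral_ge0 => z _.
have iA := int_abs iF.
have D k' x i : test_fun setT k' -> is_derive x (e i) (moll k' F) (- moll (partial i k') F x).
  move=> tk; have [C C0 HC] := test_fun_taylor i tk.
  apply: (@is_derive_quadratic _ _ _ _ (C * \int[mu]_z `|F z|)); first exact: mulr_ge0.
  move=> t; have I1 := moll_int (x + t *: e i) tk; have I2 := moll_int x tk.
  have I3 := moll_int x (test_fun_partial i tk).
  have -> : moll k' F (x + t *: e i) - moll k' F x - t * - moll (partial i k') F x =
     \int[mu]_z (F z * (k' (z - x + (- t) *: e i) - k' (z - x) - (- t) * partial i k' (z - x))).
    rewrite mulrN opprK /moll -RintegralB// -RintegralZl// -RintegralD//; last 2 first.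
    - exact: intB.
    - exact: intZ.
    by apply: eqI => // z _; rewrite scaleNr opprD addrA; ring.
  apply: (@le_trans _ _ (\int[mu]_z (C * t ^+ 2 * `|F z|))).
    apply: I_abs_le => //; last first.
    - by move=> z _; rewrite normrM mulrC ler_wpM2r// -[t ^+ 2]sqrrN.
    - by apply: intZ.
    have h : Int (fun z => F z * (k' (z - x + (- t) *: e i)) - F z * k' (z - x) + t * (F z * partial i k' (z - x))).
      apply: intD => //; last exact: intZ.
      apply: intB => //.
      by apply: int_eq I1 => // z _; rewrite scaleNr opprD addrA.
    apply: eq_measurable_fun (int_meas h) => z _; ring.
  by rewrite RintegralZl// mulrAC.
move=> tk; split; last by move=> i x; have [_] := D k x i tk.
apply: (@smooth_coind _ _ (fun f => exists c, exists2 k, test_fun setT k & f = fun x => c * moll k F x)); last first.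
  by exists 1, k => //; apply/funext => x; rewrite mul1r.
move=> _ [c [k' tk' ->]].
have D' i x : is_derive x (e i) (fun x => c * moll k' F x) (c * - moll (partial i k') F x).
  have := is_derive_mul (is_derive_cst c x (e i)) (D k' x i tk').
  by move/is_derive_eq; apply; rewrite mul0r add0r.
split; last 2 first.
- by move=> i x; have [] := D' i x.
- move=> i; exists (- c), (partial i k'); first exact: test_fun_partial.
  by apply/funext => x; have [_ E] := D' i x; rewrite /partial E mulrN mulNr.
suff H (x : point) : moll k' F @ x --> moll k' F x.
  move=> x; apply: (@continuousM R point (fun=> c)); [exact: cst_continuous|exact: H].
have [L L0 HL] := test_fun_lip_norm tk'.
apply/(@cvgrPdist_le _ _ _ (nbhs x)) => eps eps0.
pose B := L * \int[mu]_z `|F z| + 1.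
have B0 : 0 < B by rewrite ltr_wpDl// mulr_ge0.
have : \forall y \near x, `|x - y| < eps / B.
  by apply: near_norm_lt; rewrite divr_gt0.
apply: filterS => y xy.
have I1 := moll_int x tk'; have I2 := moll_int y tk'.
have -> : moll k' F x - moll k' F y = \int[mu]_z (F z * (k' (z - x) - k' (z - y))).
  by rewrite /moll -RintegralB//; apply: eqI => // z _; rewrite mulrBr.
apply: (@le_trans _ _ (\int[mu]_z (L * `|x - y| * `|F z|))).
  apply: I_abs_le => //.
  - have := int_meas (intB measurableT I1 I2); apply: eq_measurable_fun => z _; by rewrite mulrBr.
  - exact: intZ.
  - move=> z _; rewrite normrM mulrC ler_wpM2r//; apply: le_trans (HL _ _) _.
    have -> : z - x - (z - y) = - (x - y) by apply/rowP => j; rewrite !mxE; ring.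
    by rewrite normrN.
rewrite RintegralZl//; move: xy; rewrite ltr_pdivlMr// /B mulrDr mulr1 => xy.
by have := normr_ge0 (x - y); lra.
Qed.

End fixed_density.

Definition mollifier (r : R) k := [/\ test_fun setT k, forall z, 0 <= k z,
  forall z, r < `|z| -> k z = 0 & \int[mu]_z k z = 1].

Lemma test_fun_int k : test_fun setT k -> Int k.
Proof.
move=> tk; have l1 : in_L1loc [set: point] (fun=> 1) by exact: (l1loc_smooth openT (@smooth_cst R d 1)).
by apply: int_eq (l1loc_int_test openT l1 tk) => // x _; rewrite mul1r.
Qed.

(** A normalised bump on a box; its integral is positive because the bump is
    positive on the box, which has positive measure. *)
Lemma mollifier_ex (r : R) : 0 < r -> exists k, mollifier r k.
Proof.
move=> r0; pose a (_ : 'I_d) := - r; pose b (_ : 'I_d) := r.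
pose k0 := box_bump a b; pose c := \int[mu]_z k0 z.
have ab i : a i < b i by rewrite /a /b gtrN.
have tk : test_fun setT k0.
  split; first exact: smooth_box_bump.
  exists (cbox a b); split => //; first exact: compact_cbox.
  move=> x nx; apply: box_bump_eq0; apply: contra_not nx => abx i.
  by have /andP[? ?] := abx i; rewrite !ltW.
have Ik := test_fun_int tk.
have mk := continuousT_measurable_rv (smooth_cont tk.1).
have c0 : 0 < c.
  rewrite lt_neqAle Rintegral_ge0 ?andbT; last by move=> x _; exact: box_bump_ge0.
  apply/eqP => /esym c0.
  have h0 : (\int[mu]_z `|(k0 z)%:E| = 0)%E.
    under eq_integral do rewrite gee0_abs ?lee_fin ?box_bump_ge0//.
    by rewrite -[LHS]fineK ?[fine _]c0//; exact: integrable_fin_num Ik.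
  have := (ae_eq_integral_abs mu measurableT (measurable_int _ Ik)).1 h0.
  move=> [A [mA A0 HA]].
  have : (mu (box a b) <= mu A)%E.
    apply: le_measure; rewrite ?inE//; first exact: measurable_box.
    move=> x abx; apply: HA => /= h; have [] := h Logic.I.
    by apply/eqP; rewrite gt_eqF//; exact: box_bump_gt0.
  by rewrite A0 leNgt leb_box_gt0.
exists (fun z => c^-1 * k0 z); split.
- exact: test_funZ.
- by move=> z; rewrite mulr_ge0 ?box_bump_ge0// invr_ge0 ltW.
- move=> z rz; rewrite /k0 box_bump_eq0 ?mulr0// => abz; move: rz; rewrite ltNge => /negP; apply.
  apply: norm_le_coord => [|i]; first exact: ltW.
  by have /andP[? ?] := abz i; rewrite ler_norml !ltW.
- by rewrite RintegralZl// mulVf// gt_eqF.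
Qed.

Lemma mollifier_close (r : R) k F x c eta : mollifier r k -> Int F -> 0 <= eta ->
  (forall z, `|z - x| <= r -> `|F z - c| <= eta) -> `|moll k F x - c| <= eta.
Proof.
move=> [tk k0 kr k1] iF eta0 Fc; have tkx := test_fun_translate x tk.
have kx1 : \int[mu]_z k (z - x) = 1.
  rewrite -k1 /Rintegral; apply: (congr1 fine).
  apply: (@integral_leb_translate R d (- x) (EFin \o k)); apply/measurable_EFinP.
  by apply: continuousT_measurable_rv; apply: smooth_cont; case: tk.
have Ik := test_fun_int tkx; have IF := moll_int iF x tk.
have -> : moll k F x - c = \int[mu]_z ((F z - c) * k (z - x)).
  rewrite -[c in LHS]mulr1 -kx1 -RintegralZl// /moll -RintegralB//; last exact: intZ.
  by apply: eqI => // z _; rewrite mulrBl.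
rewrite -[eta]mulr1 -kx1 -RintegralZl//; apply: I_abs_le => //.
- have := int_meas (intB measurableT IF (intZ measurableT c Ik)).
  by apply: eq_measurable_fun => z _; rewrite mulrBl.
- exact: intZ.
move=> z _; rewrite normrM [`|k _|]ger0_norm//.
have [zr|zr] := leP `|z - x| r; first by rewrite ler_wpM2r// Fc.
by rewrite kr// !mulr0.
Qed.

Lemma mollifier_cvg (k_ : nat -> point -> R) F x : (forall n, mollifier n.+1%:R^-1 (k_ n)) ->
  Int F -> {for x, continuous F} -> moll (k_ n) F x @[n --> \oo] --> F x.
Proof.
move=> mk iF cF; apply/cvgrPdist_le => eps eps0.
have : \forall z \near x, `|F z - F x| <= eps.
  have h := (@cvgrPdist_le _ _ _ (nbhs x) _ F (F x)).1 cF eps eps0.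
  by apply: filterS (h _) => z; rewrite distrC.
move=> /nbhs_ballP[del /= del0 hd].
have : \forall n \near \oo, n.+1%:R^-1 < del.
  by have := cvgr_lt _ (@cvg_harmonic R); apply.
apply: filterS => n nd; rewrite distrC; apply: mollifier_close (mk n) iF (ltW eps0) _ => z zx.
apply: hd; split => // i j; rewrite (ord1 i) /ball/=.
have := le_trans (coord_le_norm (z - x) j) zx; rewrite !mxE distrC => h.
exact: le_lt_trans h nd.
Qed.

Lemma cvg2_dct (D : set point) (f_ : nat -> point -> R) f (L : R) : measurable D -> (mu D < +oo)%E ->
  (forall n, measurable_fun D (f_ n)) -> measurable_fun D f ->
  (forall n x, D x -> `|f_ n x| <= L) -> (forall x, D x -> `|f x| <= L) ->
  {ae mu, forall x, D x -> f_ n x @[n --> \oo] --> f x} -> cvg2 mu D f_ f.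
Proof.
move=> mD fD mf_ mf fL_ fL fc; split => [n||].
- by apply: (sqi_bd mD fD (mf_ n)) => x; exact: fL_.
- exact: (sqi_bd mD fD mf fL).
have IL := int_cst mD fD ((2 * L) ^+ 2).
have [|||||i1 _ h] := @dominated_convergence _ _ _ mu D mD
   (fun n x => ((f_ n x - f x) ^+ 2)%:E) (cst 0%E) (EFin \o (fun=> (2 * L) ^+ 2)).
- by move=> n; apply/measurable_EFinP; apply: measurable_funX; exact: measurable_funB.
- exact: measurable_cst.
- apply: filterS fc => x h Dx; apply: cvg_EFin; first exact: nearW.
  by apply: sqr_cvg0; rewrite -(subrr (f x)); apply: cvgB (h Dx) _; exact: cvg_cst.
- exact: IL.
- apply: aeW => x n Dx; rewrite lee_fin normrX lerXn2r ?nnegrE//; last first.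
    by apply: le_trans (ler_normB _ _) _; have := fL_ n x Dx; have := fL x Dx; lra.
  by apply: mulr_ge0 => //; apply: le_trans (fL x Dx).
rewrite integral0 in h.
by move/fine_cvgP : h => -[_]; exact.
Qed.

(** Around each point of K some radius serves a whole neighbourhood of that
    point; compactness makes it uniform. *)
Lemma compact_fattening (K Omega : set point) : compact K -> open Omega -> K `<=` Omega ->
  exists2 r : R, 0 < r & forall x z, K z -> `|z - x| <= r -> Omega x.
Proof.
move=> cK oO KO.
have H : \forall n \near \oo, forall z, K z -> forall x, `|z - x| <= n.+1%:R^-1 -> Omega x.
  have := (compact_near_coveringP K).1 cK nat \oo (fun n z => forall x, `|z - x| <= n.+1%:R^-1 -> Omega x).
  apply => z Kz; have /nbhs_ballP[del /= del0 hd] : nbhs z Omega by exact: open_nbhs_nbhs (conj oO (KO z Kz)).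
  have d20 : 0 < del / 2 by rewrite divr_gt0.
  have h1 : \forall n \near \oo, n.+1%:R^-1 < del / 2.
    by have := cvgr_lt _ (@cvg_harmonic R); apply.
  have h2 : \forall z' \near z, `|z - z'| < del / 2 by exact: near_norm_lt.
  exists ([set z' | `|z - z'| < del / 2], [set n | n.+1%:R^-1 < del / 2]); first by split.
  move=> [z' n]/= [zz nd] x zx; apply: hd; split => // i j; rewrite (ord1 i) /ball/=.
  have h : `|z - x| < del.
    have -> : z - x = (z - z') + (z' - x) by rewrite addrA subrK.
    apply: le_lt_trans (ler_normD _ _) _; move: zz (le_lt_trans zx nd); lra.
  by have := le_lt_trans (coord_le_norm (z - x) j) h; rewrite !mxE.
have [n _ hn] := H.
by exists n.+1%:R^-1 => // x z Kz; exact: (hn n (leqnn n)).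
Qed.

Lemma moll_test Omega K r k F : compact K -> (forall x z, K z -> `|z - x| <= r -> Omega x) ->
  (forall x, ~ K x -> F x = 0) -> Int F -> mollifier r k -> test_fun Omega (moll k F).
Proof.
move=> cK KO F0 iF [tk _ kr _]; split; first exact: (moll_smooth iF tk).1.
exists ((fun p : point * point => p.1 - p.2) @` (K `*` [set y | `|y| <= r])); split.
- apply: continuous_compact; last first.
    apply: compact_setX => //; apply: (@bounded_closed_compact_rv _ _ _ r) => //.
    exact: closed_ball_norm.
  apply: continuous_subspaceT => p; apply: continuousB; [exact: cvg_fst|exact: cvg_snd].
- by move=> _ [[z y]/= [Kz yr] <-]; apply: KO Kz _; rewrite opprB addrC subrK.
- move=> x nx; rewrite /moll; under eq_Rintegral => z _.
    rewrite (_ : F z * k (z - x) = 0); first over.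
    have [Kz|/F0 ->] := pselect (K z); last by rewrite mul0r.
    rewrite kr ?mulr0// ltNge; apply/negP => zr; apply: nx; exists (z, z - x) => //=.
    by rewrite opprB addrC subrK.
  by rewrite /Rintegral integral0.
Qed.

Lemma kinky_int Omega N F : kinky Omega N F -> Int F /\ forall i, Int (kgrad N i F).
Proof.
move=> kF; have [cF [K [cK KO K0]] FL [cN N0] H] := kF.
have iK (M : R) : Int (fun x => M * \1_K x).
  apply: intZ => //; apply/integrableP; split; first by apply/measurable_EFinP; exact: measurable_indic (compact_measurable_rv cK).
  under eq_integral do rewrite /= ger0_norm//.
  by rewrite integral_indic//; [rewrite setIT; exact: compact_measure_fin|exact: compact_measurable_rv].
split => [|i].
  have [C C0 HC] := compact_bounded_fun cK cF.
  apply: int_dom (iK C) _ => //; first exact: continuousT_measurable_rv.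
  move=> x _; rewrite indicE; have [Kx|Kx] := pselect (K x); first by rewrite mem_set// mulr1 HC.
  by rewrite K0// normr0 memNset// mulr0.
have [L L0 HL] := FL i.
apply: int_dom (iK L) _ => //; first exact: measurable_kgrad kF.
move=> x _; rewrite indicE; have [Kx|Kx] := pselect (K x).
  rewrite mem_set// mulr1; apply: kgrad_bound => // Nx.
  by have [/nbhs_singleton] := H x Nx i.
rewrite memNset// mulr0 /kgrad (partial_eq0 (f := F)) ?mulr0 ?normr0//.
by apply: filterS (near_out cK Kx) => y; exact: K0.
Qed.

(** Mollify F.  By parts, the derivatives of the mollification are the
    mollifications of [kgrad N i F].  Both families are bounded, and they
    converge off the null set N, where F and its derivatives are continuous. *)
Theorem kinky_approx Omega N F : open Omega -> compact (closure Omega) -> kinky Omega N F ->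
  exists Psi : nat -> point -> R, [/\ forall n, test_fun Omega (Psi n),
    cvg2 mu Omega Psi F & forall i, cvg2 mu Omega (fun n => partial i (Psi n)) (kgrad N i F)].
Proof.
move=> oO cO kF; have [cF [K [cK KO K0]] FL [cN N0] H] := kF.
have [iF iG] := kinky_int kF.
have mO := domain_measurable oO; have fO := domain_fin oO cO.
have /choice[k_ Hk] : forall n : nat, exists k, mollifier n.+1%:R^-1 k by move=> n; exact: mollifier_ex.
have [r r0 Hr] := compact_fattening cK oO KO.
(* The first m kernels are too wide to keep the support inside Omega. *)
have [m hm] : exists m : nat, m.+1%:R^-1 < r.
  by have [m _ hm] := cvgr_lt _ (@cvg_harmonic R) r r0; exists m; exact: (hm m (leqnn m)).
pose l n := (n + m)%N.
have lr n : (l n).+1%:R^-1 <= r.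
  by apply: ltW; apply: le_lt_trans hm; rewrite lef_pV2 ?posrE ?ltr0n// ler_nat ltnS leq_addl.
pose Psi n := moll (k_ (l n)) F.
have tPsi n : test_fun Omega (Psi n).
  apply: moll_test cK _ K0 iF (Hk (l n)) => x z Kz zx; apply: Hr Kz _; exact: le_trans zx (lr n).
have dPsi i n : partial i (Psi n) = moll (k_ (l n)) (kgrad N i F).
  have [tk _ _ _] := Hk (l n); apply/funext => x.
  rewrite (moll_smooth iF tk).2 /moll.
  have := kinky_ibp i kF (test_fun_translate x tk).
  under eq_Rintegral => z _ do rewrite (partial_translate x i z tk.1).
  by move=> ->; rewrite opprK.
have [C C0 HC] := compact_bounded_fun cK cF.
have FC x : `|F x| <= C.
  by have [/HC//|/K0 ->] := pselect (K x); rewrite normr0.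
have cvl G x : Int G -> {for x, continuous G} -> moll (k_ (l n)) G x @[n --> \oo] --> G x.
  by move=> iG' cG; have := mollifier_cvg Hk iG' cG; rewrite -(cvg_shiftn m).
have bd G (L : R) x n : Int G -> (forall x, `|G x| <= L) -> `|moll (k_ (l n)) G x| <= L.
  move=> iG' GL; have := @mollifier_close _ _ G x 0 L (Hk (l n)) iG' (le_trans _ (GL x)).
  by rewrite subr0; apply => // z _; rewrite subr0.
exists Psi; split => // [|i].
  apply: (@cvg2_dct _ _ _ C) => //.
  - by move=> n; apply: measurable_funS (continuousT_measurable_rv (smooth_cont (tPsi n).1)).
  - by apply: measurable_funS (continuousT_measurable_rv cF).
  - by move=> n x _; exact: bd.
  - by apply: aeW => x _; exact: cvl _ _ iF (cF x).
have [L L0 HL] := FL i.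
have GL x : `|kgrad N i F x| <= L.
  by apply: kgrad_bound => // Nx; have [/nbhs_singleton] := H x Nx i.
apply: (@cvg2_dct _ _ _ L) => //.
- by move=> n; apply: measurable_funS (continuousT_measurable_rv (smooth_cont (smooth_partial i (tPsi n).1))).
- by apply: measurable_funS (measurable_kgrad i kF).
- by move=> n x _; rewrite dPsi; exact: bd.
exists N; split => //; first exact: closed_measurable_rv.
move=> x /=; apply: contra_notP => Nx _.
under eq_cvg do rewrite dPsi.
apply: cvl => //; have [_ cg] := H x Nx i.
have nN : \forall y \near x, ~ N y by apply: open_nbhs_nbhs; split => //; exact: closed_openC.
have E y : ~ N y -> kgrad N i F y = partial i F y by move=> Ny; rewrite /kgrad indicE mem_set// mul1r.
rewrite /prop_for /continuous_at E//; apply: cvg_trans cg.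
apply: (@near_eq_cvg _ R (nbhs x) _ (partial i F) (kgrad N i F)).
by apply: filterS nN => y Ny; rewrite E.
Qed.

End mollification.

(** * Sobolev bounds for test functions *)

(** Since h vanishes far to the left, h s is the integral of h' up to s. *)
Lemma abs_le_integral_derivative (R : realType) (h h' : R -> R) (M : R) :
  (forall t, is_derive t (1 : R) h (h' t)) -> continuous h' ->
  (forall t, M < `|t| -> h t = 0) ->
  forall s, (`|h s|%:E <= \int[@lebesgue_measure R]_t `|h' t|%:E)%E.
Proof.
move=> dh ch' h0 s; pose a := - (`|M| + `|s| + 1).
have as_ : a < s.
  have := ler_norm (- s); rewrite normrN /a => ?; have := normr_ge0 M; lra.
have ha : h a = 0.
  apply: h0; rewrite /a normrN ger0_norm ?addr_ge0//.
  have := ler_norm M; have := normr_ge0 s; lra.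
have ch : continuous h.
  move=> t; apply: differentiable_continuous; apply/derivable1_diffP.
  by have [] := dh t.
have E : (\int[@lebesgue_measure R]_(t in `[a, s]) (h' t)%:E)%E = ((h s)%:E - (h a)%:E)%E.
  apply: continuous_FTC2 => //.
  - exact: continuous_subspaceT.
  - split; first by move=> t _; have [] := dh t.
      by apply: cvg_at_right_filter; exact: ch.
    by apply: cvg_at_left_filter; exact: ch.
  - by move=> t _; have [_ <-] := dh t; rewrite derive1E.
rewrite ha sube0 in E.
have mh' : measurable_fun setT h' by exact: continuous_measurable_fun.
have mh : measurable_fun setT (EFin \o h') by exact/measurable_EFinP.
rewrite -abse_EFin -E; apply: le_trans (le_abse_integral _ _ _) _ => //.
  exact: measurable_funS mh.
apply: ge0_subset_integral => //.
exact: measurableT_comp.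
Qed.

Lemma iterated_integral_le_prod d1 d2 (T1 : measurableType d1) (T2 : measurableType d2)
    (R : realType) (m1 : {sigma_finite_measure set T1 -> \bar R})
    (m2 : {sigma_finite_measure set T2 -> \bar R}) (f : T1 * T2 -> \bar R)
    (Q : T1 -> \bar R) (P : T2 -> \bar R) :
  measurable_fun setT f -> (forall p, 0 <= f p)%E ->
  measurable_fun setT Q -> measurable_fun setT P ->
  (forall t, 0 <= Q t)%E -> (forall y, 0 <= P y)%E ->
  (forall t y, f (t, y) <= P y * Q t)%E ->
  (\int[m1]_t \int[m2]_y f (t, y) <= (\int[m2]_y P y) * (\int[m1]_t Q t))%E.
Proof.
move=> mf f0 mQ mP Q0 P0 fPQ; rewrite -ge0_integralZl//; last exact: integral_ge0.
apply: ge0_le_integral => //.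
- by move=> t _; exact: integral_ge0.
- exact: (@measurable_fun_fubini_tonelli_F _ _ _ _ _ m2 f).
- exact: measurable_funeM.
move=> t _; rewrite -ge0_integralZr//.
apply: ge0_le_integral => //.
- by apply: (measurableT_comp mf); exact: measurable_pair1.
- exact: emeasurable_funM.
Qed.

Section plane.
Context {R : realType}.
Implicit Types F : 'rV[R]_2 -> R.
Local Open Scope ereal_scope.

Lemma rv_cons_line n (t s : R) (y : 'rV[R]_n) :
  (rv_cons (t, y) + s *: delta_mx ord0 ord0 = rv_cons (t + s, y))%R.
Proof.
apply/rowP => i; case: (unliftP ord0 i) => [j ->|->]; rewrite !mxE.
  have := rv_consS t y j; have := rv_consS (t + s)%R y j; rewrite !mxE => -> ->.
  by rewrite eqxx mulr0 addr0.
by have := rv_cons0 t y; have := rv_cons0 (t + s)%R y; rewrite !mxE => -> ->; rewrite !eqxx mulr1.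
Qed.

Lemma rv_cons_tail n (t s : R) (y : 'rV[R]_n) j :
  (rv_cons (t, y) + s *: delta_mx ord0 (lift ord0 j) = rv_cons (t, y + s *: delta_mx ord0 j))%R.
Proof.
apply/rowP => i; case: (unliftP ord0 i) => [k ->|->]; rewrite !mxE.
  have := rv_consS t y k; have := rv_consS t (y + s *: delta_mx ord0 j) k; rewrite !mxE => -> ->.
  by rewrite eqxx/= (inj_eq (@lift_inj _ _)).
by have := rv_cons0 t y; have := rv_cons0 t (y + s *: delta_mx ord0 j); rewrite !mxE => -> ->; rewrite eqxx/= mulr0 addr0.
Qed.

Lemma integral_leb1 (f : 'rV[R]_1 -> \bar R) : measurable_fun setT f -> (forall x, 0 <= f x) ->
  \int[leb R 1]_y f y = \int[@lebesgue_measure R]_s f (@rv_cons R 0 (s, const_mx 0%R)).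
Proof.
move=> mf f0; rewrite ge0_integral_leb_step//; apply: eq_integral => s _.
rewrite [LHS](_ : _ = \int[\d_(const_mx 0%R : 'rV[R]_0)]_y f (rv_cons (s, y)))//.
rewrite integral_dirac//; first by rewrite diracT mul1e.
by apply: (measurableT_comp mf); apply: measurableT_comp; [exact: measurable_rv_cons|exact: measurable_pair1].
Qed.

(** At each point |F| is at most the integral of a partial derivative over
    either coordinate line through it.  So F^2 is at most a function of the
    second coordinate times a function of the first. *)
Lemma gagliardo_nirenberg_plane F : test_fun setT F ->
  \int[leb R 2]_x (F x ^+ 2)%:E <=
  (\int[leb R 2]_x `|partial ord0 F x|%:E) * (\int[leb R 2]_x `|partial (lift ord0 ord0) F x|%:E).
Proof.
move=> tF; have [sF [K [cK _ K0]]] := tF.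
have [M HM] := compact_norm_bound cK.
set i0 : 'I_2 := ord0; set i1 : 'I_2 := lift ord0 ord0.
have line i x t : is_derive t (1%R : R) (fun s => F (x + s *: delta_mx ord0 i)%R) (partial i F (x + t *: delta_mx ord0 i)%R).
  by apply: is_derive_shiftline; exact: smooth_is_derive.
have mp i : measurable_fun setT (fun x => `|partial i F x|%:E).
  apply/measurable_EFinP; apply: measurableT_comp => //.
  by apply: continuousT_measurable_rv; apply: smooth_cont; exact: smooth_partial.
have mcons (f : 'rV[R]_2 -> \bar R) : measurable_fun setT f -> measurable_fun setT (f \o @rv_cons R 1).
  by move=> mf; apply: measurableT_comp => //; exact: measurable_rv_cons.
have lbound i x s : `|F (x + s *: delta_mx ord0 i)%R|%:E <=
    \int[@lebesgue_measure R]_t `|partial i F (x + t *: delta_mx ord0 i)%R|%:E.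
  apply: (@abs_le_integral_derivative R (fun s => F (x + s *: delta_mx ord0 i)%R)
     (fun t => partial i F (x + t *: delta_mx ord0 i)%R) (`|M| + `|x|)%R) => //.
    move=> t; apply: (@continuous_comp _ _ _ (fun t : R => x + t *: delta_mx ord0 i)%R (partial i F)).
      by apply: cvgD; [exact: cvg_cst|apply: cvgZr_tmp; exact: cvg_id].
    by apply: smooth_cont; exact: smooth_partial.
  move=> t ht; apply: K0; apply: HM.
  have h : (`|t| <= `|t *: (delta_mx ord0 i : 'rV[R]_2)|)%R.
    by apply: le_trans (coord_le_norm _ i); rewrite !mxE !eqxx mulr1.
  have : (`|t *: (delta_mx ord0 i : 'rV[R]_2)| <= `|x + t *: delta_mx ord0 i| + `|x|)%R.
    by rewrite -{1}(addKr x (t *: _)) addrC; exact: ler_normB.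
  have := ler_norm M; lra.
pose P (y : 'rV[R]_1) := \int[@lebesgue_measure R]_t `|partial i0 F (rv_cons (t, y))|%:E.
pose Q (t : R) := \int[leb R 1]_y `|partial i1 F (rv_cons (t, y))|%:E.
have FP t y : `|F (rv_cons (t, y))|%:E <= P y.
  have := lbound i0 (rv_cons (0%R, y)) t; rewrite rv_cons_line add0r => h; apply: le_trans h _.
  rewrite le_eqVlt; apply/orP; left; apply/eqP; apply: eq_integral => s _.
  by rewrite rv_cons_line add0r.
have FQ t y : `|F (rv_cons (t, y))|%:E <= Q t.
  have yE : y = (const_mx 0 + y ord0 ord0 *: delta_mx ord0 ord0)%R.
    by apply/rowP => j; rewrite (ord1 j) !mxE !eqxx mulr1 add0r.
  have := lbound i1 (rv_cons (t, const_mx 0%R)) (y ord0 ord0); rewrite rv_cons_tail -yE => h; apply: le_trans h _.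
  have mt : measurable_fun setT (fun y => `|partial i1 F (rv_cons (t, y))|%:E).
    by apply: (@measurableT_comp _ _ _ _ _ _ ((fun x => `|partial i1 F x|%:E) \o @rv_cons R 1)); [exact: mcons|exact: measurable_pair1].
  have -> : Q t = _ := integral_leb1 mt (fun y => normr_ge0 _).
  rewrite le_eqVlt; apply/orP; left; apply/eqP; apply: eq_integral => s _.
  rewrite rv_cons_tail; congr (`|partial i1 F (rv_cons (t, _))|%:E).
  apply/rowP => j; rewrite (ord1 j); have := rv_cons0 s (const_mx 0%R : 'rV[R]_0) => ->.
  by rewrite !mxE !eqxx mulr1 add0r.
have mP : measurable_fun setT P.
  by have := @measurable_fun_fubini_tonelli_G _ _ _ _ _ (@lebesgue_measure R) _ (mcons _ (mp i0)); apply => p; rewrite lee_fin.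
have mQ : measurable_fun setT Q.
  by have := @measurable_fun_fubini_tonelli_F _ _ _ _ _ (leb R 1) _ (mcons _ (mp i1)); apply => p; rewrite lee_fin.
have P0 y : 0 <= P y by apply: integral_ge0.
have Q0 t : 0 <= Q t by apply: integral_ge0.
have mF2 : measurable_fun setT (fun x => (F x ^+ 2)%:E).
  by apply/measurable_EFinP; apply: measurable_funX; apply: continuousT_measurable_rv; exact: smooth_cont.
rewrite ge0_integral_leb_step//; last by move=> x; rewrite lee_fin sqr_ge0.
have -> : \int[leb R 2]_x `|partial i1 F x|%:E = \int[@lebesgue_measure R]_t Q t.
  by rewrite ge0_integral_leb_step.
have -> : \int[leb R 2]_x `|partial i0 F x|%:E = \int[leb R 1]_y P y.
  rewrite ge0_integral_leb_step//.
  have h := @fubini_tonelli _ _ _ _ _ (@lebesgue_measure R) (leb R 1) _ (mcons _ (mp i0)).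
  by apply: h => p; rewrite lee_fin.
have h := @iterated_integral_le_prod _ _ _ _ _ (@lebesgue_measure R) (leb R 1) _ Q P (mcons _ mF2) _ mQ mP Q0 P0.
apply: h => [p|t y]; first by rewrite lee_fin sqr_ge0.
rewrite /= -real_normK ?num_real// expr2 EFinM.
by apply: lee_pmul => //; rewrite lee_fin.
Qed.

End plane.

(** * The velocity spaces and the dual norm *)

Section euclidean_norm.
Context {R : realType}.

Lemma dotm_add m n (A B C : 'M[R]_(m, n)) : dotm (A + B) C = dotm A C + dotm B C.
Proof.
rewrite /dotm -big_split; apply: eq_bigr => i _; rewrite -big_split; apply: eq_bigr => j _.
by rewrite mxE mulrDl.
Qed.

Lemma dotmC m n (A B : 'M[R]_(m, n)) : dotm A B = dotm B A.
Proof. by apply: eq_bigr => i _; apply: eq_bigr => j _; rewrite mulrC. Qed.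

Lemma dotmZ m n c (A B : 'M[R]_(m, n)) : dotm (c *: A) B = c * dotm A B.
Proof.
rewrite /dotm mulr_sumr; apply: eq_bigr => i _; rewrite mulr_sumr; apply: eq_bigr => j _.
by rewrite mxE mulrA.
Qed.

Lemma dotm_le_enorm m n (A B : 'M[R]_(m, n)) : `|dotm A B| <= enorm A * enorm B.
Proof.
rewrite -sqrtr_sqr /enorm -sqrtrM ?dotm_ge0// ler_sqrt ?mulr_ge0 ?dotm_ge0//.
apply: quadratic_ge0 => [||t]; [exact: dotm_ge0|exact: dotm_ge0|].
have -> : dotm A A + 2 * t * dotm A B + t ^+ 2 * dotm B B = dotm (A + t *: B) (A + t *: B).
  by rewrite dotm_add dotmZ ![dotm _ (A + _)]dotmC !dotm_add !dotmZ [dotm B A]dotmC; ring.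
exact: dotm_ge0.
Qed.

Lemma enormD m n (A B : 'M[R]_(m, n)) : enorm (A + B) <= enorm A + enorm B.
Proof.
rewrite -(ler_pXn2r (n := 2)) ?nnegrE ?addr_ge0 ?enorm_ge0//.
rewrite sqrrD !enorm_sqr dotm_add ![dotm _ (A + _)]dotmC !dotm_add [dotm B A]dotmC.
have := le_trans (ler_norm _) (dotm_le_enorm A B); lra.
Qed.

Lemma enormN m n (A : 'M[R]_(m, n)) : enorm (- A) = enorm A.
Proof. by rewrite -scaleN1r /enorm dotmZ dotmC dotmZ mulrA mulrNN !mul1r. Qed.

Lemma enorm_dist m n (A B : 'M[R]_(m, n)) : `|enorm A - enorm B| <= enorm (A - B).
Proof.
rewrite ler_norml; have := enormD (A - B) B; have := enormD (B - A) A.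
by rewrite !subrK -[B - A]opprB enormN => h1 h2; apply/andP; split; lra.
Qed.

End euclidean_norm.

Section velocity_spaces.
Context {R : realType} {d : nat}.
Local Notation point := ('rV[R]_d).
Local Notation mu := (leb R d).
Implicit Types (phi : point -> R) (v w : point -> point).
Variable Omega : set point.
Hypothesis oO : open Omega.
Hypothesis cO : compact (closure Omega).
Let mO := domain_measurable oO.
Let fO := domain_fin oO cO.

Local Notation Int f := (mu.-integrable Omega (EFin \o f)).
Local Notation I f := (integ Omega f).
Local Notation sq f := (sqi mu Omega f).
Local Notation nq f := (nsq mu Omega f).
Local Notation cv f_ f := (cvg2 mu Omega f_ f).
Local Notation H1 f := (H1 Omega f).
Local Notation gradsq f := (gradsq Omega f).

Lemma semiX_ge0 v : (forall i, H1 (coordf v i)) -> 0 <= semiX Omega v.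
Proof.
move=> hv; have sJ k l : sq (fun x => wjac Omega v x k l).
  by under [X in sqi _ _ X]eq_fun do rewrite mxE; exact: H1_dsq.
by rewrite /semiX normL2E ?sqrtr_ge0//; have [] := sq_enorm oO sJ.
Qed.

Lemma semiX_sqr v : (forall i, H1 (coordf v i)) ->
  semiX Omega v ^+ 2 = \sum_i gradsq (coordf v i).
Proof.
move=> hv; have sJ k l : sq (fun x => wjac Omega v x k l).
  by under [X in sqi _ _ X]eq_fun do rewrite mxE; exact: H1_dsq.
have [s1 s2] := sq_enorm oO sJ.
rewrite /semiX normL2E// sqr_sqrtr ?nsq_ge0// s2; apply: eq_bigr => i _; apply: eq_bigr => j _.
by rewrite /nsq; under eq_Rintegral do rewrite mxE.
Qed.

Lemma sq_enorm_field v : (forall i, sq (coordf v i)) ->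
  sq (fun x => enorm (v x)) /\ nq (fun x => enorm (v x)) = \sum_i nq (coordf v i).
Proof.
move=> sv; have sk k l : sq (fun x => v x k l) by rewrite (ord1 k); exact: sv.
by have [h1 h2] := sq_enorm oO sk; split => //; rewrite h2 big_ord1.
Qed.

Lemma normX_ge0 v : 0 <= normX Omega v. Proof. exact: sqrtr_ge0. Qed.

(** A scalar function as a field with one component, to which the Sobolev
    constants for vector fields apply. *)
Definition single (i : 'I_d) f : point -> point := fun x => f x *: delta_mx ord0 i.

Lemma single_coord i f j : coordf (single i f) j = fun x => (i == j)%:R * f x.
Proof. by apply/funext => x; rewrite /coordf /single !mxE eqxx/= mulrC eq_sym. Qed.

Lemma enorm_single i f x : enorm (single i f x) = `|f x|.
Proof.
rewrite -sqrtr_sqr; apply: (congr1 Num.sqrt).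
rewrite /dotm big_ord1 (bigD1 i)//= big1 ?addr0 => [|j ji]; rewrite !mxE !eqxx/=.
  by rewrite mulr1 expr2.
by rewrite (negbTE ji) mulr0 mul0r.
Qed.

Lemma gradsqZ c f : H1 f -> gradsq (fun x => c * f x) = c ^+ 2 * gradsq f.
Proof.
move=> hf; rewrite !gradsqE mulr_sumr; apply: eq_bigr => i _.
rewrite -nsqZ; last exact: H1_dsq.
apply: nsq_ae => //; first exact: wderivZ.
- exact: (H1_dsq oO i (H1Z oO c hf)).1.
- by apply: measurable_funM => //; exact: (H1_dsq oO i hf).1.
- exact: mO.
Qed.

Lemma single_H1 i f j : H1 f -> H1 (coordf (single i f) j).
Proof. by move=> hf; rewrite single_coord; exact: H1Z. Qed.

Lemma single_X0 i f : in_H10 Omega f -> in_X0 Omega (single i f).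
Proof. by move=> hf j; rewrite single_coord; exact: H10Z. Qed.

Lemma semiX_single i f : H1 f -> semiX Omega (single i f) ^+ 2 = gradsq f.
Proof.
move=> hf; rewrite semiX_sqr => [|j]; last exact: single_H1.
rewrite (bigD1 i)//= big1 ?addr0 => [|j ji]; rewrite single_coord gradsqZ//.
  by rewrite eqxx expr1n mul1r.
by rewrite eq_sym (negbTE ji) expr0n mul0r.
Qed.

(** ** Sobolev constants for scalar functions *)

Variables (Sc Cc : R -> R).
Hypothesis SC : sobolev_constants Omega Sc Cc.

Lemma H10_Lp (i0 : 'I_d) p f : 1 <= p <= 6 -> in_H10 Omega f ->
  Int (fun x => `|f x| `^ p) /\
  I (fun x => `|f x| `^ p) <= (Cc p * Num.sqrt (gradsq f)) `^ p.
Proof.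
move=> p16 hf; have [_ C0 _ h] := SC p16; have h1 : H1 f by have [] := (H10P oO cO f).1 hf.
have := h _ (single_X0 i0 hf).
have -> : semiX Omega (single i0 f) = Num.sqrt (gradsq f).
  rewrite -(semiX_single i0 h1) sqrtr_sqr ger0_norm// semiX_ge0// => j; exact: single_H1.
rewrite (_ : (fun x => enorm (single i0 f x)) = (fun x => `|f x|)); last first.
  by apply/funext => x; exact: enorm_single.
have p0 : 0 < p by have /andP[] := p16; lra.
move=> /(normLp_le_int oO p0) [||h2 h3].
- by rewrite mulr_ge0 ?sqrtr_ge0// ltW.
- by apply: measurableT_comp => //; exact: (H1_sq oO h1).1.
split; first by apply: int_eq h2 => [|x _]; [exact: mO|rewrite normr_id].
by apply: le_trans h3; rewrite /integ; under [X in _ <= X]eq_Rintegral do rewrite normr_id.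
Qed.

Let p26 : 1 <= (2 : R) <= 6. Proof. by apply/andP; split; lra. Qed.

Lemma poincare f : (0 < d)%N -> in_H10 Omega f -> nq f <= Cc 2 ^+ 2 * gradsq f.
Proof.
move=> d0 hf.
have [_ C0 _ _] := SC p26.
have E : (Cc 2 * Num.sqrt (gradsq f)) `^ 2 = Cc 2 ^+ 2 * gradsq f.
  rewrite -[Cc 2 * _]ger0_norm; last by rewrite mulr_ge0 ?sqrtr_ge0// ltW.
  by rewrite pow2E exprMn sqr_sqrtr// gradsq_ge0.
have [_] := H10_Lp (Ordinal d0) p26 hf; rewrite E => h.
by apply: le_trans h; rewrite /nsq /integ; under [X in _ <= X]eq_Rintegral do rewrite pow2E.
Qed.

Lemma X0_H1 v : in_X0 Omega v -> forall i, H1 (coordf v i).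
Proof. by move=> hv i; have [] := (H10P oO cO _).1 (hv i). Qed.

Lemma poincareX v : (0 < d)%N -> in_X0 Omega v ->
  \sum_i nq (coordf v i) <= Cc 2 ^+ 2 * semiX Omega v ^+ 2.
Proof.
move=> d0 hv; rewrite semiX_sqr; last exact: X0_H1.
by rewrite mulr_sumr; apply: ler_sum => i _; exact: poincare.
Qed.

(** ** The dual norm *)

Lemma semiXZ c v : (forall i, H1 (coordf v i)) ->
  semiX Omega (fun x => c *: v x) = `|c| * semiX Omega v.
Proof.
move=> hv; have E i : coordf (fun x => c *: v x) i = fun x => c * coordf v i x.
  by apply/funext => x; rewrite /coordf mxE.
have hc i : H1 (coordf (fun x => c *: v x) i) by rewrite E; exact: H1Z.
apply/eqP; rewrite -(eqrXn2 (n := 2)) ?mulr_ge0 ?semiX_ge0// exprMn !semiX_sqr// real_normK ?num_real//.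
rewrite mulr_sumr; apply/eqP; apply: eq_bigr => i _; rewrite E; exact: gradsqZ.
Qed.

Lemma dotv_int f v : (forall i, sq (coordf f i)) -> (forall i, sq (coordf v i)) ->
  Int (fun x => dotv (f x) (v x)).
Proof.
move=> sf sv; under [X in Int X]eq_fun do rewrite dotv_sum.
by apply: int_sum => // i; exact: (sqiM mO (sf i) (sv i)).
Qed.

Lemma dotv_cauchy_schwarz f v : (forall i, sq (coordf f i)) -> (forall i, sq (coordf v i)) ->
  `|I (fun x => dotv (f x) (v x))| <=
  Num.sqrt (\sum_i nq (coordf f i)) * Num.sqrt (\sum_i nq (coordf v i)).
Proof.
move=> sf sv; have [f1 f2] := sq_enorm_field sf; have [v1 v2] := sq_enorm_field sv.
rewrite -f2 -v2; have := cauchy_schwarz mO f1 v1; apply: le_trans.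
have h : `|I (fun x => dotv (f x) (v x))| <= I (fun x => enorm (f x) * enorm (v x)).
  apply: I_abs_le => //; [exact: int_meas (dotv_int sf sv)|exact: sqiM|].
  by move=> x _; exact: dotm_le_enorm.
by apply: le_trans h _; exact: ler_norm.
Qed.

(** By Poincare's inequality the values are bounded, so that the supremum in
    the dual norm is a true one. *)
Lemma dual_norm_has_sup f : (0 < d)%N -> (forall i, sq (coordf f i)) ->
  has_sup [set I (fun x => dotv (f x) (v x)) | v in [set v | in_X0 Omega v /\ semiX Omega v <= 1]].
Proof.
move=> d0 sf; have z0 : in_X0 Omega (fun=> 0).
  move=> i; apply: H10_test => //; rewrite (_ : coordf _ _ = fun=> 0); first exact: test_fun0.
  by apply/funext => x; rewrite /coordf mxE.
split.
  exists (I (fun x => dotv (f x) 0)), (fun=> 0) => //; split => //.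
  have -> : semiX Omega (fun=> 0) = semiX Omega (fun x : point => 0 *: (0 : point)).
    by congr semiX; apply/funext => x; rewrite scaler0.
  by rewrite semiXZ ?normr0 ?mul0r//; exact: X0_H1.
have [_ C0 _ _] := SC p26.
exists (Num.sqrt (\sum_i nq (coordf f i)) * Cc 2) => _ [v [hv v1] <-].
apply: le_trans (ler_norm _) _; apply: le_trans (dotv_cauchy_schwarz sf _) _.
  by move=> i; apply: H1_sq => //; exact: X0_H1.
rewrite ler_wpM2l ?sqrtr_ge0// -[leRHS]ger0_norm ?(ltW C0)// -sqrtr_sqr ler_sqrt ?sqr_ge0//.
apply: le_trans (poincareX d0 hv) _; rewrite -[leRHS]mulr1 ler_wpM2l ?sqr_ge0//.
by rewrite expr_le1// semiX_ge0//; exact: X0_H1.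
Qed.

Lemma dual_norm_ge0 f : (0 < d)%N -> (forall i, sq (coordf f i)) -> 0 <= normX0' Omega f.
Proof.
move=> d0 sf; have [[_ [v [hv v1] _]] ub] := dual_norm_has_sup d0 sf.
have z0 : in_X0 Omega (fun x => 0 *: v x).
  move=> i; rewrite (_ : coordf _ _ = fun x => 0 * coordf v i x); first exact: H10Z.
  by apply/funext => x; rewrite /coordf mxE.
apply: ub_le_sup => //; exists (fun x => 0 *: v x).
  split; last by rewrite semiXZ ?normr0 ?mul0r ?ler01//; exact: X0_H1.
  exact: z0.
rewrite /integ; under eq_Rintegral => x _.
  rewrite (_ : dotv (f x) (0 *: v x) = 0); first over.
  by rewrite dotv_sum big1// => i _; rewrite !mxE mul0r mulr0.
by rewrite /Rintegral integral0.
Qed.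

(** By homogeneity; a field of seminorm 0 vanishes by Poincare's inequality. *)
Lemma dual_norm_le f v : (0 < d)%N -> (forall i, sq (coordf f i)) -> in_X0 Omega v ->
  I (fun x => dotv (f x) (v x)) <= normX0' Omega f * semiX Omega v.
Proof.
move=> d0 sf hv; have hv1 := X0_H1 hv; have s0 := semiX_ge0 hv1.
have sv i : sq (coordf v i) := H1_sq oO (hv1 i).
have [s00|sn0] := eqVneq (semiX Omega v) 0.
  rewrite s00 mulr0; apply: le_trans (ler_norm _) _; apply: le_trans (dotv_cauchy_schwarz sf sv) _.
  have := poincareX d0 hv; rewrite s00 expr0n mulr0 => h.
  have -> : \sum_i nq (coordf v i) = 0.
    by apply/eqP; rewrite eq_le h sumr_ge0// => i _; exact: nsq_ge0.
  by rewrite sqrtr0 mulr0.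
have sp : 0 < semiX Omega v by rewrite lt_neqAle eq_sym sn0.
set s := semiX Omega v in s0 sn0 sp *.
rewrite -ler_pdivrMr// mulrC /integ -RintegralZl//; last exact: dotv_int.
have [_ ub] := dual_norm_has_sup d0 sf.
apply: ub_le_sup => //; exists (fun x => s^-1 *: v x).
  split; last by rewrite semiXZ// ger0_norm ?invr_ge0// mulVf.
  move=> i; rewrite (_ : coordf _ _ = fun x => s^-1 * coordf v i x); first exact: H10Z.
  by apply/funext => x; rewrite /coordf mxE.
apply: eqI => // x _; rewrite !dotv_sum mulr_sumr; apply: eq_bigr => i _.
by rewrite mxE mulrCA.
Qed.

End velocity_spaces.

(** * Multiplication by the discrete porosity on H^1_0 *)

(** Let g > 1 and b > g^(r-2).  Then g^2 <= b^(k-1), which is where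
    r <= k (r - 2) enters; in each other case one of the first two terms on the
    right dominates, or b <= b^k. *)
Lemma young_weight (R : realType) (r : R) (k : nat) (g b : R) : 2 < r -> r <= k%:R * (r - 2) ->
  0 <= g -> 0 <= b -> g ^+ 2 * b <= g `^ r + 1 + b ^+ k.
Proof.
move=> r2 rk g0 b0; have gr0 := powR_ge0 g r; have bk0 : 0 <= b ^+ k by exact: exprn_ge0.
have r20 : 0 < r - 2 by lra.
have k1 : (1 < k)%N.
  have : 1 < k%:R :> R by rewrite -(ltr_pM2r r20) mul1r; lra.
  by rewrite ltr1n.
have [g1|g1] := leP g 1.
  apply: (@le_trans _ _ b); first by rewrite -[leRHS]mul1r ler_wpM2r// expr_le1.
  have [b1|b1] := leP b 1; first by lra.
  have : b <= b ^+ k by rewrite -[leLHS]expr1; apply: ler_weXn2l; [exact: ltW|exact: ltnW].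
  by lra.
have gp : 0 < g by lra.
have E : g `^ r = g ^+ 2 * g `^ (r - 2).
  rewrite -powR_mulrn// -powRD; last by apply/implyP => _; rewrite gt_eqF.
  by congr powR; ring.
have [bg|bg] := leP b (g `^ (r - 2)).
  have : g ^+ 2 * b <= g `^ r by rewrite E ler_wpM2l// exprn_ge0.
  by lra.
have h : g ^+ 2 <= b ^+ k.-1.
  apply: (@le_trans _ _ (g `^ (r - 2) ^+ k.-1)); last by rewrite lerXn2r ?nnegrE ?powR_ge0// ltW.
  rewrite -powR_mulrn// -[_ ^+ k.-1]powR_mulrn ?powR_ge0// -powRrM.
  apply: ler_powR; first exact: ltW.
  have E2 : k%:R = k.-1%:R + 1 :> R by rewrite natr1 prednK// ltnW.
  by move: rk; rewrite E2 mulrDl mul1r mulrC; lra.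
have : g ^+ 2 * b <= b ^+ k.
  have -> : b ^+ k = b ^+ k.-1 * b by rewrite -exprSr prednK// ltnW.
  by rewrite ler_wpM2r.
by lra.
Qed.

Lemma powRD_le (R : realType) (r a b : R) : 0 <= r -> 0 <= a -> 0 <= b ->
  (a + b) `^ r <= 2 `^ r * (a `^ r + b `^ r).
Proof.
move=> r0; wlog ab : a b / a <= b => [h a0 b0|a0 b0].
  by have [/h|/ltW/h] := leP a b; [exact|rewrite addrC [a `^ r + _]addrC; exact].
apply: (@le_trans _ _ ((2 * b) `^ r)).
  by apply: ge0_ler_powR => //; rewrite ?nnegrE; lra.
by rewrite powRM// ler_wpM2l ?powR_ge0// lerDr powR_ge0.
Qed.

Lemma lee_mul_real (R : realType) (a b c : \bar R) (x y z : R) :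
  a = x%:E -> b = y%:E -> c = z%:E -> (a <= b * c)%E -> x <= y * z.
Proof. by move=> -> -> ->; rewrite -EFinM lee_fin. Qed.

Section powers_of_test_functions.
Context {R : realType} {d : nat}.
Local Notation point := ('rV[R]_d).
Local Notation mu := (leb R d).
Implicit Types (phi : point -> R).

Lemma test_funX (Omega : set point) phi k : test_fun Omega phi ->
  test_fun Omega (fun x => phi x ^+ k.+1).
Proof.
move=> tp; elim: k => [|k ih]; first by under [X in test_fun _ X]eq_fun do rewrite expr1.
by under [X in test_fun _ X]eq_fun do rewrite exprS; apply: test_funM => //; case: ih.
Qed.

Lemma smoothX phi k : smooth phi -> smooth (fun x => phi x ^+ k).
Proof.
move=> sp; elim: k => [|m ih].
  by under [X in smooth X]eq_fun do rewrite expr0; exact: smooth_cst.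
by under [X in smooth X]eq_fun do rewrite exprS; exact: smoothM.
Qed.

Lemma partialX phi i k x : smooth phi ->
  partial i (fun x => phi x ^+ k.+1) x = k.+1%:R * (phi x ^+ k * partial i phi x).
Proof.
move=> sp; elim: k => [|k ih].
  by rewrite expr0 !mul1r; congr (partial i _ x); apply/funext => y; rewrite expr1.
have -> : (fun x => phi x ^+ k.+2) = fun x => phi x * phi x ^+ k.+1.
  by apply/funext => y; rewrite exprS.
by rewrite partialM; [rewrite ih -[k.+2%:R]natr1 exprS; ring|exact: sp|exact: smoothX].
Qed.

Lemma gradsq_smooth (Omega : set point) phi : open Omega -> compact (closure Omega) -> smooth phi ->
  gradsq Omega phi = \sum_i nsq mu Omega (partial i phi).
Proof.
move=> oO cO sp; apply: eq_bigr => i _; have hp := H1_smooth oO cO sp.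
apply: nsq_ae => //; first exact: wderiv_smooth.
- exact: (H1_dsq oO i hp).1.
- by apply: (sq_cont oO cO _).1; apply: smooth_cont; exact: smooth_partial.
Qed.

End powers_of_test_functions.

(** Gagliardo-Nirenberg for phi^(k+2), whose derivatives are (k+2) phi^(k+1)
    times those of phi, and Cauchy-Schwarz.  An L^(2k+2) bound yields an
    L^(2k+4) bound, so that iteration reaches every exponent in the plane. *)
Lemma plane_power_step (R : realType) (Omega : set 'rV[R]_2) (phi : 'rV[R]_2 -> R) k :
  open Omega -> compact (closure Omega) -> test_fun Omega phi ->
  nsq (leb R 2) Omega (fun x => phi x ^+ k.+2) <=
  k.+2%:R ^+ 2 * (nsq (leb R 2) Omega (fun x => phi x ^+ k.+1) * gradsq Omega phi).
Proof.
move=> oO cO tp; have mO := domain_measurable oO; have [sp _] := tp.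
set a := nsq _ _ (fun x => phi x ^+ k.+1).
have tT (f : 'rV[R]_2 -> R) : test_fun Omega f -> test_fun setT f.
  by move=> [sf [K [cK KO K0]]]; split => //; exists K.
have supp (f : 'rV[R]_2 -> R) : test_fun Omega f -> forall x, ~ Omega x -> f x = 0.
  by move=> [_ [K [_ KO K0]]] x nO; apply: K0 => /KO.
have sq_test (f : 'rV[R]_2 -> R) : test_fun Omega f -> sqi (leb R 2) Omega f.
  by move=> [sf _]; apply: sq_cont => //; exact: smooth_cont.
have tF := test_funX k.+1 tp; set F := fun x => phi x ^+ k.+2 in tF *.
have GN := gagliardo_nirenberg_plane (tT _ tF).
have RI (f : 'rV[R]_2 -> R) : (leb R 2).-integrable setT (EFin \o f) ->
    (\int[leb R 2]_x (f x)%:E = (\int[leb R 2]_x f x)%:E)%E.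
  by move=> If; rewrite /Rintegral fineK//; exact: integrable_fin_num If.
have IF2 : (leb R 2).-integrable setT (EFin \o (fun x => F x ^+ 2)).
  apply: test_fun_int; apply: tT.
  have -> : (fun x => F x ^+ 2) = fun x => F x * F x by apply/funext => x; rewrite expr2.
  by apply: test_funM (tF) _; case: tF.
have Iab i : (leb R 2).-integrable setT (EFin \o (fun x => `|partial i F x|)).
  by apply: int_abs; apply: test_fun_int; apply: tT; exact: test_fun_partial.
have {}GN : nsq (leb R 2) Omega F <=
    integ Omega (fun x => `|partial ord0 F x|) * integ Omega (fun x => `|partial (lift ord0 ord0) F x|).
  have S0 i : integ Omega (fun x => `|partial i F x|) = \int[leb R 2]_x `|partial i F x|.
    by apply: integ_supp => x nO; rewrite (supp _ (test_fun_partial _ tF))// normr0.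
  have -> : nsq (leb R 2) Omega F = \int[leb R 2]_x (F x ^+ 2).
    by apply: integ_supp => x nO; rewrite (supp _ tF)// expr0n.
  rewrite (S0 ord0) (S0 (lift ord0 ord0)).
  exact: lee_mul_real (RI _ IF2) (RI _ (Iab _)) (RI _ (Iab _)) GN.
have bound i : integ Omega (fun x => `|partial i F x|) <= k.+2%:R * (Num.sqrt a * Num.sqrt (gradsq Omega phi)).
  have s1 : sqi (leb R 2) Omega (fun x => `|phi x ^+ k.+1|).
    have h := sq_test _ (test_funX k tp).
    by apply: (sqi_dom _ _ h) => //; [exact: measurableT_comp h.1|move=> x _; rewrite normr_id].
  have s2 : sqi (leb R 2) Omega (fun x => `|partial i phi x|).
    have h := sq_test _ (test_fun_partial i tp).
    by apply: (sqi_dom _ _ h) => //; [exact: measurableT_comp h.1|move=> x _; rewrite normr_id].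
  have E x : `|partial i F x| = k.+2%:R * (`|phi x ^+ k.+1| * `|partial i phi x|).
    by rewrite /F partialX// !normrM ger0_norm.
  rewrite /integ; under eq_Rintegral do rewrite E.
  rewrite RintegralZl//; last exact: sqiM.
  rewrite ler_wpM2l//; apply: le_trans (ler_norm _) _.
  apply: le_trans (cauchy_schwarz mO s1 s2) _.
  have -> : nsq (leb R 2) Omega (fun x => `|phi x ^+ k.+1|) = a.
    by apply: eqI => // x _; rewrite real_normK ?num_real.
  rewrite ler_wpM2l ?sqrtr_ge0// ler_sqrt ?gradsq_ge0//.
  rewrite gradsq_smooth// (bigD1 i)//= (_ : nsq _ _ (fun x => `|_|) = nsq (leb R 2) Omega (partial i phi)).
    by rewrite lerDl; apply: sumr_ge0 => j _; exact: nsq_ge0.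
  by apply: eqI => // x _; rewrite real_normK ?num_real.
apply: le_trans GN _; apply: le_trans (ler_pM _ _ (bound _) (bound _)) _.
- by apply: Rintegral_ge0 => x _.
- by apply: Rintegral_ge0 => x _.
have h1 : Num.sqrt a ^+ 2 = a by rewrite sqr_sqrtr ?nsq_ge0.
have h2 := sqr_sqrtr (gradsq_ge0 Omega phi).
by rewrite -[X in _ <= _ * (X * _)]h1 -[X in _ <= _ * (_ * X)]h2 -!exprMn -expr2.
Qed.

(** The exponent k is the one that Young's inequality needs against a weight in
    L^(r/2): it is 3 in space, where H^1_0 embeds in L^6, and as large as r
    requires in the plane. *)
Lemma test_power_bound (R : realType) (d : nat) (Omega : set 'rV[R]_d) (Sc Cc : R -> R) (r : R) :
  d = 2%N \/ d = 3%N -> open Omega -> compact (closure Omega) ->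
  sobolev_constants Omega Sc Cc -> d%:R < r ->
  exists k A, [/\ 0 <= A, r <= k%:R * (r - 2) &
    forall phi, test_fun Omega phi -> nsq (leb R d) Omega (fun x => phi x ^+ k) <= A * gradsq Omega phi ^+ k].
Proof.
case=> d23; subst d => oO cO SC dr; have mO := domain_measurable oO.
- have r2 : 0 < r - 2 by move: dr; lra.
  have [k hk] : exists k : nat, r / (r - 2) <= k.+1%:R.
    exists (Num.truncn (r / (r - 2))); apply: ltW; exact: truncnS_gt.
  pose A := fix A (k : nat) : R := if k is l.+1 then k.+1%:R ^+ 2 * A l else Cc 2 ^+ 2.
  have A0 l : 0 <= A l.
    by elim: l => [|l ih]; [exact: sqr_ge0|exact: mulr_ge0 (sqr_ge0 _) ih].
  exists k.+1, (A k); split => //; first by rewrite -ler_pdivrMr.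
  move=> phi tp; elim: k {hk} => [|l ih].
    have := poincare oO cO SC isT (H10_test oO cO tp); rewrite expr1; apply: le_trans.
    by rewrite le_eqVlt; apply/orP; left; apply/eqP; apply: eqI => // x _; rewrite expr1.
  apply: le_trans (plane_power_step l oO cO tp) _.
  have -> : A l.+1 = l.+2%:R ^+ 2 * A l by [].
  rewrite -[leRHS]mulrA ler_wpM2l ?sqr_ge0// [gradsq _ _ ^+ _]exprSr mulrA.
  by rewrite ler_wpM2r ?gradsq_ge0.
- exists 3, (Cc 6 ^+ 6); split; [|by move: dr; lra|].
    by rewrite -[6%N]/(2 * 3)%N exprM exprn_ge0// sqr_ge0.
  move=> phi tp; have p16 : 1 <= (6 : R) <= 6 by apply/andP; split; lra.
  have [_ C0 _ _] := SC _ p16.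
  have [_] := H10_Lp oO cO SC ord0 p16 (H10_test oO cO tp).
  rewrite powR_mulrn; last by rewrite mulr_ge0 ?sqrtr_ge0// ltW.
  rewrite exprMn -[in Num.sqrt _ ^+ 6](_ : (2 * 3)%N = 6%N)// [Num.sqrt _ ^+ _]exprM sqr_sqrtr ?gradsq_ge0//.
  apply: le_trans; rewrite le_eqVlt; apply/orP; left; apply/eqP; apply: eqI => // x _.
  by rewrite powR_mulrn// -normrX ger0_norm -?exprM// -[6%N]/(3 * 2)%N exprM sqr_ge0.
Qed.

(** ** Uniform bounds on the discrete porosity *)

Lemma sum_sqr_le (R : realDomainType) (J : Type) (s : seq J) (F : J -> R) :
  (forall j, 0 <= F j) -> \sum_(j <- s) F j ^+ 2 <= (\sum_(j <- s) F j) ^+ 2.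
Proof.
move=> F0; elim: s => [|j s ih]; first by rewrite !big_nil expr0n.
rewrite !big_cons sqrrD; have h : 0 <= F j * \sum_(k <- s) F k by rewrite mulr_ge0 ?sumr_ge0.
by move: ih h; rewrite mulr2n; lra.
Qed.

Lemma enorm_le_sum (R : realType) m n (A : 'M[R]_(m, n)) :
  enorm A <= \sum_p `|A p.1 p.2|.
Proof.
rewrite -(ler_pXn2r (n := 2)) ?nnegrE ?enorm_ge0 ?sumr_ge0//.
rewrite enorm_sqr /dotm pair_bigA/=; apply: le_trans (sum_sqr_le _ _) => //.
by apply: ler_sum => p _; rewrite real_normK ?num_real// expr2.
Qed.

Section discrete_porosity_bounds.
Context {R : realType} {d : nat}.
Local Notation point := ('rV[R]_d).
Local Notation mu := (leb R d).
Implicit Types (phi f g : point -> R) (v w : point -> point).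
Variable Omega : set point.
Hypothesis oO : open Omega.
Hypothesis cO : compact (closure Omega).
Let mO := domain_measurable oO.
Let fO := domain_fin oO cO.

Local Notation Int f := (mu.-integrable Omega (EFin \o f)).
Local Notation I f := (integ Omega f).
Local Notation sq f := (sqi mu Omega f).
Local Notation nq f := (nsq mu Omega f).
Local Notation cv f_ f := (cvg2 mu Omega f_ f).
Local Notation H1 f := (H1 Omega f).
Local Notation gradsq f := (gradsq Omega f).

Lemma integZ c f : Int f -> I (fun x => c * f x) = c * I f.
Proof. by move=> If; rewrite /integ RintegralZl. Qed.

Lemma integD f g : Int f -> Int g -> I (fun x => f x + g x) = I f + I g.
Proof. by move=> If Ig; rewrite /integ RintegralD. Qed.

Lemma integB f g : Int f -> Int g -> I (fun x => f x - g x) = I f - I g.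
Proof. by move=> If Ig; rewrite /integ RintegralB. Qed.

Lemma measurable_enorm m n (A : point -> 'M[R]_(m, n)) :
  (forall k l, measurable_fun Omega (fun x => A x k l)) ->
  measurable_fun Omega (fun x => enorm (A x)).
Proof.
move=> mA; apply: (@measurableT_comp _ _ _ _ _ _ (@Num.sqrt R)).
  by apply: continuous_measurable_fun; exact: sqrt_continuous.
apply: measurable_sum => k; apply: measurable_sum => l; exact: measurable_funM.
Qed.

Lemma Lr_sum (r : R) (J : Type) (s : seq J) (F : J -> point -> R) : 0 <= r ->
  (forall j, measurable_fun Omega (F j)) -> (forall j, Int (fun x => `|F j x| `^ r)) ->
  Int (fun x => (\sum_(j <- s) `|F j x|) `^ r).
Proof.
move=> r0 mF IF; elim: s => [|j s ih].
  by apply: int_eq (int_cst mO fO (0 `^ r)) => // x _; rewrite big_nil.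
have ms : measurable_fun Omega (fun x => \sum_(k <- s) `|F k x|).
  by apply: measurable_sum => k; exact: measurableT_comp.
apply: (int_dom mO (g := fun x => 2 `^ r * (`|F j x| `^ r + (\sum_(k <- s) `|F k x|) `^ r))).
- apply: (@measurableT_comp _ _ _ _ _ _ (fun t : R => t `^ r)); first exact: measurable_powR.
  under eq_fun do rewrite big_cons.
  by apply: measurable_funD => //; exact: measurableT_comp.
- by apply: intZ => //; apply: intD.
- move=> x _; rewrite ger0_norm ?powR_ge0// big_cons; apply: powRD_le => //.
  exact: sumr_ge0.
Qed.

Lemma Lr_enorm (r : R) m n (A : point -> 'M[R]_(m, n)) : 0 <= r ->
  (forall k l, measurable_fun Omega (fun x => A x k l)) ->
  (forall k l, Int (fun x => `|A x k l| `^ r)) -> Int (fun x => `|enorm (A x)| `^ r).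
Proof.
move=> r0 mA IA.
have IS := @Lr_sum r _ (index_enum ('I_m * 'I_n)%type) (fun p x => A x p.1 p.2) r0 (fun p => mA p.1 p.2) (fun p => IA p.1 p.2).
apply: (int_dom mO _ IS).
  apply: (@measurableT_comp _ _ _ _ _ _ (fun t : R => t `^ r)); first exact: measurable_powR.
  by apply: measurableT_comp => //; exact: measurable_enorm.
move=> x _; rewrite ger0_norm ?powR_ge0//; apply: ge0_ler_powR => //.
- by rewrite nnegrE sumr_ge0.
- by rewrite ger0_norm ?enorm_ge0// enorm_le_sum.
Qed.

(** The error bounds on the porosity carry the mesh size; elements lie in a
    bounded set, so that a constant replaces it. *)
Lemma mesh_bound : exists2 D : R, 0 <= D & forall T : seq (simplex R d),
  (forall K, K \in T -> hull K `<=` closure Omega) -> mesh T <= D.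
Proof.
have [M HM] : exists M, forall x, closure Omega x -> `|x| <= M.
  have /compact_bounded[M [_ HM]] := cO.
  by exists (M + 1) => x; apply: HM; rewrite ltrDl.
exists (\sum_(p : 'I_1 * 'I_d) (2 * `|M|)); first by apply: sumr_ge0 => p _; rewrite mulr_ge0.
move=> T TO; rewrite /mesh big_seq; apply: bigmax_le; first by apply: sumr_ge0 => p _; rewrite mulr_ge0.
move=> K KT; have [->|/set0P h0] := eqVneq (hull K) set0.
  rewrite /diam (_ : [set _ | _ in _] = set0) ?sup0; first by apply: sumr_ge0 => p _; rewrite mulr_ge0.
  by rewrite set0X image_set0.
apply: ge_sup; first by have [x hx] := h0; exists (enorm (x - x)), (x, x).
move=> _ [[x y]/= [hx hy] <-]; apply: le_trans (enorm_le_sum _) _; apply: ler_sum => p _.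
have h z : hull K z -> `|z ord0 p.2| <= `|M|.
  move=> hz; apply: le_trans (coord_le_norm _ _) _; apply: le_trans (HM _ (TO _ KT _ hz)) _; exact: ler_norm.
rewrite !mxE (ord1 p.1); apply: le_trans (ler_normB _ _) _.
by have := h x hx; have := h y hy; lra.
Qed.

Variables (eps0 r Ceps : R) (eps : point -> R).
Hypotheses (r2 : 2 < r) (eps00 : 0 < eps0) (C0 : 0 < Ceps).
Hypothesis W2 : in_W2p Omega r%:E eps.

Definition admissible T eh := conforming_triangulation Omega T /\
  discrete_porosity Omega eps0 r Ceps eps T eh.

Lemma admissible_bound T eh : admissible T eh -> forall x, closure Omega x -> `|eh x| <= 1.
Proof.
move=> [_ [_ h _ _]] x /h /andP[h1 h2]; rewrite ger0_norm//.
exact: le_trans (ltW eps00) h1.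
Qed.

Lemma admissible_hull T eh K : admissible T eh -> K \in T -> hull K `<=` closure Omega.
Proof. by move=> [[_ -> _] _] KT x hx; exists K. Qed.

Let r0 : 0 < r. Proof. exact: lt_trans r2. Qed.

Lemma W1r_grad f : in_W1p Omega r%:E f -> forall j, measurable_fun Omega (wderiv Omega j f) /\
  Int (fun x => `|wderiv Omega j f x| `^ r).
Proof.
move=> [_ h] j; have [_ [m l]] := h j; split => //.
exact: normLp_lty_int r0 m l.
Qed.

Lemma W2r_norm_fin : exists2 W, 0 <= W & normW2p Omega r%:E eps = W%:E.
Proof.
have [W1 HW] := W2; have [[me le] _] := W1.
have lG : Int (fun x => `|enorm (wgrad Omega eps x)| `^ r).
  apply: Lr_enorm => [|k l|k l]; first exact: ltW.
    by under eq_fun do rewrite mxE; have [] := W1r_grad W1 l.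
  by have [_] := W1r_grad W1 l; apply: int_eq => // x _; rewrite mxE.
have lH : Int (fun x => `|enorm (whess Omega eps x)| `^ r).
  apply: Lr_enorm => [|k l|k l]; first exact: ltW.
    by under eq_fun do rewrite mxE; have [] := W1r_grad (HW l) k.
  by have [_] := W1r_grad (HW l) k; apply: int_eq => // x _; rewrite mxE.
have le' := normLp_lty_int r0 me le.
rewrite /normW2p /normW1p (int_normLp oO r0 le') (int_normLp oO r0 lG) (int_normLp oO r0 lH).
by rewrite -!EFinD; eexists; last by []; rewrite !addr_ge0 ?powR_ge0.
Qed.

(** The gradient of eps plus the error, which the W^(2,r) norm of eps and the
    mesh size control in L^r. *)
Lemma kgrad_Lr : exists2 B, 0 <= B & forall T eh, admissible T eh -> forall i,
  measurable_fun Omega (kgrad (skeleton T) i eh) /\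
  (Int (fun x => `|kgrad (skeleton T) i eh x| `^ r) /\
  I (fun x => `|kgrad (skeleton T) i eh x| `^ r) <= B).
Proof.
have [W W0 EW] := W2r_norm_fin; have [D D0 HD] := mesh_bound.
have [W1 _] := W2.
pose A i := I (fun x => `|wderiv Omega i eps x| `^ r).
have A0 i : 0 <= A i by apply: Rintegral_ge0 => x _; exact: powR_ge0.
pose E := (Ceps * D * W) `^ r.
exists (2 `^ r * (\sum_i A i + E)); first by rewrite mulr_ge0 ?powR_ge0// addr_ge0 ?powR_ge0// sumr_ge0.
move=> T eh ad i; have [[nT OT _] [Meh _ _ hd]] := ad.
have ehM := admissible_bound ad.
have mk j : measurable_fun Omega (kgrad (skeleton T) j eh) by exact: measurable_kgrad_pl OT Meh j.
have wd j := pl_wderiv oO nT OT Meh ehM j cO.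
have mw j : measurable_fun Omega (wderiv Omega j eh) by have [_ []] := wderivP (wd j).
have me j : measurable_fun Omega (wderiv Omega j eps) by have [] := W1r_grad W1 j.
pose G x := enorm (wgrad Omega eps x - wgrad Omega eh x).
have mG : measurable_fun Omega G.
  apply: measurable_enorm => k l.
  by under eq_fun do rewrite !mxE; exact: measurable_funB.
have [||IG HG] := @normLp_le_int _ _ _ oO r G (Ceps * D * W) r0 _ mG.
- by rewrite !mulr_ge0// ltW.
- apply: le_trans hd _; rewrite EW -EFinM lee_fin ler_wpM2r// ler_wpM2l ?(ltW C0)//.
  by apply: HD => K; exact: admissible_hull ad.
have [_ Ie] := W1r_grad W1 i.
have IB := intZ mO (2 `^ r) (intD mO Ie IG).
have ptw x : `|wderiv Omega i eh x| `^ r <= 2 `^ r * (`|wderiv Omega i eps x| `^ r + `|G x| `^ r).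
  apply: le_trans (powRD_le (ltW r0) (normr_ge0 _) (normr_ge0 _)).
  apply: ge0_ler_powR; rewrite ?nnegrE ?addr_ge0//; first exact: ltW.
  have h := coord_le_enorm (wgrad Omega eps x - wgrad Omega eh x) i; rewrite !mxE in h.
  have -> : wderiv Omega i eh x = wderiv Omega i eps x - (wderiv Omega i eps x - wderiv Omega i eh x) by ring.
  apply: le_trans (ler_normB _ _) _; rewrite lerD2l; apply: le_trans h _; exact: ler_norm.
have mwr : measurable_fun Omega (fun x => `|wderiv Omega i eh x| `^ r) by exact: measurable_pow.
have Iw : Int (fun x => `|wderiv Omega i eh x| `^ r).
  by apply: int_dom IB _ => // x _; rewrite ger0_norm ?powR_ge0.
have ae := wderivE oO (wd i).
split => //; split.
  apply: int_ae Iw => //; last exact: measurable_pow.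
  by apply: filterS ae => x h Ox; rewrite h.
have -> : I (fun x => `|kgrad (skeleton T) i eh x| `^ r) = I (fun x => `|wderiv Omega i eh x| `^ r).
  apply: I_ae => //; last exact: measurable_pow.
  by apply: filterS ae => x h Ox; rewrite h.
apply: (@le_trans _ _ (I (fun x => 2 `^ r * (`|wderiv Omega i eps x| `^ r + `|G x| `^ r)))).
  by apply: (I_le mO Iw IB) => x _; exact: ptw.
rewrite (integZ (2 `^ r) (intD mO Ie IG)) ler_wpM2l ?powR_ge0//.
rewrite (integD Ie IG); apply: lerD; last exact: HG.
by rewrite (bigD1 i)//= lerDl; exact: sumr_ge0.
Qed.

End discrete_porosity_bounds.

(** ** The load *)

Section discrete_load.
Context {R : realType} {d : nat}.
Local Notation point := ('rV[R]_d).
Local Notation mu := (leb R d).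
Implicit Types (phi f g : point -> R) (v w : point -> point).
Variable Omega : set point.
Hypothesis oO : open Omega.
Hypothesis cO : compact (closure Omega).
Let mO := domain_measurable oO.
Let fO := domain_fin oO cO.

Local Notation Int f := (mu.-integrable Omega (EFin \o f)).
Local Notation I f := (integ Omega f).
Local Notation sq f := (sqi mu Omega f).
Local Notation nq f := (nsq mu Omega f).
Local Notation cv f_ f := (cvg2 mu Omega f_ f).
Local Notation H1 f := (H1 Omega f).
Local Notation gradsq f := (gradsq Omega f).

Lemma cvg2_ae (f_ : nat -> point -> R) f g : {ae mu, forall x, Omega x -> f x = g x} ->
  measurable_fun Omega g -> cv f_ f -> cv f_ g.
Proof.
move=> fg mg [sf_ sf cf]; have sg := sqi_ae mO fg mg sf; split => //.
rewrite (_ : (fun n => _) = (fun n => nq (fun x => f_ n x - f x)))//; apply/funext => n.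
apply: nsq_ae => //; [|exact: measurable_funB (sf_ n).1 mg|exact: measurable_funB (sf_ n).1 sf.1].
by apply: filterS fg => x h Ox; rewrite h.
Qed.

Lemma cvg_sumR (J : finType) (a : J -> nat -> R) (l : J -> R) :
  (forall k, a k @ \oo --> l k) -> (\sum_k a k n) @[n --> \oo] --> \sum_k l k.
Proof.
move=> al; elim: (index_enum J) => [|j s ih].
  by rewrite big_nil; under eq_cvg do rewrite big_nil; exact: cvg_cst.
by rewrite big_cons; under eq_cvg do rewrite big_cons; exact: cvgD (al j) ih.
Qed.

Lemma kinky_H10 N F : kinky Omega N F ->
  in_H10 Omega F /\ forall i, is_wderiv Omega i F (kgrad N i F).
Proof.
move=> kF; have [cF [K [cK KO K0]] FL [cN N0] H] := kF.
have [Psi [tPsi cP dP]] := kinky_approx oO cO kF.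
have F0 x : ~ Omega x -> F x = 0 by move=> nO; apply: K0 => /KO.
have wF i : is_wderiv Omega i F (kgrad N i F).
  have [L L0 HL] := FL i.
  split.
  - apply: l1loc_bd => //; split; first by apply: measurable_funS (continuousT_measurable_rv cF).
    by move=> K' cK' _; have [M _ HM] := compact_bounded_fun cK' cF; exists M.
  - apply: l1loc_bd => //; split; first by apply: measurable_funS (measurable_kgrad i kF).
    move=> K' cK' _; exists L => x _; apply: kgrad_bound => // Nx.
    by have [/nbhs_singleton] := H x Nx i.
  move=> phi tp; have tT : test_fun setT phi.
    by have [sp [K' [cK' _ K0']]] := tp; split => //; exists K'.
  have p0 x : ~ Omega x -> phi x = 0.
    by move=> nO; have [_ [K' [_ KO' K0']]] := tp; apply: K0' => /KO'.
  rewrite [LHS]integ_supp => [|x nO]; last by rewrite F0// mul0r.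
  rewrite [X in - X]integ_supp => [|x nO]; last by rewrite p0// mulr0.
  exact: kinky_ibp kF tT.
split => //; apply/H10P => //; split.
  by apply/H1P => //; split => [|i]; [case: cP|exists (kgrad N i F); split => //; case: (dP i)].
exists Psi; split => //; split => //; first by move=> n; case: (tPsi n).
move=> i; apply: cvg2_ae (dP i); last by have [_ []] := wderivP (wF i).
by apply: filterS (wderivE oO (wF i)) => x h Ox; rewrite h.
Qed.

Variables (Sc Cc : R -> R) (eps0 r Ceps : R) (eps : point -> R).
Hypotheses (d23 : d = 2%N \/ d = 3%N) (SC : sobolev_constants Omega Sc Cc).
Hypotheses (dr : d%:R < r) (eps00 : 0 < eps0) (C0 : 0 < Ceps).
Hypothesis W2 : in_W2p Omega r%:E eps.
Local Notation adm := (admissible Omega eps0 r Ceps eps).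

Let d0 : (0 < d)%N. Proof. by case: d23 => ->. Qed.
Let r2 : 2 < r.
Proof. by apply: le_lt_trans dr; rewrite ler_nat; case: d23 => ->. Qed.

(** Young's inequality splits the integral into the L^r bound on the gradient of
    the porosity, uniform in the mesh, the measure of Omega, and a power of phi
    that the Dirichlet integral controls. *)
Lemma kgrad_weight : exists2 K : R, 0 <= K & forall T eh, adm T eh -> forall i phi,
  test_fun Omega phi ->
  sq (fun x => kgrad (skeleton T) i eh x * phi x) /\
  nq (fun x => kgrad (skeleton T) i eh x * phi x) <= K * gradsq phi.
Proof.
have [k [A [A0 rk HA]]] := test_power_bound d23 oO cO SC dr.
have [B B0 HB] := kgrad_Lr oO cO r2 eps00 C0 W2.
have m0 : 0 <= I (fun=> 1) by apply: Rintegral_ge0 => x _.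
exists (B + I (fun=> 1) + A); first by rewrite !addr_ge0.
move=> T eh ad i phi tp; have [[nT OT _] [Meh _ _ _]] := ad.
have ehM := admissible_bound eps00 ad.
have [L L0 HL] := kgrad_pl_bound OT Meh.
have [mk [Ik IkB]] := HB _ _ ad i.
have sphi : sq phi by apply: sq_cont => //; apply: smooth_cont; case: tp.
set kg := kgrad (skeleton T) i eh in mk Ik IkB *.
have skp : sq (fun x => kg x * phi x) by apply: (sqi_bdM mO mk _ sphi) => x Ox; exact: HL.
split => //; set G := gradsq phi.
have G0 : 0 <= G := gradsq_ge0 _ _.
(* A function of zero Dirichlet integral vanishes; any bound on the weight does,
   and the one at hand may depend on the mesh. *)
have [G00|Gn0] := eqVneq G 0.
  rewrite G00 mulr0; have P0 : nq phi <= 0.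
    by have := poincare oO cO SC d0 (H10_test oO cO tp); rewrite -/G G00 mulr0.
  apply: (@le_trans _ _ (nq (fun x => L * phi x))); last first.
    by rewrite (nsqZ mO L sphi) mulr_ge0_le0// sqr_ge0.
  apply: (I_le mO skp.2 (sqiZ mO L sphi).2) => x Ox.
  rewrite -[leLHS]real_normK ?num_real// -[leRHS]real_normK ?num_real//.
  have h : `|kg x * phi x| <= `|L * phi x|.
    by rewrite normrM [leRHS]normrM (ger0_norm L0); apply: ler_wpM2r => //; exact: HL.
  by rewrite lerXn2r ?nnegrE.
have Gp : 0 < G by rewrite lt_neqAle eq_sym Gn0.
have spk : sq (fun x => phi x ^+ k).
  by apply: sq_cont => //; apply: smooth_cont; apply: smoothX; case: tp.
have I1 : Int (fun=> 1) := int_cst mO fO 1.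
have I2 := intZ mO (G ^+ k)^-1 spk.2.
have I3 := intD mO (intD mO Ik I1) I2.
have I4 := intZ mO G I3.
apply: (@le_trans _ _ (I (fun x => G * (`|kg x| `^ r + 1 + (G ^+ k)^-1 * (phi x ^+ k) ^+ 2)))).
  apply: (I_le mO skp.2 I4) => x _.
  (* Dividing phi^2 by G makes the bound on the power of phi a constant. *)
  have := @young_weight _ r k `|kg x| (phi x ^+ 2 / G) r2 rk (normr_ge0 _) (divr_ge0 (sqr_ge0 _) G0).
  rewrite -(ler_pM2l Gp); congr (_ <= _).
    by rewrite real_normK ?num_real// [RHS]exprMn mulrCA [G * _]mulrC divfK.
  by congr (_ * (_ + _)); rewrite exprMn exprVn mulrC -!exprM mulnC.
rewrite (integZ oO G I3) (integD oO (intD mO Ik I1) I2) (integD oO Ik I1).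
rewrite (integZ oO _ spk.2) mulrC ler_wpM2r// !lerD//.
rewrite ler_pdivrMl ?exprn_gt0// mulrC; exact: HA.
Qed.

(** Product rule; the gradient of eh acts on phi as a weight. *)
Lemma mult_test : exists2 K : R, 0 <= K & forall T eh, adm T eh -> forall phi, test_fun Omega phi ->
  in_H10 Omega (fun x => eh x * phi x) /\ gradsq (fun x => eh x * phi x) <= K * gradsq phi.
Proof.
have [K K0 HK] := kgrad_weight; exists (\sum_(i < d) (2 * (K + 1))).
  by apply: sumr_ge0 => i _; rewrite mulr_ge0 ?addr_ge0.
move=> T eh ad phi tp; have [[nT OT _] [Meh _ _ _]] := ad; have [sp _] := tp.
have ehM := admissible_bound eps00 ad.
have kF := kinky_pl oO nT OT Meh ehM tp; have [hF wF] := kinky_H10 kF; split => //.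
rewrite mulr_suml; apply: ler_sum => i _; have [s1 n1] := HK _ _ ad i _ tp.
have s0 : sq (partial i phi) by apply: sq_cont => //; apply: smooth_cont; exact: smooth_partial.
have meh := pl_measurable oO Meh.
have ehO x : Omega x -> `|eh x| <= 1 by move=> Ox; apply: ehM; exact: subset_closure.
have s2 : sq (fun x => eh x * partial i phi x) by exact: (sqi_bdM mO meh ehO s0).
have h1 : H1 (fun x => eh x * phi x) by have [] := (H10P oO cO _).1 hF.
have -> : nq (wderiv Omega i (fun x => eh x * phi x)) =
  nq (fun x => kgrad (skeleton T) i eh x * phi x + eh x * partial i phi x).
  apply: nsq_ae => //; [|exact: (H1_dsq oO i h1).1|exact: (sqiD mO s1 s2).1].
  apply: filterS2 (wderivE oO (wF i)) (ae_skeleton nT) => x h Nx Ox.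
  by rewrite h// (kgrad_plM OT Meh).
apply: le_trans (nsqD_le mO s1 s2) _; rewrite -mulrA ler_wpM2l// mulrDl mul1r; apply: lerD => //.
apply: (@le_trans _ _ (nq (partial i phi))).
  apply: (I_le mO s2.2 s0.2) => x Ox; rewrite exprMn -[leRHS]mul1r ler_wpM2r ?sqr_ge0//.
  by rewrite -real_normK ?num_real// expr_le1// ehO.
rewrite gradsq_smooth// (bigD1 i)//= lerDl; apply: sumr_ge0 => j _; exact: nsq_ge0.
Qed.

(** Take test functions phi_n tending to v in H^1.  The fields eh phi_n are in
    X_0 with seminorm bounded by that of phi_n, so that the dual norm of f bounds
    (f, eh phi_n); both sides pass to the limit. *)
Lemma form_l_bound : exists2 K : R, 0 <= K & forall T eh, adm T eh ->
  forall (f v : point -> point), in_L2v Omega f -> in_X0 Omega v ->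
  form_l Omega eh f v <= K * normX0' Omega f * semiX Omega v.
Proof.
have [K K0 HK] := mult_test; exists (Num.sqrt K); first exact: sqrtr_ge0.
move=> T eh ad f v Lf hv; have [[nT OT _] [Meh _ _ _]] := ad.
have ehM := admissible_bound eps00 ad; have meh := pl_measurable oO Meh.
have ehO x : Omega x -> `|eh x| <= 1 by move=> Ox; apply: ehM; exact: subset_closure.
have sf i : sq (coordf f i) by apply/in_Lp2 => //; exact: Lf.
have sef i : sq (fun x => eh x * coordf f i x) by exact: (sqi_bdM mO meh ehO (sf i)).
have hv1 := X0_H1 oO cO hv.
have /choice[phi Hphi] : forall i, exists phi : nat -> point -> R,
    (forall n, test_fun Omega (phi n)) /\ approx Omega phi (coordf v i).
  by move=> i; have [_ [phi h]] := (H10P oO cO _).1 (hv i); exists phi.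
pose V n x : point := \row_i (eh x * phi i n x).
have EV n i : coordf (V n) i = fun x => eh x * phi i n x by apply/funext => x; rewrite /coordf mxE.
have hV n : in_X0 Omega (V n).
  by move=> i; rewrite EV; have [] := HK _ _ ad _ ((Hphi i).1 n).
pose s n := \sum_i gradsq (phi i n).
have sV n : semiX Omega (V n) <= Num.sqrt K * Num.sqrt (s n).
  have hV1 := X0_H1 oO cO (hV n).
  have s0 : 0 <= s n by apply: sumr_ge0 => i _; exact: gradsq_ge0.
  have semi0 := semiX_ge0 oO hV1.
  have b0 : 0 <= Num.sqrt K * Num.sqrt (s n) by rewrite mulr_ge0 ?sqrtr_ge0.
  rewrite -(ler_pXn2r (n := 2))// exprMn (sqr_sqrtr K0) (sqr_sqrtr s0) (semiX_sqr oO hV1).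
  rewrite mulr_sumr; apply: ler_sum => i _; rewrite EV.
  by have [] := HK _ _ ad _ ((Hphi i).1 n).
have EI n : I (fun x => dotv (f x) (V n x)) = \sum_i I (fun x => eh x * coordf f i x * phi i n x).
  have spn i : sq (phi i n) by have [_ [h _ _] _] := (Hphi i).2.
  rewrite /integ -I_sum//; last by move=> i; exact: (sqiM mO (sef i) (spn i)).
  apply: eqI => // x _; rewrite dotv_sum; apply: eq_bigr => i _; by rewrite mxE /coordf; ring.
have cI : I (fun x => dotv (f x) (V n x)) @[n --> \oo] --> form_l Omega eh f v.
  have -> : form_l Omega eh f v = \sum_i I (fun x => eh x * coordf f i x * coordf v i x).
    rewrite /form_l /integ -I_sum//; last by move=> i; exact: (sqiM mO (sef i) (H1_sq oO (hv1 i))).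
    apply: eqI => // x _; rewrite dotv_sum mulr_sumr; apply: eq_bigr => i _; by rewrite /coordf mulrA.
  under eq_cvg do rewrite EI.
  apply: cvg_sumR => i; have [_ c _] := (Hphi i).2.
  exact: (cvg2M mO (cvg2_cst (sef i)) c).
have cs : s n @[n --> \oo] --> semiX Omega v ^+ 2.
  rewrite semiX_sqr//; apply: cvg_sumR => i; have [sp _ c] := (Hphi i).2.
  under eq_cvg do rewrite gradsq_smooth//.
  by apply: cvg_sumR => j; exact: (cvg2_nsq mO (c j)).
have nf0 := dual_norm_ge0 oO cO SC d0 sf.
have cR : normX0' Omega f * (Num.sqrt K * Num.sqrt (s n)) @[n --> \oo] -->
    Num.sqrt K * normX0' Omega f * semiX Omega v.
  have -> : Num.sqrt K * normX0' Omega f * semiX Omega v =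
     normX0' Omega f * (Num.sqrt K * Num.sqrt (semiX Omega v ^+ 2)).
    by rewrite sqrtr_sqr ger0_norm ?semiX_ge0//; ring.
  apply: cvgMr; apply: cvgMr; apply: cvg_comp cs _; exact: sqrt_continuous.
apply: ler_cvg_to cI cR _; apply: nearW => n.
apply: le_trans (dual_norm_le oO cO SC d0 sf (hV n)) _.
by rewrite ler_wpM2l.
Qed.

End discrete_load.

(** * The forms *)

Section fourth_powers.
Context {R : realType} {d : nat}.
Local Notation point := ('rV[R]_d).
Local Notation mu := (leb R d).
Variable Omega : set point.
Hypothesis oO : open Omega.
Hypothesis cO : compact (closure Omega).
Let mO := domain_measurable oO.
Implicit Types (f g : point -> R).
Local Notation I f := (integ Omega f).
Local Notation sq f := (sqi mu Omega f).
Local Notation nq f := (nsq mu Omega f).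
Local Notation cv f_ f := (cvg2 mu Omega f_ f).

(** Membership in L^4, phrased through squares to reuse the theory of L^2. *)
Definition sq4 f := measurable_fun Omega f /\ sq (fun x => f x ^+ 2).

Lemma sq4_sq f : sq4 f -> sq f.
Proof.
move=> [mf s2]; split => //.
exact: (sqi_int mO (domain_fin oO cO) s2).
Qed.

Lemma sq4M f g : sq4 f -> sq4 g -> sq (fun x => f x * g x).
Proof.
move=> [mf sf] [mg sg]; apply: (sqi_dom mO _ (sqiD mO sf sg)); first exact: measurable_funM.
move=> x _; rewrite normrM [leRHS]ger0_norm ?addr_ge0 ?sqr_ge0//.
rewrite -(real_normK (num_real (f x))) -(real_normK (num_real (g x))).
have := sqr_ge0 (`|f x| - `|g x|); have := mulr_ge0 (normr_ge0 (f x)) (normr_ge0 (g x)).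
by nra.
Qed.

Lemma sq4_dom f g : measurable_fun Omega f -> sq4 g ->
  (forall x, Omega x -> `|f x| <= `|g x|) -> sq4 f.
Proof.
move=> mf [mg sg] fg; split => //; apply: (sqi_dom mO _ sg); first exact: measurable_funX.
move=> x Ox; rewrite !normrX lerXn2r ?nnegrE//; exact: fg.
Qed.

Lemma sq4Z c f : sq4 f -> sq4 (fun x => c * f x).
Proof.
move=> [mf sf]; split; first exact: measurable_funM.
by apply: eq_sqi (sqiZ mO (c ^+ 2) sf) => // x _; rewrite exprMn.
Qed.

Lemma sq4D f g : sq4 f -> sq4 g -> sq4 (fun x => f x + g x).
Proof.
move=> sf sg; split; first by apply: measurable_funD; [exact: sf.1|exact: sg.1].
apply: (sqi_dom mO _ (sqiZ mO 2 (sqiD mO sf.2 sg.2))).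
  by apply: measurable_funX; apply: measurable_funD; [exact: sf.1|exact: sg.1].
move=> x _; rewrite !ger0_norm ?sqr_ge0 ?mulr_ge0 ?addr_ge0 ?sqr_ge0//.
by have := sqr_ge0 (f x - g x); nra.
Qed.

Lemma nsqM_le f g : sq4 f -> sq4 g ->
  nq (fun x => f x * g x) <= Num.sqrt (nq (fun x => f x ^+ 2)) * Num.sqrt (nq (fun x => g x ^+ 2)).
Proof.
move=> [mf sf] [mg sg]; apply: le_trans (cauchy_schwarz mO sf sg).
apply: le_trans (ler_norm _); rewrite le_eqVlt; apply/orP; left; apply/eqP.
by apply: eqI => // x _; rewrite exprMn.
Qed.

Lemma nsqM_bound f g (P Q : R) : sq4 f -> sq4 g -> 0 <= P -> 0 <= Q ->
  nq (fun x => f x ^+ 2) <= P ^+ 4 -> nq (fun x => g x ^+ 2) <= Q ^+ 4 ->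
  Num.sqrt (nq (fun x => f x * g x)) <= P * Q.
Proof.
move=> sf sg P0 Q0 fP gQ.
have s4 (a b : R) : 0 <= b -> a <= b ^+ 4 -> Num.sqrt a <= b ^+ 2.
  move=> b0 ab; rewrite -[leRHS]ger0_norm ?sqr_ge0// -sqrtr_sqr ler_wsqrtr//.
  by rewrite -exprM.
rewrite -[leRHS]ger0_norm ?mulr_ge0// -sqrtr_sqr ler_wsqrtr// exprMn.
apply: le_trans (nsqM_le sf sg) _; apply: ler_pM; rewrite ?sqrtr_ge0//; exact: s4.
Qed.

Definition cv4 (f_ : nat -> point -> R) f :=
  [/\ forall n, sq4 (f_ n), sq4 f & nq (fun x => (f_ n x - f x) ^+ 2) @[n --> \oo] --> 0].

Lemma sq4B f g : sq4 f -> sq4 g -> sq4 (fun x => f x - g x).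
Proof. by move=> sf /(sq4Z (-1)) sg; have := sq4D sf sg; under [X in sq4 X]eq_fun do rewrite mulN1r. Qed.

Lemma cv4M (f_ : nat -> point -> R) f g : sq4 g -> cv4 f_ f ->
  cv (fun n x => g x * f_ n x) (fun x => g x * f x).
Proof.
move=> sg [sf_ sf h]; split => [n||]; [exact: sq4M|exact: sq4M|].
apply: (@cvg2_0le _ _ (fun n => Num.sqrt (nq (fun x => g x ^+ 2)) * Num.sqrt (nq (fun x => (f_ n x - f x) ^+ 2)))).
  move=> n; rewrite nsq_ge0/=; apply: le_trans (nsqM_le sg (sq4B (sf_ n) sf)).
  by rewrite le_eqVlt; apply/orP; left; apply/eqP; apply: eqI => // x _; rewrite mulrBr.
by rewrite -[X in _ --> X](mulr0 (Num.sqrt (nq (fun x => g x ^+ 2)))); apply: cvgMr; exact: sqrt_cvg0.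
Qed.

Lemma cv4_sqr (f_ : nat -> point -> R) f : cv4 f_ f ->
  cv (fun n x => f_ n x ^+ 2) (fun x => f x ^+ 2).
Proof.
move=> cf; have [sf_ sf h] := cf.
have c0 : cv (fun n x => (f_ n x - f x) ^+ 2) (fun=> 0).
  split => [n||]; [exact: (sq4B (sf_ n) sf).2|exact: sqi0|].
  by under eq_cvg do under eq_fun do rewrite subr0.
have c1 := cv4M (sq4Z 2 sf) cf.
have c2 := cvg2_cst (mu := mu) (D := Omega) (sqiN mO sf.2).
have := cvg2D mO c0 (cvg2D mO c1 c2); congr cvg2.
  by apply/funext => n; apply/funext => x; ring.
by apply/funext => x; ring.
Qed.

End fourth_powers.

Section forms_theory.
Context {R : realType} {d : nat}.
Local Notation point := ('rV[R]_d).
Local Notation mu := (leb R d).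
Implicit Types (phi : point -> R) (u v w : point -> point).
Variable Omega : set point.
Hypothesis oO : open Omega.
Hypothesis cO : compact (closure Omega).
Let mO := domain_measurable oO.
Let fO := domain_fin oO cO.

Local Notation Int f := (mu.-integrable Omega (EFin \o f)).
Local Notation I f := (integ Omega f).
Local Notation sq f := (sqi mu Omega f).
Local Notation nq f := (nsq mu Omega f).
Local Notation cv f_ f := (cvg2 mu Omega f_ f).
Local Notation H1 f := (H1 Omega f).
Local Notation gradsq f := (gradsq Omega f).
Local Notation sq4 f := (sq4 Omega f).

(** A class containing both X_0 and the extension G, and closed under sums.
    Smooth approximation gives the product rule for the divergence of eps_h v,
    and L^4 integrability makes the trilinear integrals finite. *)
Definition velocity v :=
  (forall i, H1 (coordf v i) /\ exists phi : nat -> point -> R, approx Omega phi (coordf v i)) /\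
  sq4 (fun x => enorm (v x)).

Lemma coordfD u v i : coordf (fieldD u v) i = fun x => coordf u i x + coordf v i x.
Proof. by apply/funext => x; rewrite /coordf mxE. Qed.

Lemma coordfZ c v i : coordf (fun x => c *: v x) i = fun x => c * coordf v i x.
Proof. by apply/funext => x; rewrite /coordf mxE. Qed.

Lemma velocity_H1 v i : velocity v -> H1 (coordf v i). Proof. by move=> [/(_ i)[]]. Qed.

Lemma velocity_sq4 v i : velocity v -> sq4 (coordf v i).
Proof.
move=> hv; apply: (sq4_dom oO _ hv.2); first exact: (H1_sq oO (velocity_H1 i hv)).1.
by move=> x _; rewrite [leRHS]ger0_norm ?enorm_ge0// coord_le_enorm.
Qed.

Lemma velocity_sq v i : velocity v -> sq (coordf v i).
Proof. by move=> hv; exact: H1_sq (velocity_H1 i hv). Qed.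

Lemma velocityD u v : velocity u -> velocity v -> velocity (fieldD u v).
Proof.
move=> hu hv; split => [i|].
  rewrite coordfD; have [h1 [p ap]] := hu.1 i; have [h2 [q aq]] := hv.1 i; split; first exact: H1D.
  by exists (fun n x => p n x + q n x); exact: approxD.
apply: (sq4_dom oO _ (sq4D oO hu.2 hv.2)).
  apply: measurable_enorm => // k l; rewrite (ord1 k).
  have -> : (fun x => fieldD u v x ord0 l) = fun x => coordf u l x + coordf v l x by rewrite -coordfD.
  by apply: measurable_funD; [exact: (velocity_sq l hu).1|exact: (velocity_sq l hv).1].
move=> x _; rewrite !ger0_norm ?addr_ge0 ?enorm_ge0//; exact: enormD.
Qed.

Section sobolev.
Variables (Sc Cc : R -> R).
Hypothesis SC : sobolev_constants Omega Sc Cc.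
Let p46 : 1 <= (4 : R) <= 6. Proof. by apply/andP; split; lra. Qed.

Lemma L4_bound v c : (forall i, sq (coordf v i)) -> 0 <= c ->
  (normLp Omega 4%:E (fun x => enorm (v x)) <= c%:E)%E ->
  sq4 (fun x => enorm (v x)) /\ nq (fun x => enorm (v x) ^+ 2) <= c ^+ 4.
Proof.
move=> sv c0 h.
have mE : measurable_fun Omega (fun x => enorm (v x)).
  by apply: measurable_enorm => // k l; rewrite (ord1 k); exact: (sv l).1.
have [||I1 I2] := @normLp_le_int _ _ _ oO 4 _ c _ c0 mE; [by []|exact: h|].
have E x : `|enorm (v x)| `^ 4 = (enorm (v x) ^+ 2) ^+ 2.
  by rewrite (ger0_norm (enorm_ge0 _)) powR_mulrn ?enorm_ge0// -exprM.
split; first split => //; first split; first exact: measurable_funX.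
  by apply: int_eq I1 => // x _; rewrite E.
rewrite -powR_mulrn//; apply: le_trans I2.
by rewrite le_eqVlt; apply/orP; left; apply/eqP; apply: eqI => // x _; rewrite E.
Qed.

Lemma X0_L4 v : in_X0 Omega v ->
  sq4 (fun x => enorm (v x)) /\ nq (fun x => enorm (v x) ^+ 2) <= (Cc 4 * semiX Omega v) ^+ 4.
Proof.
move=> hv; have hv1 := X0_H1 oO cO hv; have [_ C0 _ h] := SC p46.
apply: L4_bound (h v hv); first by move=> i; exact: H1_sq (hv1 i).
by rewrite mulr_ge0 ?semiX_ge0// ltW.
Qed.

Lemma X_L4 v : in_X Omega v ->
  sq4 (fun x => enorm (v x)) /\ nq (fun x => enorm (v x) ^+ 2) <= (Sc 4 * normX Omega v) ^+ 4.
Proof.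
move=> hv; have [S0 _ h _] := SC p46.
apply: L4_bound (h v hv); first by move=> i; exact: (H1_sq oO (hv i)).
by rewrite mulr_ge0 ?normX_ge0// ltW.
Qed.

Lemma X0_velocity v : in_X0 Omega v -> velocity v.
Proof.
move=> hv; split; last exact: (X0_L4 hv).1.
by move=> i; have [h [phi [_ a]]] := (H10P oO cO _).1 (hv i); split => //; exists phi.
Qed.

Lemma trace_velocity v g : in_X Omega v -> (forall i, is_trace Omega (coordf v i) (coordf g i)) -> velocity v.
Proof.
move=> hv tv; split; last exact: (X_L4 hv).1.
by move=> i; split; [exact: hv|exact: (trace_approx oO cO (hv i) (tv i))].
Qed.

(** The difference phi_n - f is in H^1_0: its gradient controls its L^4 norm. *)
Lemma H10_cv4 (i0 : 'I_d) f (phi_ : nat -> point -> R) : in_H10 Omega f -> (forall n, test_fun Omega (phi_ n)) ->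
  approx Omega phi_ f -> cv4 Omega phi_ f.
Proof.
move=> hf tp ap; have [_ C0 _ _] := SC p46.
have q4 g : in_H10 Omega g -> sq4 g /\ nq (fun x => g x ^+ 2) <= Cc 4 ^+ 4 * gradsq g ^+ 2.
  move=> hg; have [h1 h2] := H10_Lp oO cO SC i0 p46 hg.
  have hg1 : H1 g by have [] := (H10P oO cO _).1 hg.
  have E x : `|g x| `^ 4 = (g x ^+ 2) ^+ 2.
    by rewrite powR_mulrn// -[4%N]/(2 * 2)%N exprM real_normK ?num_real.
  split; first split; first exact: (H1_sq oO hg1).1.
    split; first by apply: measurable_funX; exact: (H1_sq oO hg1).1.
    by apply: int_eq h1 => // x _; rewrite E.
  have -> : Cc 4 ^+ 4 * gradsq g ^+ 2 = (Cc 4 * Num.sqrt (gradsq g)) `^ 4.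
    rewrite powR_mulrn; last by rewrite mulr_ge0 ?sqrtr_ge0// ltW.
    by rewrite exprMn -[4%N]/(2 * 2)%N [Num.sqrt _ ^+ _]exprM sqr_sqrtr ?gradsq_ge0.
  apply: le_trans h2; rewrite le_eqVlt; apply/orP; left; apply/eqP.
  by apply: eqI => // x _; rewrite E.
have hf1 : H1 f by have [] := (H10P oO cO _).1 hf.
have hB n : in_H10 Omega (fun x => phi_ n x - f x).
  have := H10D oO cO (H10_test oO cO (tp n)) (H10Z oO cO (-1) hf).
  by under [X in in_H10 _ X]eq_fun do rewrite mulN1r.
split => [n||]; [exact: (q4 _ (H10_test oO cO (tp n))).1|exact: (q4 _ hf).1|].
have [sp _ dp] := ap.
apply: (@cvg2_0le _ _ (fun n => Cc 4 ^+ 4 * (\sum_i nq (fun x => partial i (phi_ n) x - wderiv Omega i f x)) ^+ 2)).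
  move=> n; rewrite nsq_ge0/=; have [_] := q4 _ (hB n); congr (_ <= _ * _ ^+ 2).
  apply: eq_bigr => i _; have hp := H1_smooth oO cO (sp n).
  apply: nsq_ae => //.
  - apply: filterS2 (wderivB oO i hp hf1) (wderiv_smooth oO i (sp n)) => x h1 h2 Ox.
    by rewrite h1// h2.
  - exact: (H1_dsq oO i (H1B oO hp hf1)).1.
  - have [h _ _] := dp i; exact: measurable_funB (h n).1 (H1_dsq oO i hf1).1.
rewrite -[X in _ --> X](mulr0 (Cc 4 ^+ 4)).
by apply: cvgMr; apply: sqr_cvg0; apply: sum_cvg0 => i; have [_ _] := dp i.
Qed.

End sobolev.
End forms_theory.

(** ** The divergence of the weighted velocity *)

Section discrete_forms.
Context {R : realType} {d : nat}.
Local Notation point := ('rV[R]_d).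
Local Notation mu := (leb R d).
Implicit Types (phi : point -> R) (u v w : point -> point).
Variable Omega : set point.
Hypothesis oO : open Omega.
Hypothesis cO : compact (closure Omega).
Let mO := domain_measurable oO.
Let fO := domain_fin oO cO.

Local Notation Int f := (mu.-integrable Omega (EFin \o f)).
Local Notation I f := (integ Omega f).
Local Notation sq f := (sqi mu Omega f).
Local Notation nq f := (nsq mu Omega f).
Local Notation cv f_ f := (cvg2 mu Omega f_ f).
Local Notation H1 f := (H1 Omega f).
Local Notation gradsq f := (gradsq Omega f).
Local Notation sq4 f := (sq4 Omega f).
Local Notation velocity := (velocity Omega).

Variables (T : seq (simplex R d)) (eh : point -> R).
Hypothesis nT : forall K, K \in T -> nondegenerate K.
Hypothesis OT : closure Omega = \bigcup_(K in [set` T]) hull K.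
Hypothesis Meh : in_Mh Omega T eh.
Hypothesis eh1 : forall x, closure Omega x -> `|eh x| <= 1.
Local Notation kg i := (kgrad (skeleton T) i eh).

Let meh : measurable_fun Omega eh. Proof. exact: pl_measurable oO Meh. Qed.
Let ehO x : Omega x -> `|eh x| <= 1.
Proof. by move=> Ox; apply: eh1; exact: subset_closure. Qed.

Lemma sq_mult f : sq f -> sq (fun x => eh x * f x).
Proof. by move=> sf; exact: (sqi_bdM mO meh ehO sf). Qed.

Lemma sq_kgrad_mult i f : sq f -> sq (fun x => kg i x * f x).
Proof.
move=> sf; have [L L0 HL] := kgrad_pl_bound OT Meh.
by apply: (sqi_bdM mO (measurable_kgrad_pl oO OT Meh i) _ sf) => x; exact: HL.
Qed.

Lemma sq_l1loc f : sq f -> in_L1loc Omega f.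
Proof.
move=> sf; split; first exact: sf.1.
move=> K cK KO; apply: (integrableS mO (compact_measurable_rv cK) KO).
exact: (sqi_int mO fO sf).
Qed.

(** For smooth phi_n, the product phi_n psi is a test function, against which
    the weak derivative of eh applies; the resulting identity is linear in phi_n
    and in its gradient and passes to the limit. *)
Lemma mult_wderiv i f (phi : nat -> point -> R) : H1 f -> approx Omega phi f ->
  is_wderiv Omega i (fun x => eh x * f x) (fun x => kg i x * f x + eh x * wderiv Omega i f x).
Proof.
move=> hf [sp cp dp]; have sf := H1_sq oO hf; have sdf := H1_dsq oO i hf.
have [_ _ weh] := pl_wderiv oO nT OT Meh eh1 i cO.
split.
- by apply: sq_l1loc; exact: sq_mult.
- by apply: sq_l1loc; apply: (sqiD mO); [exact: sq_kgrad_mult|exact: sq_mult].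
move=> psi tpsi; have [spsi _] := tpsi.
have scont g : continuous g -> sq g by exact: sq_cont.
have s1 : sq (fun x => eh x * partial i psi x).
  by apply: sq_mult; apply: scont; apply: smooth_cont; exact: smooth_partial.
have s2 : sq (fun x => eh x * psi x) by apply: sq_mult; apply: scont; exact: smooth_cont.
have s3 : sq (fun x => kg i x * psi x) by apply: sq_kgrad_mult; apply: scont; exact: smooth_cont.
have E n : I (fun x => eh x * partial i psi x * phi n x) + I (fun x => eh x * psi x * partial i (phi n) x) =
   - I (fun x => kg i x * psi x * phi n x).
  have [spn _ _] := cp; have [sdn _ _] := dp i.
  rewrite -(integD oO (sqiM mO s1 (spn n)) (sqiM mO s2 (sdn n))).
  have := weh _ (test_funM tpsi (sp n)) => h.
  transitivity (I (fun x => eh x * partial i (fun x => psi x * phi n x) x)).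
    apply: eqI => // x _; rewrite partialM; [ring|by []|exact: sp].
  by rewrite h; congr (- _); apply: eqI => // x _; rewrite mulrA.
have c1 := cvg2M mO (cvg2_cst s1) cp.
have c2 := cvg2M mO (cvg2_cst s2) (dp i).
have c3 := cvg2M mO (cvg2_cst s3) cp.
have L : I (fun x => eh x * partial i psi x * f x) + I (fun x => eh x * psi x * wderiv Omega i f x) =
   - I (fun x => kg i x * psi x * f x).
  apply: (@cvg_unique _ (@Rhausdorff R) _ _ _ _ (cvgD c1 c2)).
  rewrite (_ : (fun n => _) + (fun n => _) = (fun n => - I (fun x => kg i x * psi x * phi n x))).
    exact: cvgN c3.
  by apply/funext => n; rewrite -E.
have := L; rewrite -(integD oO (sqiM mO s1 sf) (sqiM mO s2 sdf)).
rewrite (integD oO (sqiM mO s1 sf) (sqiM mO s2 sdf)).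
move/eqP; rewrite eq_sym -subr_eq -opprD => /eqP L'.
transitivity (I (fun x => eh x * partial i psi x * f x)); first by apply: eqI => // x _; ring.
rewrite -L'; congr (- _); rewrite -(integD oO (sqiM mO s3 sf) (sqiM mO s2 sdf)).
by apply: eqI => // x _; ring.
Qed.

(** The product rule gives a formula for the divergence of eh v, almost
    everywhere equal to the chosen representative [ediv]. *)
Definition pdiv v x : R := \sum_i (kg i x * coordf v i x + eh x * wderiv Omega i (coordf v i) x).

Lemma is_wdiv_velocity v : velocity v -> is_wdiv Omega (fun x => eh x *: v x) (pdiv v).
Proof.
move=> hv; apply: is_wdiv_wderiv => // i.
have [h1 [phi ap]] := hv.1 i.
have -> : coordf (fun x => eh x *: v x) i = fun x => eh x * coordf v i x.
  by apply/funext => x; rewrite /coordf mxE.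
exact: mult_wderiv h1 ap.
Qed.

Lemma sq_pdiv v : velocity v -> sq (pdiv v).
Proof.
move=> hv; apply: sqi_sum => // i; apply: (sqiD mO).
  by apply: sq_kgrad_mult; exact: velocity_sq.
by apply: sq_mult; apply: H1_dsq => //; exact: velocity_H1.
Qed.

Lemma ediv_pdiv v : velocity v -> {ae mu, forall x, Omega x -> ediv Omega eh v x = pdiv v x}.
Proof. by move=> /is_wdiv_velocity; exact: wdivE. Qed.

Lemma is_wdiv_ediv v : velocity v -> is_wdiv Omega (fun x => eh x *: v x) (ediv Omega eh v).
Proof.
move=> hv; rewrite /ediv /wdiv; apply: (xgetPex (fun=> 0)); exists (pdiv v).
exact: is_wdiv_velocity.
Qed.

Lemma sq_ediv v : velocity v -> sq (ediv Omega eh v).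
Proof.
move=> hv; apply: (sqi_ae mO _ _ (sq_pdiv hv)).
  by apply: filterS (ediv_pdiv hv) => x h Ox; rewrite h.
by have [_ []] := is_wdiv_ediv hv.
Qed.

Lemma edivD u v : velocity u -> velocity v ->
  {ae mu, forall x, Omega x -> ediv Omega eh (fieldD u v) x = ediv Omega eh u x + ediv Omega eh v x}.
Proof.
move=> hu hv; have h i := wderivD oO i (velocity_H1 i hu) (velocity_H1 i hv).
have huv := velocityD oO hu hv.
have hall := ae_forall_countable h.
have e12 : {ae mu, forall x, (Omega x -> ediv Omega eh u x = pdiv u x) /\
    (Omega x -> ediv Omega eh v x = pdiv v x)}.
  by apply: filterS2 (ediv_pdiv hu) (ediv_pdiv hv).
apply: filterS3 (ediv_pdiv huv) hall e12 => x h1 h2 [h3 h4] Ox.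
rewrite h1// h3// h4// /pdiv -big_split; apply: eq_bigr => i _ /=.
by rewrite coordfD h2//; ring.
Qed.

(** ** Integrability and additivity *)

Lemma velocity_sqM u v i j : velocity u -> velocity v -> sq (fun x => coordf u i x * coordf v j x).
Proof. by move=> hu hv; apply: (sq4M oO); exact: velocity_sq4. Qed.

Definition conv u v w x : R := \sum_i \sum_j eh x * (coordf u j x * coordf w i x) * wderiv Omega j (coordf v i) x.

Lemma convE u v w x : eh x * dotv (u x *m (wjac Omega v x)^T) (w x) = conv u v w x.
Proof.
rewrite dotv_sum mulr_sumr; apply: eq_bigr => i _.
rewrite mxE mulr_suml mulr_sumr; apply: eq_bigr => j _.
by rewrite !mxE /coordf; ring.
Qed.

Lemma conv_int1 u v w i j : velocity u -> velocity v -> velocity w ->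
  Int (fun x => eh x * (coordf u j x * coordf w i x) * wderiv Omega j (coordf v i) x).
Proof.
move=> hu hv hw; apply: (sqiM mO); first by apply: sq_mult; exact: velocity_sqM.
by apply: H1_dsq => //; exact: velocity_H1.
Qed.

Lemma conv_int u v w : velocity u -> velocity v -> velocity w -> Int (conv u v w).
Proof.
move=> hu hv hw; apply: int_sum => // i; apply: int_sum => // j; exact: conv_int1.
Qed.

Lemma half_int1 u v w i : velocity u -> velocity v -> velocity w ->
  Int (fun x => ediv Omega eh u x * (coordf v i x * coordf w i x)).
Proof. by move=> hu hv hw; apply: (sqiM mO); [exact: sq_ediv|exact: velocity_sqM]. Qed.

Lemma half_int u v w : velocity u -> velocity v -> velocity w ->
  Int (fun x => ediv Omega eh u x * dotv (v x) (w x)).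
Proof.
move=> hu hv hw; have := int_sum mO (fun i => half_int1 i hu hv hw).
by apply: int_eq => // x _; rewrite dotv_sum mulr_sumr.
Qed.

Lemma form_dE u v w : form_d Omega eh u v w =
  I (conv u v w) + 2^-1 * I (fun x => ediv Omega eh u x * dotv (v x) (w x)).
Proof. by congr (_ + _); apply: eqI => // x _; exact: convE. Qed.

Lemma dotvDl (x y z : point) : dotv (x + y) z = dotv x z + dotv y z.
Proof. exact: dotm_add. Qed.

Lemma form_dDl u1 u2 v w : velocity u1 -> velocity u2 -> velocity v -> velocity w ->
  form_d Omega eh (fieldD u1 u2) v w = form_d Omega eh u1 v w + form_d Omega eh u2 v w.
Proof.
move=> h1 h2 hv hw; have h12 := velocityD oO h1 h2; rewrite !form_dE addrACA -mulrDr.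
rewrite -(integD oO (conv_int h1 hv hw) (conv_int h2 hv hw)).
rewrite -(integD oO (half_int h1 hv hw) (half_int h2 hv hw)); congr (_ + _ * _).
  apply: eqI => // x _; rewrite -big_split; apply: eq_bigr => i _; rewrite -big_split; apply: eq_bigr => j _ /=.
  by rewrite coordfD; ring.
apply: I_ae => //.
- by apply: filterS (edivD h1 h2) => x h Ox; rewrite h// mulrDl.
- exact: (int_meas (half_int h12 hv hw)).
- exact: (int_meas (intD mO (half_int h1 hv hw) (half_int h2 hv hw))).
Qed.

Lemma form_dDm u v1 v2 w : velocity u -> velocity v1 -> velocity v2 -> velocity w ->
  form_d Omega eh u (fieldD v1 v2) w = form_d Omega eh u v1 w + form_d Omega eh u v2 w.
Proof.
move=> hu h1 h2 hw; have h12 := velocityD oO h1 h2; rewrite !form_dE addrACA -mulrDr.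
have E2 : I (fun x => ediv Omega eh u x * dotv (fieldD v1 v2 x) (w x)) =
   I (fun x => ediv Omega eh u x * dotv (v1 x) (w x)) + I (fun x => ediv Omega eh u x * dotv (v2 x) (w x)).
  rewrite -(integD oO (half_int hu h1 hw) (half_int hu h2 hw)).
  by apply: eqI => // x _; rewrite dotvDl mulrDr.
rewrite E2; congr (_ + _).
transitivity (I (fun x => conv u v1 w x + conv u v2 w x)); last first.
  exact: (integD oO (conv_int hu h1 hw) (conv_int hu h2 hw)).
have hall : {ae mu, forall x, forall ij : 'I_d * 'I_d, Omega x ->
   wderiv Omega ij.2 (coordf (fieldD v1 v2) ij.1) x =
   wderiv Omega ij.2 (coordf v1 ij.1) x + wderiv Omega ij.2 (coordf v2 ij.1) x}.
  apply: ae_forall_countable => -[i j] /=; rewrite coordfD.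
  by apply: wderivD => //; exact: velocity_H1.
apply: I_ae => //.
- apply: filterS hall => x h Ox; rewrite -big_split; apply: eq_bigr => i _.
  rewrite -big_split; apply: eq_bigr => j _ /=; rewrite (h (i, j) Ox); ring.
- exact: (int_meas (conv_int hu h12 hw)).
- exact: (int_meas (intD mO (conv_int hu h1 hw) (conv_int hu h2 hw))).
Qed.

Lemma form_dNr u v w : velocity u -> velocity v -> velocity w ->
  form_d Omega eh u v (fun x => (-1) *: w x) = - form_d Omega eh u v w.
Proof.
move=> hu hv hw; rewrite !form_dE opprD -mulrN -(I_N mO (conv_int hu hv hw)) -(I_N mO (half_int hu hv hw)).
congr (_ + _ * _); apply: eqI => // x _.
  rewrite -sumrN; apply: eq_bigr => i _; rewrite -sumrN; apply: eq_bigr => j _.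
  by rewrite coordfZ; ring.
by rewrite !dotv_sum !mulr_sumr -sumrN; apply: eq_bigr => i _; rewrite mxE; ring.
Qed.

(** ** Skew-symmetry *)

Variables (Sc Cc : R -> R).
Hypothesis SC : sobolev_constants Omega Sc Cc.

(** For each component, 2 v_i (eh u . grad v_i) = eh u . grad (v_i^2), whose
    integral is that of - div(eh u) v_i^2 when v_i is a test function.  Test
    functions converging to v_i in H^1 and in L^4 give the general case. *)
Lemma form_d_skew u v : velocity u -> in_X0 Omega v -> form_d Omega eh u v v = 0.
Proof.
move=> hu hv0; have hv := X0_velocity oO cO SC hv0.
have step i : 2 * (\sum_j I (fun x => eh x * (coordf u j x * coordf v i x) * wderiv Omega j (coordf v i) x)) =
   - I (fun x => ediv Omega eh u x * (coordf v i x * coordf v i x)).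
  have [hf [phi [tp ap]]] := (H10P oO cO _).1 (hv0 i).
  have c4 := H10_cv4 oO cO SC i (hv0 i) tp ap; have [sp cp dp] := ap.
  set f := coordf v i in hf ap c4 cp dp *.
  have [_ _ wd] := is_wdiv_ediv hu.
  have sF j : sq4 (fun x => eh x * coordf u j x).
    have hj := velocity_sq4 oO j hu; apply: (sq4_dom oO _ hj); first by apply: measurable_funM => //; exact: hj.1.
    by move=> x Ox; rewrite normrM -[leRHS]mul1r ler_wpM2r// ehO.
  have cF j := cvg2M mO (cv4M oO (sF j) c4) (dp j).
  have cD := cvg2M mO (cvg2_cst (sq_ediv hu)) (cv4_sqr oO c4).
  have E n : 2 * (\sum_j I (fun x => eh x * coordf u j x * phi n x * partial j (phi n) x)) =
      - I (fun x => ediv Omega eh u x * phi n x ^+ 2).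
    have tpn2 := test_funM (tp n) (sp n).
    have Ij j : Int (fun x => eh x * coordf u j x * phi n x * partial j (phi n) x).
      have [h1 _ _] := cv4M oO (sF j) c4; have [h2 _ _] := dp j; exact: (sqiM mO (h1 n) (h2 n)).
    rewrite (_ : \sum_j _ = I (fun x => \sum_j eh x * coordf u j x * phi n x * partial j (phi n) x)); last first.
      by rewrite /integ I_sum.
    have := wd _ tpn2 => h.
    have h' : - I (fun x => ediv Omega eh u x * phi n x ^+ 2) =
       - I (fun x => ediv Omega eh u x * (phi n x * phi n x)).
      by congr (- _); apply: eqI => // x _; rewrite expr2.
    rewrite h' -h -(integZ oO 2 (int_sum mO Ij)); apply: eqI => // x _.
    rewrite mulr_sumr; apply: eq_bigr => j _; rewrite partialM// /coordf mxE; ring.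
  have cL : 2 * (\sum_j I (fun x => eh x * coordf u j x * phi n x * partial j (phi n) x)) @[n --> \oo] -->
      2 * (\sum_j I (fun x => eh x * coordf u j x * f x * wderiv Omega j f x)).
    by apply: cvgMr; apply: cvg_sumR => j; exact: cF.
  have cR : 2 * (\sum_j I (fun x => eh x * coordf u j x * phi n x * partial j (phi n) x)) @[n --> \oo] -->
      - I (fun x => ediv Omega eh u x * f x ^+ 2).
    by under eq_cvg do rewrite E; exact: cvgN cD.
  have h := cvg_unique (@Rhausdorff R) cL cR.
  transitivity (2 * (\sum_j I (fun x => eh x * coordf u j x * f x * wderiv Omega j f x))).
    by congr (_ * _); apply: eq_bigr => j _; apply: eqI => // x _; ring.
  by rewrite h; congr (- _); apply: eqI => // x _; rewrite expr2.
rewrite form_dE.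
have -> : I (conv u v v) = \sum_i \sum_j I (fun x => eh x * (coordf u j x * coordf v i x) * wderiv Omega j (coordf v i) x).
  have h := I_sum mO (fun i => int_sum mO (fun j => conv_int1 i j hu hv hv)).
  apply: (eq_trans h); apply: eq_bigr => i _.
  exact: (I_sum mO (fun j => conv_int1 i j hu hv hv)).
have -> : I (fun x => ediv Omega eh u x * dotv (v x) (v x)) =
   \sum_i I (fun x => ediv Omega eh u x * (coordf v i x * coordf v i x)).
  rewrite /integ -I_sum//; last by move=> i; exact: half_int1.
  by apply: eqI => // x _; rewrite dotv_sum mulr_sumr.
rewrite mulr_sumr -big_split big1// => i _ /=.
have := step i; set a := \sum_j _; set b := I _ => h.
have -> : b = - (2 * a) by rewrite h opprK.
by field.
Qed.

End discrete_forms.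

(** A coefficient is continuous inside its interval only; its two boundary
    values are arbitrary, so measurability has to treat them apart. *)
Lemma coefficient_measurable (R : realType) (eps0 am aM : R) (a : R -> R) :
  coefficient eps0 am aM a -> exists2 b, measurable_fun setT b &
  forall t, eps0 <= t <= 1 -> a t = b t.
Proof.
move=> [_ _ [M HM]]; pose A := `]eps0, 1[%classic : set R.
have mA : measurable_fun A a.
  apply: open_continuous_measurable_fun; first exact: interval_open.
  move=> t /set_mem; rewrite /A/= in_itv/= => /HM[da _].
  by apply: differentiable_continuous; exact/derivable1_diffP.
have mA' : measurable_fun setT (a \_ A).
  by apply/(measurable_restrictT a (measurable_itv _)).
exists (fun t => if t == eps0 then a eps0 else if t == 1 then a 1 else (a \_ A) t).
  apply: measurable_fun_ifT => //; first exact: measurable_fun_eqr.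
  apply: measurable_fun_ifT => //; exact: measurable_fun_eqr.
move=> t /andP[e0t t1]; case: eqVneq => [->//|te]; case: eqVneq => [->//|tn].
rewrite patchE mem_set// /A/= in_itv/= lt_neqAle eq_sym te e0t/= lt_neqAle tn.
exact: t1.
Qed.

(** ** Estimates of the forms *)

Section forms_estimates.
Context {R : realType} {d : nat}.
Local Notation point := ('rV[R]_d).
Local Notation mu := (leb R d).
Implicit Types (phi : point -> R) (u v w : point -> point).
Variable Omega : set point.
Hypothesis oO : open Omega.
Hypothesis cO : compact (closure Omega).
Let mO := domain_measurable oO.
Let fO := domain_fin oO cO.

Local Notation Int f := (mu.-integrable Omega (EFin \o f)).
Local Notation I f := (integ Omega f).
Local Notation sq f := (sqi mu Omega f).
Local Notation nq f := (nsq mu Omega f).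
Local Notation H1 f := (H1 Omega f).
Local Notation sq4 f := (sq4 Omega f).
Local Notation velocity := (velocity Omega).
Local Notation semiX := (semiX Omega).

Variables (T : seq (simplex R d)) (eh : point -> R).
Hypothesis nT : forall K, K \in T -> nondegenerate K.
Hypothesis OT : closure Omega = \bigcup_(K in [set` T]) hull K.
Hypothesis Meh : in_Mh Omega T eh.
Variables (Re eps0 alpham alphaM betam betaM : R) (alpha beta : R -> R).
Hypotheses (Re0 : 0 < Re) (eps00 : 0 < eps0).
Hypothesis ehE : forall x, closure Omega x -> eps0 <= eh x <= 1.
Hypothesis Ha : coefficient eps0 alpham alphaM alpha.
Hypothesis Hb : coefficient eps0 betam betaM beta.
Local Notation form_a := (form_a Omega Re alpha eh).
Local Notation form_d := (form_d Omega eh).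
Local Notation form_c := (form_c Omega beta eh).
Local Notation form_b := (form_b Omega eh).

Let ehO x : Omega x -> eps0 <= eh x <= 1.
Proof. by move=> Ox; apply: ehE; exact: subset_closure. Qed.
Let eh1 x : closure Omega x -> `|eh x| <= 1.
Proof. by move=> /ehE /andP[h1 h2]; rewrite ger0_norm// (le_trans (ltW eps00)). Qed.
Let meh : measurable_fun Omega eh. Proof. exact: pl_measurable oO Meh. Qed.

Lemma coefficient_comp_measurable am aM a : coefficient eps0 am aM a ->
  measurable_fun Omega (fun x => a (eh x)).
Proof.
move=> /coefficient_measurable[b mb ab].
have : measurable_fun Omega (fun x => b (eh x)) by exact: measurableT_comp.
by apply: eq_measurable_fun => x; rewrite inE => Ox; rewrite ab// ehO.
Qed.

Lemma coefficient_comp_bound am aM a x : coefficient eps0 am aM a -> Omega x ->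
  0 < a (eh x) <= aM.
Proof. by move=> [h1 h2 _] Ox; rewrite h1 ?ehO//=; have /andP[] := h2 _ (ehO Ox). Qed.

(** ** The viscous form *)

Lemma sq_wjac v k l : velocity v -> sq (fun x => wjac Omega v x k l).
Proof. by move=> hv; under [X in sqi _ _ X]eq_fun do rewrite mxE; apply: H1_dsq => //; exact: velocity_H1. Qed.

Lemma sq_enorm_wjac v : velocity v -> sq (fun x => enorm (wjac Omega v x)) /\
  Num.sqrt (nq (fun x => enorm (wjac Omega v x))) = semiX v.
Proof.
move=> hv; have [h _] := sq_enorm oO (fun k l => sq_wjac k l hv); split => //.
by rewrite /Defs.semiX normL2E.
Qed.

Lemma dotm_wjac_int u v : velocity u -> velocity v ->
  Int (fun x => eh x * dotm (wjac Omega u x) (wjac Omega v x)).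
Proof.
move=> hu hv; rewrite /dotm.
under [X in Int X]eq_fun do rewrite mulr_sumr.
apply: int_sum => // i; under [X in Int X]eq_fun do rewrite mulr_sumr.
apply: int_sum => // j.
apply: int_eq (sqiM mO (sq_mult oO Meh eh1 (sq_wjac i j hu)) (sq_wjac i j hv)) => // x _.
by rewrite mulrA.
Qed.

Lemma coef_dotv_int am aM a u v : coefficient eps0 am aM a -> velocity u -> velocity v ->
  Int (fun x => a (eh x) * dotv (u x) (v x)).
Proof.
move=> ha hu hv; have ma := coefficient_comp_measurable ha.
under [X in Int X]eq_fun do rewrite dotv_sum mulr_sumr.
apply: int_sum => // i.
have s : sq (fun x => a (eh x) * coordf u i x).
  apply: (sqi_bdM mO (c := aM) ma _ (velocity_sq oO i hu)) => x Ox.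
  by have /andP[h1 h2] := coefficient_comp_bound ha Ox; rewrite ger0_norm// ltW.
by apply: int_eq (sqiM mO s (velocity_sq oO i hv)) => // x _; rewrite mulrA.
Qed.

Lemma split_sum (a a1 a2 b b1 b2 : R) : a = a1 + a2 -> b = b1 + b2 ->
  a + b = (a1 + b1) + (a2 + b2).
Proof. by move=> -> ->; ring. Qed.

Lemma form_aD u1 u2 v : velocity u1 -> velocity u2 -> velocity v ->
  form_a (fieldD u1 u2) v = form_a u1 v + form_a u2 v.
Proof.
move=> h1 h2 hv; have h12 := velocityD oO h1 h2; 
have E1 : I (fun x => eh x * dotm (wjac Omega (fieldD u1 u2) x) (wjac Omega v x)) =
   I (fun x => eh x * dotm (wjac Omega u1 x) (wjac Omega v x)) +
   I (fun x => eh x * dotm (wjac Omega u2 x) (wjac Omega v x)).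
  have J1 := dotm_wjac_int h1 hv; have J2 := dotm_wjac_int h2 hv.
  rewrite -(integD oO J1 J2).
  have hall : {ae mu, forall x, forall ij : 'I_d * 'I_d, Omega x ->
     wderiv Omega ij.2 (coordf (fieldD u1 u2) ij.1) x =
     wderiv Omega ij.2 (coordf u1 ij.1) x + wderiv Omega ij.2 (coordf u2 ij.1) x}.
    apply: ae_forall_countable => -[i j] /=; rewrite coordfD.
    by apply: wderivD => //; exact: velocity_H1.
  apply: I_ae => //; [|exact: (int_meas (dotm_wjac_int h12 hv))|exact: (int_meas (intD mO J1 J2))].
  apply: filterS hall => x h Ox; rewrite -mulrDr -dotm_add; congr (_ * dotm _ _).
  by apply/matrixP => i j; rewrite !mxE (h (i, j) Ox).
have E2 : I (fun x => alpha (eh x) * dotv (fieldD u1 u2 x) (v x)) =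
   I (fun x => alpha (eh x) * dotv (u1 x) (v x)) + I (fun x => alpha (eh x) * dotv (u2 x) (v x)).
  rewrite -(integD oO (coef_dotv_int Ha h1 hv) (coef_dotv_int Ha h2 hv)).
  by apply: eqI => // x _; rewrite dotvDl mulrDr.
by apply: split_sum E2; rewrite E1 mulrDr.
Qed.

Lemma form_a_coercive v : velocity v -> eps0 / Re * semiX v ^+ 2 <= form_a v v.
Proof.
move=> hv; have [sJ <-] := sq_enorm_wjac hv.
rewrite sqr_sqrtr ?nsq_ge0// -[leLHS]addr0; apply: lerD; last first.
  apply: Rintegral_ge0 => x Ox; apply: mulr_ge0; last exact: dotm_ge0.
  by have /andP[/ltW] := coefficient_comp_bound Ha Ox.
rewrite -mulrA mulrCA ler_wpM2l ?invr_ge0 ?(ltW Re0)//.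
apply: (@le_trans _ _ (I (fun x => eps0 * enorm (wjac Omega v x) ^+ 2))); first by rewrite (integZ oO eps0 sJ.2).
apply: (I_le mO (intZ mO eps0 sJ.2) (dotm_wjac_int hv hv)) => x Ox.
by rewrite enorm_sqr ler_wpM2r ?dotm_ge0//; have /andP[] := ehO Ox.
Qed.

Definition l2 v : R := Num.sqrt (nq (fun x => enorm (v x))).

Lemma l2_ge0 v : 0 <= l2 v. Proof. exact: sqrtr_ge0. Qed.

Lemma velocity_sq_enorm v : velocity v -> sq (fun x => enorm (v x)).
Proof. by move=> [_ h]; exact: (sq4_sq oO cO h). Qed.

Lemma form_a_bound u v : velocity u -> velocity v ->
  `|form_a u v| <= Re^-1 * (semiX u * semiX v) + alphaM * (l2 u * l2 v).
Proof.
move=> hu hv; apply: le_trans (ler_normD _ _) _; apply: lerD.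
  rewrite normrM ger0_norm ?invr_ge0 ?(ltW Re0)// ler_wpM2l ?invr_ge0 ?(ltW Re0)//.
  have [sJu <-] := sq_enorm_wjac hu; have [sJv <-] := sq_enorm_wjac hv.
  apply: le_trans (cauchy_schwarz mO sJu sJv).
  apply: le_trans (ler_norm _); apply: (I_abs_le mO (int_meas (dotm_wjac_int hu hv)) (sqiM mO sJu sJv)) => x Ox.
  rewrite normrM -[leRHS]mul1r; apply: ler_pM => //; last exact: dotm_le_enorm.
  by apply: eh1; exact: subset_closure.
have su := velocity_sq_enorm hu; have sv := velocity_sq_enorm hv.
have [E0 | /set0P [x0 Ox0]] := eqVneq Omega set0.
  rewrite /integ E0 Rintegral_set0 normr0.
  by rewrite [l2 u](_ : _ = 0) ?mul0r ?mulr0// /l2 /nsq E0 Rintegral_set0 sqrtr0.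
have aM0 : 0 <= alphaM by have /andP[h1 h2] := coefficient_comp_bound Ha Ox0; exact: le_trans (ltW h1) h2.
apply: (@le_trans _ _ (I (fun x => alphaM * (enorm (u x) * enorm (v x))))).
  apply: (I_abs_le mO (int_meas (coef_dotv_int Ha hu hv)) (intZ mO alphaM (sqiM mO su sv))) => x Ox.
  rewrite normrM; apply: ler_pM => //; last exact: dotm_le_enorm.
  by have /andP[h1 h2] := coefficient_comp_bound Ha Ox; rewrite ger0_norm// ltW.
rewrite (integZ oO alphaM (sqiM mO su sv)) ler_wpM2l//.
by apply: le_trans (ler_norm _) _; exact: cauchy_schwarz.
Qed.

(** ** The Forchheimer term *)

Definition drag u v w : R := I (fun x => beta (eh x) * enorm (u x) * dotv (v x) (w x)).

Lemma drag_int u v w : velocity u -> velocity v -> velocity w ->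
  Int (fun x => beta (eh x) * enorm (u x) * dotv (v x) (w x)).
Proof.
move=> hu hv hw; have mb := coefficient_comp_measurable Hb.
under [X in Int X]eq_fun do rewrite dotv_sum mulr_sumr.
apply: int_sum => // i.
have s : sq (fun x => beta (eh x) * enorm (u x)).
  apply: (sqi_bdM mO (c := betaM) mb _ (velocity_sq_enorm hu)) => x Ox.
  by have /andP[h1 h2] := coefficient_comp_bound Hb Ox; rewrite ger0_norm// ltW.
exact: (sqiM mO s (velocity_sqM oO i i hv hw)).
Qed.

Lemma form_cE u v w : form_c u v w = form_d u v w + drag u v w.
Proof. by []. Qed.

Lemma form_cDm u v1 v2 w : velocity u -> velocity v1 -> velocity v2 -> velocity w ->
  form_c u (fieldD v1 v2) w = form_c u v1 w + form_c u v2 w.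
Proof.
move=> hu h1 h2 hw; apply: split_sum; first exact: (form_dDm oO cO nT OT Meh eh1 hu h1 h2 hw).
rewrite -(integD oO (drag_int hu h1 hw) (drag_int hu h2 hw)).
by apply: eqI => // x _; rewrite dotvDl mulrDr.
Qed.

Lemma drag_ge0 u v : 0 <= drag u v v.
Proof.
apply: Rintegral_ge0 => x Ox; rewrite !mulr_ge0 ?enorm_ge0 ?dotm_ge0//.
by have /andP[/ltW] := coefficient_comp_bound Hb Ox.
Qed.

Lemma holder244 (P Q : R) e v w : velocity e -> velocity v -> velocity w ->
  0 <= P -> 0 <= Q ->
  nq (fun x => enorm (v x) ^+ 2) <= P ^+ 4 -> nq (fun x => enorm (w x) ^+ 2) <= Q ^+ 4 ->
  Int (fun x => enorm (e x) * (enorm (v x) * enorm (w x))) /\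
  I (fun x => enorm (e x) * (enorm (v x) * enorm (w x))) <= l2 e * (P * Q).
Proof.
move=> he hv hw P0 Q0 hP hQ.
have s := sq4M oO hv.2 hw.2; have se := velocity_sq_enorm he; split; first exact: (sqiM mO se s).
apply: le_trans (ler_norm _) _; apply: le_trans (cauchy_schwarz mO se s) _.
by rewrite ler_wpM2l ?l2_ge0//; exact: (nsqM_bound oO hv.2 hw.2).
Qed.

(** The modulus is 1-Lipschitz, so that e takes the place of the difference of
    moduli.  The second argument is split because the embedding constants of its
    two parts, a discrete field and the boundary extension, differ. *)
Lemma drag_lipschitz (P1 P2 Q : R) u1 u2 e v1 v2 w :
  velocity u1 -> velocity u2 -> velocity e -> velocity v1 -> velocity v2 -> velocity w ->
  (forall x, u1 x - u2 x = e x) -> 0 <= P1 -> 0 <= P2 -> 0 <= Q ->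
  nq (fun x => enorm (v1 x) ^+ 2) <= P1 ^+ 4 -> nq (fun x => enorm (v2 x) ^+ 2) <= P2 ^+ 4 ->
  nq (fun x => enorm (w x) ^+ 2) <= Q ^+ 4 ->
  `|drag u1 (fieldD v1 v2) w - drag u2 (fieldD v1 v2) w| <= betaM * (l2 e * ((P1 + P2) * Q)).
Proof.
move=> hu1 hu2 he hv1 hv2 hw ue P10 P20 Q0 hP1 hP2 hQ.
have hv := velocityD oO hv1 hv2.
have [J1 B1] := holder244 he hv1 hw P10 Q0 hP1 hQ.
have [J2 B2] := holder244 he hv2 hw P20 Q0 hP2 hQ.
have K1 := drag_int hu1 hv hw; have K2 := drag_int hu2 hv hw.
rewrite /drag -(integB oO K1 K2).
have [E0 | /set0P [x0 Ox0]] := eqVneq Omega set0.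
  rewrite /integ E0 Rintegral_set0 normr0.
  by rewrite [l2 e](_ : _ = 0) ?mul0r ?mulr0// /l2 /nsq E0 Rintegral_set0 sqrtr0.
have bM0 : 0 <= betaM by have /andP[h1 h2] := coefficient_comp_bound Hb Ox0; exact: le_trans (ltW h1) h2.
have J := intZ mO betaM (intD mO J1 J2).
apply: le_trans (I_abs_le mO (int_meas (intB mO K1 K2)) J _) _; last first.
  rewrite -/(integ Omega _) (integZ oO betaM (intD mO J1 J2)) (integD oO J1 J2) ler_wpM2l// mulrDl mulrDr.
  exact: lerD.
move=> x Ox; have /andP[b0 bM] := coefficient_comp_bound Hb Ox.
have -> : beta (eh x) * enorm (u1 x) * dotv (fieldD v1 v2 x) (w x) -
    beta (eh x) * enorm (u2 x) * dotv (fieldD v1 v2 x) (w x) =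
    beta (eh x) * ((enorm (u1 x) - enorm (u2 x)) * dotv (fieldD v1 v2 x) (w x)) by ring.
rewrite normrM; apply: ler_pM => //; first by rewrite ger0_norm// ltW.
rewrite normrM -mulrDr; apply: ler_pM => //.
  by apply: le_trans (enorm_dist _ _) _; rewrite ue.
apply: le_trans (dotm_le_enorm _ _) _; rewrite -mulrDl ler_wpM2r ?enorm_ge0//; exact: enormD.
Qed.

(** ** The divergence form *)

Lemma form_b_int v q : velocity v -> sq q -> Int (fun x => ediv Omega eh v x * q x).
Proof. by move=> hv hq; exact: (sqiM mO (sq_ediv oO cO nT OT Meh eh1 hv) hq). Qed.

Lemma form_bDl u v q : velocity u -> velocity v -> sq q ->
  form_b (fieldD u v) q = form_b u q + form_b v q.
Proof.
move=> hu hv hq; have huv := velocityD oO hu hv.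
rewrite /Defs.form_b -(integD oO (form_b_int hu hq) (form_b_int hv hq)).
apply: I_ae => //.
- by apply: filterS (edivD oO cO nT OT Meh eh1 hu hv) => x h Ox; rewrite h// mulrDl.
- exact: (int_meas (form_b_int huv hq)).
- exact: (int_meas (intD mO (form_b_int hu hq) (form_b_int hv hq))).
Qed.

Lemma form_bBr v q r : velocity v -> sq q -> sq r ->
  form_b v (fun x => q x - r x) = form_b v q - form_b v r.
Proof.
move=> hv hq hr; rewrite /Defs.form_b -(integB oO (form_b_int hv hq) (form_b_int hv hr)).
by apply: eqI => // x _; rewrite mulrBr.
Qed.

End forms_estimates.

(** * The iteration error *)

(** ** Elementary inequalities *)

Section real_estimates.
Context {R : realType}.
Implicit Types a b c : R.

Lemma lipschitz_total b c2 c4 s4 cd se sw n sv l : 0 <= b -> 0 < c2 -> 0 < c4 -> 0 < s4 ->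
  0 <= se -> 0 <= sw -> 0 <= n -> 0 <= sv -> 0 <= l -> l <= c2 * se ->
  cd * se * (sw + n) * sv + b * (l * ((c4 * sw + s4 * n) * (c4 * sv))) <=
  (cd + b * (c2 * ((c4 + s4) * c4))) * se * (sw + n) * sv.
Proof.
move=> b0 c20 c40 s40 se0 sw0 n0 sv0 l0 le.
have -> : (cd + b * (c2 * ((c4 + s4) * c4))) * se * (sw + n) * sv =
  cd * se * (sw + n) * sv + b * (c2 * se * ((c4 + s4) * (sw + n) * (c4 * sv))) by ring.
rewrite lerD2l ler_wpM2l//; apply: ler_pM => //.
  by rewrite mulr_ge0 ?addr_ge0 ?mulr_ge0// ltW.
rewrite ler_wpM2r ?mulr_ge0 ?(ltW c40)// mulrDl; apply: lerD.
  by rewrite ler_wpM2l ?(ltW c40)// lerDl.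
by rewrite ler_wpM2l ?(ltW s40)// lerDr.
Qed.

Lemma cancel_factor k s b : 0 <= s -> 0 <= b -> k * s ^+ 2 <= b * s -> k * s <= b.
Proof.
rewrite le_eqVlt => /predU1P[<- b0 _|s0 _]; first by rewrite mulr0.
by rewrite expr2 mulrA ler_pM2r.
Qed.

Lemma addrBB a b c b' : a + b - (c + b') = (a - c) + (b - b').
Proof. by ring. Qed.

Lemma le_opp_of_sum0 a b c : a + b + c = 0 -> 0 <= b -> a <= - c.
Proof. by lra. Qed.

Lemma energy_le a c c' l k y1 y2 y3 : a + (c + c') = l - k -> l <= y1 -> - k <= y2 ->
  - c' <= y3 -> 0 <= c -> a <= y1 + y2 + y3.
Proof. by lra. Qed.

Lemma subtract_equations a a' c c' cG b b' l aG k : a + a' + (c + c') - b' = l - aG - cG ->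
  a' + k - b = l - aG -> a + c + (c' + cG - k) = b' - b.
Proof. by lra. Qed.

Lemma pressure_total k aM c2 s sv l lv cw k2 se m : 0 <= aM -> 0 <= c2 -> 0 <= l -> 0 <= lv ->
  l <= c2 * s -> lv <= c2 * sv ->
  k * (s * sv) + aM * (l * lv) + cw * s * sv + k2 * se * m * sv <=
  ((k + aM * c2 ^+ 2) * s + cw * s + k2 * m * se) * sv.
Proof.
move=> aM0 c20 l0 lv0 h1 h2.
have h3 : aM * (l * lv) <= aM * (c2 * s * (c2 * sv)) by rewrite ler_wpM2l// ler_pM.
apply: le_trans (lerD (lerD (lerD (lexx _) h3) (lexx _)) (lexx _)) _.
by rewrite le_eqVlt; apply/orP; left; apply/eqP; ring.
Qed.

End real_estimates.

Section iteration.
Context {R : realType} {d : nat}.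
Local Notation point := ('rV[R]_d).
Local Notation mu := (leb R d).
Implicit Types (phi q r : point -> R) (u v w : point -> point).
Variable Omega : set point.
Hypothesis oO : open Omega.
Hypothesis cO : compact (closure Omega).
Let mO := domain_measurable oO.
Let fO := domain_fin oO cO.

Local Notation Int f := (mu.-integrable Omega (EFin \o f)).
Local Notation I f := (integ Omega f).
Local Notation sq f := (sqi mu Omega f).
Local Notation nq f := (nsq mu Omega f).
Local Notation H1 f := (H1 Omega f).
Local Notation velocity := (velocity Omega).
Local Notation nX := (normX Omega).
Local Notation sX := (semiX Omega).
Local Notation l2 := (l2 Omega).

Variables (T : seq (simplex R d)) (eh eps : point -> R).
Local Notation X0h := (in_X0h Omega T).
Local Notation M0h := (in_M0h Omega T).

(** ** The discrete spaces are vector spaces *)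

Lemma P1_bubbleD K f1 f2 : is_P1_bubble K f1 -> is_P1_bubble K f2 ->
  is_P1_bubble K (fun x : point => f1 x + f2 x).
Proof.
move=> [a1 [c1 [b1 h1]]] [a2 [c2 [b2 h2]]]; exists (a1 + a2), (c1 + c2), (b1 + b2) => x hx.
have -> : (x *m (a1 + a2)) ord0 ord0 = (x *m a1) ord0 ord0 + (x *m a2) ord0 ord0 by rewrite mulmxDr mxE.
by rewrite h1// h2//; ring.
Qed.

Lemma P1_bubbleZ K (c : R) f1 : is_P1_bubble K f1 -> is_P1_bubble K (fun x : point => c * f1 x).
Proof.
move=> [a1 [c1 [b1 h1]]]; exists (c *: a1), (c * c1), (c * b1) => x hx.
have -> : (x *m (c *: a1)) ord0 ord0 = c * (x *m a1) ord0 ord0 by rewrite -scalemxAr mxE.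
by rewrite h1//; ring.
Qed.

Lemma X0hD u v : X0h u -> X0h v -> X0h (fieldD u v).
Proof.
move=> [hu u0] [hv v0]; split => i; rewrite coordfD; last exact: H10D.
have [cu bu] := hu i; have [cv bv] := hv i; split.
  by move=> x; apply: continuousD; [exact: cu|exact: cv].
by move=> K KT; apply: P1_bubbleD; [exact: bu|exact: bv].
Qed.

Lemma X0hZ c v : X0h v -> X0h (fun x => c *: v x).
Proof.
move=> [hv v0]; split => i; rewrite coordfZ; last exact: H10Z.
have [cv bv] := hv i; split.
  by move=> x; apply: continuousM; [exact: cvg_cst|exact: cv].
by move=> K KT; apply: P1_bubbleZ; exact: bv.
Qed.

Definition fieldB u v : point -> point := fun x => u x - v x.

Lemma fieldBE u v : fieldB u v = fieldD u (fun x => (-1) *: v x).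
Proof. by apply/funext => x; rewrite /fieldB /fieldD scaleN1r. Qed.

Lemma fieldBK u v : fieldD (fieldB u v) v = u.
Proof. by apply/funext => x; rewrite /fieldD /fieldB subrK. Qed.

Lemma X0hB u v : X0h u -> X0h v -> X0h (fieldB u v).
Proof. by move=> hu hv; rewrite fieldBE; exact: X0hD hu (X0hZ _ hv). Qed.

Lemma M0h_sq q : M0h q -> sq q.
Proof. by move=> [_ h _]; exact/in_Lp2. Qed.

Lemma M0hB q r : M0h q -> M0h r -> M0h (fun x => q x - r x).
Proof.
move=> hq hr; have sq_ := M0h_sq hq; have sr := M0h_sq hr.
have [[cq Pq] _ Iq] := hq; have [[cr Pr] _ Ir] := hr; split.
- split; first by move=> x; apply: continuousB; [exact: cq|exact: cr].
  move=> K KT; have [a1 [c1 h1]] := Pq K KT; have [a2 [c2 h2]] := Pr K KT.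
  exists (a1 - a2), (c1 - c2) => x hx.
  have -> : (x *m (a1 - a2)) ord0 ord0 = (x *m a1) ord0 ord0 - (x *m a2) ord0 ord0.
    by rewrite mulmxBr mxE; congr (_ + _); rewrite mxE.
  by rewrite h1// h2//; ring.
- by apply/in_Lp2 => //; exact: sqiB.
- by rewrite (integB oO (sqi_int mO fO sq_) (sqi_int mO fO sr)) Iq Ir subrr.
Qed.

(** ** The two problems on one mesh *)

Hypothesis nT : forall K, K \in T -> nondegenerate K.
Hypothesis OT : closure Omega = \bigcup_(K in [set` T]) hull K.
Hypothesis Meh : in_Mh Omega T eh.
Variables (Re eps0 alpham alphaM betam betaM gamma c_d c_v : R) (alpha beta : R -> R).
Variables (Sc Cc : R -> R).
Hypotheses (d0 : (0 < d)%N) (Re0 : 0 < Re) (eps00 : 0 < eps0).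
Hypotheses (aM0 : 0 <= alphaM) (bM0 : 0 <= betaM) (cd0 : 0 < c_d) (cv0 : 0 < c_v).
Hypothesis ehE : forall x, closure Omega x -> eps0 <= eh x <= 1.
Hypothesis Ha : coefficient eps0 alpham alphaM alpha.
Hypothesis Hb : coefficient eps0 betam betaM beta.
Hypothesis SC : sobolev_constants Omega Sc Cc.
Hypothesis td : trilinear_bound Omega T eps (form_d Omega eh) c_d.
Hypothesis tc : trilinear_bound Omega T eps (form_c Omega beta eh) c_v.
Local Notation fa := (form_a Omega Re alpha eh).
Local Notation fd := (form_d Omega eh).
Local Notation fc := (form_c Omega beta eh).
Local Notation fb := (form_b Omega eh).
Local Notation dr := (drag Omega eh beta).

Let eh1 x : closure Omega x -> `|eh x| <= 1.
Proof. by move=> /ehE /andP[h1 h2]; rewrite ger0_norm// (le_trans (ltW eps00)). Qed.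

Lemma X0h_X0 v : X0h v -> in_X0 Omega v. Proof. by case. Qed.

Lemma X0h_velocity v : X0h v -> velocity v.
Proof. by move=> [_ h]; exact: (X0_velocity oO cO SC h). Qed.

Lemma X0h_semi_ge0 v : X0h v -> 0 <= sX v.
Proof. by move=> /X0h_velocity hv; apply: semiX_ge0 => // i; exact: velocity_H1. Qed.

Lemma X0h_l2 v : X0h v -> l2 v <= Cc 2 * sX v.
Proof.
move=> hv; have p26 : 1 <= (2 : R) <= 6 by apply/andP; split; lra.
have [_ C0 _ _] := SC p26; have s0 := X0h_semi_ge0 hv; have vv := X0h_velocity hv.
have c0 : 0 <= Cc 2 * sX v by rewrite mulr_ge0// ltW.
rewrite /l2 -[leRHS]ger0_norm// -sqrtr_sqr ler_wsqrtr// exprMn.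
have [_ ->] := sq_enorm_field oO (fun i => velocity_sq oO i vv).
exact: (poincareX oO cO SC d0 (X0h_X0 hv)).
Qed.

Section boundary_data.
Variables (g G : point -> point).
Hypothesis bd : boundary_datum Omega eps g G.

Lemma datum_velocity : velocity G.
Proof. by have [_ hG tG _ _] := bd; exact: (trace_velocity oO cO SC hG tG). Qed.
Let vG := datum_velocity.

Lemma datum_semi : sX G <= nX G.
Proof.
have [_ hG _ _ _] := bd; have s0 := semiX_ge0 oO hG.
rewrite -[leLHS]ger0_norm// -sqrtr_sqr /Defs.normX ler_wsqrtr// lerDr; exact: sqr_ge0.
Qed.

Lemma datum_l2 : l2 G <= nX G.
Proof.
have [_ hG _ _ _] := bd; have [h _] := sq_enorm_field oO (fun i => H1_sq oO (hG i)).
have -> : l2 G = normL2 Omega (fun x => enorm (G x)) by rewrite normL2E.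
have n0 : 0 <= normL2 Omega (fun x => enorm (G x)) by rewrite normL2E// sqrtr_ge0.
rewrite -[leLHS]ger0_norm// -sqrtr_sqr /Defs.normX ler_wsqrtr// lerDl; exact: sqr_ge0.
Qed.

(** The constant c_d for the convection; for the drag, the embedding constants in
    Hoelder's inequality with exponents 2, 4, 4, where Sc 4 measures the boundary
    extension and Cc 4 the discrete fields. *)
Definition advection_lip : R := c_d + betaM * (Cc 2 * ((Cc 4 + Sc 4) * Cc 4)).

Let C2 : 0 < Cc 2.
Proof. by have p : 1 <= (2 : R) <= 6 by [apply/andP; split; lra]; have [] := SC p. Qed.
Let p46 : 1 <= (4 : R) <= 6. Proof. by apply/andP; split; lra. Qed.
Let C4 : 0 < Cc 4. Proof. by have [] := SC p46. Qed.
Let S4 : 0 < Sc 4. Proof. by have [] := SC p46. Qed.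

Lemma advection_lip_ge0 : 0 <= advection_lip.
Proof.
apply: addr_ge0; first exact: ltW.
apply: mulr_ge0 => //; apply: mulr_ge0; first exact: ltW.
by apply: mulr_ge0; [apply: addr_ge0; exact: ltW|exact: ltW].
Qed.

(** The convection form is linear in the advecting field, and the drag depends on
    it through its modulus. *)
Lemma form_c_lipschitz wi w v : X0h wi -> X0h w -> X0h v ->
  `|fc (fieldD wi G) (fieldD w G) v - fc (fieldD w G) (fieldD w G) v| <=
  advection_lip * sX (fieldB wi w) * (sX w + nX G) * sX v.
Proof.
move=> hwi hw hv; set e := fieldB wi w; set U := fieldD w G.
have he : X0h e := X0hB hwi hw.
have [[[vwi vw] vv] ve] := (X0h_velocity hwi, X0h_velocity hw, X0h_velocity hv, X0h_velocity he).
have vU : velocity U := velocityD oO vw vG; have vUi := velocityD oO vwi vG.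
have UiE : fieldD wi G = fieldD e U.
  by apply/funext => x; rewrite /U /e /fieldD /fieldB addrA subrK.
have Ed : fd (fieldD wi G) U v - fd U U v = fd e U v.
  by rewrite UiE (form_dDl oO cO nT OT Meh eh1 ve vU vU vv) addrK.
rewrite !form_cE addrBB Ed.
have [[[s1 s2] s3] n0] := (X0h_semi_ge0 he, X0h_semi_ge0 hw, X0h_semi_ge0 hv, normX_ge0 Omega G).
have sizU : sized_arg Omega T G U (sX w + nX G) by apply: Or33; exists w.
have size_ : sized_arg Omega T G e (sX e) by exact: Or31.
have [_ _ t3] := td.
have hd : `|fd e U v| <= c_d * sX e * (sX w + nX G) * sX v.
  rewrite ler_norml; apply/andP; split; last exact: (t3 _ _ bd).
  (* The bound on d_h is one-sided; the lower bound comes from -v. *)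
  have hN : X0h (fun x => (-1) *: v x) := X0hZ (-1) hv.
  have := t3 _ _ bd _ _ _ _ _ size_ sizU hN.
  rewrite (form_dNr oO cO nT OT Meh eh1 ve vU vv) semiXZ => [|//|i]; last exact: velocity_H1.
  by rewrite normrN1 mul1r lerNl.
have [_ hG _ _ _] := bd.
have [_ q1] := X0_L4 oO cO SC (X0h_X0 hw); have [_ q2] := X_L4 oO SC hG; have [_ q3] := X0_L4 oO cO SC (X0h_X0 hv).
have [P1 P2 Q0] : [/\ 0 <= Cc 4 * sX w, 0 <= Sc 4 * nX G & 0 <= Cc 4 * sX v].
  by split; rewrite mulr_ge0// ltW.
have hdr := drag_lipschitz oO cO Meh ehE Hb vUi vU ve vw vG vv (fun x => _) P1 P2 Q0 q1 q2 q3.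
have {}hdr := hdr _.
have hE x : fieldD wi G x - U x = e x by rewrite /U /fieldD /e /fieldB opprD addrACA subrr addr0.
apply: le_trans (ler_normD _ _) _.
have h2 := hdr hE; apply: le_trans (lerD hd h2) _.
have hl := X0h_l2 he.
rewrite /advection_lip; exact: (lipschitz_total c_d bM0 C2 C4 S4 s1 s2 n0 s3 (l2_ge0 _ _) hl).
Qed.

(** ** The error equation *)

Variables (f : point -> point) (w : point -> point) (p : point -> R).
Hypothesis sD : solves_D Omega Re alpha beta eh T f G w p.

(** Writing w' as the new error plus w in the iterative problem isolates the
    terms in the new error; the others compare two advecting fields. *)
Lemma error_equation wi w' p' : X0h wi -> solves_I Omega Re alpha beta eh T f G wi w' p' ->
  forall v, X0h v ->
  fa (fieldB w' w) v + fc (fieldD wi G) (fieldB w' w) v +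
  (fc (fieldD wi G) (fieldD w G) v - fc (fieldD w G) (fieldD w G) v) = fb v (fun x => p' x - p x).
Proof.
move=> hwi [hw' hp' eI _] v hv; have [hw hp eD _] := sD.
have he := X0hB hw' hw.
have [[[[vwi vw'] vw] ve] vv] := (X0h_velocity hwi, X0h_velocity hw', X0h_velocity hw, X0h_velocity he, X0h_velocity hv).
have vUi := velocityD oO vwi vG.
have E1 : fa w' v = fa (fieldB w' w) v + fa w v.
  by rewrite -{1}(fieldBK w' w) (form_aD oO Meh Re eps00 ehE Ha).
have E2 : fc (fieldD wi G) w' v = fc (fieldD wi G) (fieldB w' w) v + fc (fieldD wi G) w v.
  by rewrite -{1}(fieldBK w' w) (form_cDm oO cO nT OT Meh eps00 ehE Hb vUi ve vw vv).
have E3 := form_cDm oO cO nT OT Meh eps00 ehE Hb vUi vw vG vv.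
have E4 := form_bBr oO cO nT OT Meh eps00 ehE vv (M0h_sq hp') (M0h_sq hp).
have Ei := eI v hv; have Ed := eD v hv; rewrite E1 E2 in Ei; rewrite E4 E3.
exact: subtract_equations Ei Ed.
Qed.

(** Test with the new error.  The pressure drops out, since both fields are
    discretely divergence free, and the advection of the error by w_i + G is
    nonnegative. *)
Lemma contraction wi w' p' : X0h wi -> solves_I Omega Re alpha beta eh T f G wi w' p' ->
  eps0 / Re * sX (fieldB w' w) <= advection_lip * (sX w + nX G) * sX (fieldB wi w).
Proof.
move=> hwi sI; have [hw hp _ bD] := sD; have [hw' hp' _ bI] := sI.
have he := X0hB hw' hw; have := error_equation hwi sI he; set e' := fieldB w' w in he *.
have [[[vwi vw'] vw] ve'] := (X0h_velocity hwi, X0h_velocity hw', X0h_velocity hw, X0h_velocity he).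
have vUi := velocityD oO vwi vG.
have b0 r : M0h r -> fb e' r = 0.
  move=> hr; have := bI r hr; rewrite -(fieldBK w' w) (form_bDl oO cO nT OT Meh eps00 ehE ve' vw (M0h_sq hr)).
  by rewrite (bD r hr) addr0.
rewrite (b0 _ (M0hB hp' hp)) => E.
have c0 : 0 <= fc (fieldD wi G) e' e'.
  rewrite form_cE (form_d_skew oO cO nT OT Meh eh1 SC vUi (X0h_X0 he)) add0r.
  exact: (drag_ge0 ehE Hb).
have a0 := form_a_coercive oO Meh Re0 eps00 ehE Ha ve'.
have L := form_c_lipschitz hwi hw he.
have L' := le_trans (ler_norm _) L; have s0 := X0h_semi_ge0 he.
have s1 := X0h_semi_ge0 (X0hB hwi hw); have s2 := X0h_semi_ge0 hw.
have key : eps0 / Re * sX e' ^+ 2 <= advection_lip * sX (fieldB wi w) * (sX w + nX G) * sX e'.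
  apply: le_trans a0 _; apply: le_trans L; apply: (@le_trans _ _ (- (fc (fieldD wi G) (fieldD w G) e' - fc (fieldD w G) (fieldD w G) e'))).
    exact: le_opp_of_sum0 E c0.
  by rewrite -normrN; exact: ler_norm.
apply: (cancel_factor s0 (mulr_ge0 (mulr_ge0 advection_lip_ge0 (addr_ge0 s2 (normX_ge0 _ _))) s1)).
by rewrite (mulrAC advection_lip).
Qed.

(** Test the discrete problem with its solution.  The bound on the term
    with G advected by w + G contains the seminorm of w again; the smallness of
    the boundary datum will absorb it. *)
Lemma apriori_bound (L : R) : 0 <= L -> form_l Omega eh f w <= L * sX w ->
  eps0 / Re * sX w <= L + (Re^-1 + alphaM * Cc 2) * nX G + c_v * (sX w + nX G) * nX G.
Proof.
move=> L0 hL; have [hw hp eD bD] := sD; have := eD w hw; rewrite (bD p hp) subr0 => E.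
have vw := X0h_velocity hw; have vU := velocityD oO vw vG; have s0 := X0h_semi_ge0 hw.
have E3 := form_cDm oO cO nT OT Meh eps00 ehE Hb vU vw vG vw.
have c0 : 0 <= fc (fieldD w G) w w.
  rewrite form_cE (form_d_skew oO cO nT OT Meh eh1 SC vU (X0h_X0 hw)) add0r.
  exact: (drag_ge0 ehE Hb).
have a0 := form_a_coercive oO Meh Re0 eps00 ehE Ha vw.
have aG := form_a_bound oO cO Meh Re0 eps00 ehE Ha vG vw.
have dragN : dr (fieldD w G) G (fun x => (-1) *: w x) = - dr (fieldD w G) G w.
  rewrite /drag /integ -(I_N mO (drag_int oO cO Meh ehE Hb vU vG vw)).
  by apply: eqI => // x _; rewrite /dotv dotmC dotmZ dotmC; ring.
have sizU : sized_arg Omega T G (fieldD w G) (sX w + nX G) by apply: Or33; exists w.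
have sizG : sized_arg Omega T G G (nX G) by exact: Or32.
have [_ _ t3] := tc.
(* The bound on c_h is one-sided; it is applied to -w. *)
have cG : - fc (fieldD w G) G w <= c_v * (sX w + nX G) * nX G * sX w.
  have := t3 _ _ bd _ _ _ _ _ sizU sizG (X0hZ (-1) hw).
  rewrite semiXZ => [|//|i]; last exact: velocity_H1.
  rewrite normrN1 mul1r => h; rewrite form_cE opprD; apply: le_trans h.
  by rewrite form_cE (form_dNr oO cO nT OT Meh eh1 vU vG vw) dragN.
have n0 := normX_ge0 Omega G.
have aG' : - fa G w <= (Re^-1 + alphaM * Cc 2) * nX G * sX w.
  apply: le_trans (_ : `|fa G w| <= _); first by rewrite -normrN; exact: ler_norm.
  apply: le_trans aG _; rewrite [leRHS](_ : _ = Re^-1 * (nX G * sX w) + alphaM * (nX G * (Cc 2 * sX w))); last by ring.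
  apply: lerD; rewrite ler_wpM2l ?invr_ge0 ?(ltW Re0)//.
    by rewrite ler_wpM2r// datum_semi.
  by apply: ler_pM; rewrite ?l2_ge0 ?datum_l2 ?X0h_l2.
have key : eps0 / Re * sX w ^+ 2 <=
    (L + (Re^-1 + alphaM * Cc 2) * nX G + c_v * (sX w + nX G) * nX G) * sX w.
  rewrite [leRHS](_ : _ = L * sX w + (Re^-1 + alphaM * Cc 2) * nX G * sX w + c_v * (sX w + nX G) * nX G * sX w); last by ring.
  apply: le_trans a0 _; rewrite E3 in E.
  exact: energy_le E hL aG' cG c0.
apply: (cancel_factor s0 _ key); apply: addr_ge0; last first.
  exact: (mulr_ge0 (mulr_ge0 (ltW cv0) (addr_ge0 s0 n0)) n0).
apply: (addr_ge0 L0); apply: mulr_ge0 n0; apply: addr_ge0; first by rewrite invr_ge0 ltW.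
exact: (mulr_ge0 aM0 (ltW C2)).
Qed.

(** ** The error in the pressure *)

Lemma pressure_error wi w' p' : X0h wi -> solves_I Omega Re alpha beta eh T f G wi w' p' ->
  inf_sup Omega eh T gamma ->
  gamma * normL2 Omega (fun x => p' x - p x) <=
  (Re^-1 + alphaM * Cc 2 ^+ 2) * sX (fieldB w' w) + c_v * (sX wi + nX G) * sX (fieldB w' w) +
  advection_lip * (sX w + nX G) * sX (fieldB wi w).
Proof.
move=> hwi sI isup; have [hw hp _ _] := sD; have [hw' hp' _ _] := sI.
rewrite -lee_fin; apply: le_trans (isup _ (M0hB hp' hp)) _.
apply: ge_ereal_sup => _ [v [hv sv] <-]; rewrite lee_fin ler_pdivrMr//.
rewrite -(error_equation hwi sI hv); set e' := fieldB w' w.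
have he : X0h e' := X0hB hw' hw; have [ve vv] := (X0h_velocity he, X0h_velocity hv).
have aG := le_trans (ler_norm _) (form_a_bound oO cO Meh Re0 eps00 ehE Ha ve vv).
have L := le_trans (ler_norm _) (form_c_lipschitz hwi hw hv).
have sizU : sized_arg Omega T G (fieldD wi G) (sX wi + nX G) by apply: Or33; exists wi.
have size_ : sized_arg Omega T G e' (sX e') by exact: Or31.
have [_ _ t3] := tc; have tb := t3 _ _ bd _ _ _ _ _ sizU size_ hv.
apply: le_trans (lerD (lerD aG tb) L) _.
exact: (pressure_total _ _ _ _ _ aM0 (ltW C2) (l2_ge0 _ _) (l2_ge0 _ _) (X0h_l2 he) (X0h_l2 hv)).
Qed.

(** This weak triangle inequality bounds the iterates independently of their
    index. *)
Lemma semi_triangle u v : X0h u -> X0h v -> sX (fieldD u v) ^+ 2 <= 2 * (sX u ^+ 2 + sX v ^+ 2).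
Proof.
move=> hu hv; have hH v' : X0h v' -> forall i, H1 (coordf v' i).
  by move=> /X0h_velocity h i; exact: velocity_H1.
rewrite !semiX_sqr//; [|exact: hH|exact: hH|exact: (hH _ (X0hD hu hv))].
rewrite -big_split mulr_sumr; apply: ler_sum => i _ /=; rewrite coordfD.
rewrite /gradsq -big_split mulr_sumr; apply: ler_sum => j _ /=.
have [h1 h2] := (hH _ hu i, hH _ hv i).
have [d1 d2] := (H1_dsq oO j h1, H1_dsq oO j h2).
have d12 : sq (wderiv Omega j (fun x => coordf u i x + coordf v i x)).
  by apply: H1_dsq => //; exact: H1D.
rewrite (nsq_ae oO (wderivD oO _ h1 h2) d12.1 (sqiD mO d1 d2).1).
exact: (nsqD_le mO d1 d2).
Qed.

End boundary_data.
End iteration.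

(** * Convergence *)

Section smallness.
Context {R : realType}.

(** The smallness of ng makes the term cv s nG at most half of the left-hand
    side. *)
Lemma apriori_smallness (Re eps0 Kl m m2 cv nf ng nG s : R) : 0 < Re -> 0 < eps0 -> 0 <= Kl ->
  0 <= m -> Re^-1 <= m2 -> 0 < cv -> 0 <= nf -> 0 <= nG -> nG <= ng -> 0 <= s ->
  eps0 / Re * s <= Kl * nf + m * nG + cv * (s + nG) * nG ->
  ng < eps0 / (2 * cv * Re) ->
  s <= (Kl / eps0 + 1 + Re * m) * (2 * Re / eps0 * (eps0 * nf + cv * ng ^+ 2 + m2 * ng)).
Proof.
move=> Re0 e0 Kl0 m0 m2R cv0 nf0 nG0 nGng s0 H hng.
have ng0 : 0 <= ng := le_trans nG0 nGng.
have h1 : cv * s * nG <= eps0 / (2 * Re) * s.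
  rewrite (mulrAC cv) ler_wpM2r//; apply: le_trans (_ : cv * ng <= _); first by rewrite ler_wpM2l// ltW.
  apply: le_trans (ler_wpM2l (ltW cv0) (ltW hng)) _; rewrite le_eqVlt; apply/orP; left; apply/eqP.
  by field; rewrite !gt_eqF.
have h2 : m * nG <= Re * m * (m2 * ng).
  have : m * nG <= m * ng by rewrite ler_wpM2l.
  have : m * ng = Re * m * (Re^-1 * ng) by field; rewrite gt_eqF.
  have : Re * m * (Re^-1 * ng) <= Re * m * (m2 * ng).
    by rewrite ler_wpM2l ?mulr_ge0 ?(ltW Re0)// ler_wpM2r.
  by lra.
have h3 : cv * nG * nG <= cv * ng ^+ 2.
  by rewrite -mulrA ler_wpM2l ?(ltW cv0)// expr2 ler_pM.
have E : eps0 / Re * s = eps0 / (2 * Re) * s + eps0 / (2 * Re) * s by field; rewrite gt_eqF.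
set Q := eps0 * nf + cv * ng ^+ 2 + m2 * ng.
have m20 : 0 <= m2 by apply: le_trans m2R; rewrite invr_ge0 ltW.
have [a0 b0 c0] : [/\ 0 <= eps0 * nf, 0 <= cv * ng ^+ 2 & 0 <= m2 * ng].
  by split; rewrite mulr_ge0 ?sqr_ge0// ltW.
have h4 : eps0 / (2 * Re) * s <= (Kl / eps0 + 1 + Re * m) * Q.
  have -> : (Kl / eps0 + 1 + Re * m) * Q = Kl * nf + cv * ng ^+ 2 + Re * m * (m2 * ng) +
     (Kl / eps0 * (cv * ng ^+ 2 + m2 * ng) + (eps0 * nf + m2 * ng) +
      Re * m * (eps0 * nf + cv * ng ^+ 2)) by rewrite /Q; field; rewrite gt_eqF.
  have r0 : 0 <= Kl / eps0 * (cv * ng ^+ 2 + m2 * ng) + (eps0 * nf + m2 * ng) +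
      Re * m * (eps0 * nf + cv * ng ^+ 2).
    apply: addr_ge0; last by rewrite mulr_ge0 ?addr_ge0// mulr_ge0// ltW.
    apply: addr_ge0; last exact: addr_ge0.
    by apply: mulr_ge0; [rewrite divr_ge0// ltW|exact: addr_ge0].
  have X : cv * (s + nG) * nG = cv * s * nG + cv * nG * nG by ring.
  rewrite X E in H; move: H h1 h2 h3 r0.
  by lra.
have p0 : 0 < 2 * Re / eps0 by rewrite divr_gt0// mulr_gt0.
have : 2 * Re / eps0 * (eps0 / (2 * Re) * s) <= 2 * Re / eps0 * ((Kl / eps0 + 1 + Re * m) * Q).
  by rewrite ler_wpM2l// ltW.
have -> : 2 * Re / eps0 * (eps0 / (2 * Re) * s) = s by field; rewrite !gt_eqF.
by rewrite mulrCA.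
Qed.

(** Both s and nG are bounded by multiples of the data R1 and ng, so that a large
    enough constant in the smallness condition controls k2 (s + nG). *)
Lemma smallness_half (Re eps0 K k2 s nG ng R1 a b : R) : 0 < Re -> 0 < eps0 ->
  0 <= k2 -> 0 <= b -> 0 <= R1 -> 0 <= ng -> nG <= ng -> s <= K * R1 ->
  (`|k2| * (`|K| + 1) + 1) * (R1 + ng) < eps0 / (2 * Re) ->
  eps0 / Re * a <= k2 * (s + nG) * b -> a <= 2^-1 * b.
Proof.
move=> Re0 e0 k20 b0 R10 ng0 nGng hs hc H.
have h1 : s + nG <= (`|K| + 1) * (R1 + ng).
  have : K * R1 <= `|K| * R1 by rewrite ler_wpM2r// ler_norm.
  have := mulr_ge0 (normr_ge0 K) ng0.
  by move: hs nGng R10; nra.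
have h2 : k2 * (s + nG) <= eps0 / (2 * Re).
  apply/ltW; apply: le_lt_trans hc; rewrite (ger0_norm k20) mulrDl -mulrA mul1r.
  apply: le_trans (ler_wpM2l k20 h1) _; rewrite lerDl; exact: addr_ge0.
have h3 := le_trans H (ler_wpM2r b0 h2).
have E : eps0 / (2 * Re) * b = eps0 / Re * (2^-1 * b) by field; rewrite gt_eqF.
by rewrite E ler_pM2l ?divr_gt0// in h3.
Qed.

Lemma halving_cvg0 (a : nat -> R) : (forall n, 0 <= a n) -> (forall n, a n.+1 <= 2^-1 * a n) ->
  a @ \oo --> 0.
Proof.
move=> a0 ha; have hb n : 0 <= a n <= geometric (a 0%N) 2^-1 n.
  rewrite a0 /=; elim: n => [|n IH]; first by rewrite expr0 mulr1.
  by apply: le_trans (ha n) _; rewrite exprS mulrCA ler_wpM2l// invr_ge0.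
apply: cvg2_0le hb _; apply: cvg_geometric.
by rewrite ger0_norm ?invr_ge0// invf_lt1// ltr1n.
Qed.

Lemma halving_le (a : nat -> R) : (forall n, 0 <= a n) -> (forall n, a n.+1 <= 2^-1 * a n) ->
  forall n, a n <= a 0%N.
Proof.
move=> a0 ha; elim=> [//|n IH]; apply: le_trans (ha n) _; apply: le_trans IH.
by rewrite ler_piMl// invf_le1// ler1n.
Qed.

Lemma sum_sqr_mono (a b s : R) : 0 <= a -> a <= b -> 2 * (a ^+ 2 + s ^+ 2) <= 2 * (b ^+ 2 + s ^+ 2).
Proof. by move=> *; nra. Qed.

Lemma pressure_total_mono (k cv m B s c : R) : 0 <= cv -> 0 <= s -> m <= B ->
  k * s + cv * m * s + c <= (k + cv * B) * s + c.
Proof. by move=> cv0 s0 mB; rewrite lerD2r mulrDl lerD2l ler_wpM2r// ler_wpM2l. Qed.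

Lemma lincomb_cvg0 (c k m : R) (a b : nat -> R) : a @ \oo --> 0 -> b @ \oo --> 0 ->
  c * (k * a n + m * b n) @[n --> \oo] --> 0.
Proof.
move=> a0 b0; rewrite -[X in _ --> X](mulr0 c); apply: cvgMr.
rewrite -[X in _ --> X]addr0 -[X in _ --> X + _](mulr0 k) -[X in _ --> _ + X](mulr0 m).
by apply: cvgD; apply: cvgMr.
Qed.

Lemma EFin_cvg0 (a : nat -> R) : a @ \oo --> 0 -> ((a n)%:E @[n --> \oo] --> 0%E).
Proof. by move=> h; apply: cvg_EFin; [exact: nearW|exact: h]. Qed.

End smallness.

Theorem theorem3p7 (R : realType) (d : nat) (Omega : set 'rV[R]_d)
    (Re eps0 r alpham alphaM betam betaM Ceps gamma c_d c_v : R)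
    (eps : 'rV[R]_d -> R) (alpha beta : R -> R) (S C : R -> R)
    (H : Type) (T : H -> seq (simplex R d)) (epsh : H -> 'rV[R]_d -> R)
    (IX : H -> ('rV[R]_d -> 'rV[R]_d) -> ('rV[R]_d -> 'rV[R]_d)) :
  d = 2%N \/ d = 3%N ->
  polyhedral_domain Omega ->
  0 < Re -> 0 < eps0 -> d%:R < r ->
  sobolev_constants Omega S C ->
  porosity Omega eps0 r eps ->
  in_W1p Omega +oo%E eps -> in_W2p Omega r%:E eps ->
  coefficient eps0 alpham alphaM alpha ->
  coefficient eps0 betam betaM beta ->
  (forall h, conforming_triangulation Omega (T h)) ->
  regular_family T ->
  0 < Ceps ->
  (forall h, discrete_porosity Omega eps0 r Ceps eps (T h) (epsh h)) ->
  (forall h v, in_X Omega v -> in_Xh Omega (T h) (IX h v)) ->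
  0 < gamma ->
  (forall h, inf_sup Omega (epsh h) (T h) gamma) ->
  0 < c_d -> 0 < c_v ->
  (forall h, trilinear_bound Omega (T h) eps (form_d Omega (epsh h)) c_d) ->
  (forall h, trilinear_bound Omega (T h) eps (form_c Omega beta (epsh h)) c_v) ->
  exists c1 : R, 0 < c1 /\
    forall f g G : 'rV[R]_d -> 'rV[R]_d,
    in_L2v Omega f ->
    boundary_datum Omega eps g G ->
    let nf := normX0' Omega f in
    let ng := normHhalf Omega g in
    let F1 := 2 * Re / eps0 *
      (nf + (Re^-1 + alphaM * S 2) * ng + c_v * ng ^+ 2) in
    let R1 := 2 * Re / eps0 *
      (eps0 * nf + c_v * ng ^+ 2 + (Re^-1 + alphaM * C 2 ^+ 2) * ng) in
    ng < eps0 / (2 * c_v * Re) ->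
    eps0 * nf + c_v * ng ^+ 2 +
      ((eps0 + 2) / (2 * Re) + alphaM * C 2 ^+ 2) * ng
      < eps0 ^+ 2 / (2 * Re ^+ 2 * (c_d + betaM * C 2 * C 4 * S 4)) ->
    c1 * (R1 + ng) < eps0 / (2 * Re) ->
    forall (h : H)
      (w_ : nat -> 'rV[R]_d -> 'rV[R]_d) (p_ : nat -> 'rV[R]_d -> R)
      (w : 'rV[R]_d -> 'rV[R]_d) (p : 'rV[R]_d -> R),
    in_X0h Omega (T h) (w_ 0%N) ->
    semiX Omega (w_ 0%N) <= F1 ->
    (forall i, solves_I Omega Re alpha beta (epsh h) (T h) f G
                 (w_ i) (w_ i.+1) (p_ i.+1)) ->
    solves_D Omega Re alpha beta (epsh h) (T h) f G w p ->
    let u_ i := fieldD (w_ i) (IX h G) in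
    let u := fieldD w (IX h G) in
    (normLp Omega 2%:E (fun x => enorm (u_ i.+1 x - u x))
       @[i --> \oo] --> 0%E) /\
    (normLp Omega 2%:E (fun x => p_ i.+1 x - p x) @[i --> \oo] --> 0%E).
Proof.
move=> d23 [Ox0 oO _ [T0 [nT0 OT0]] _] Re0 eps00 dr SC _ _ W2 Ha Hb Tc _ C0 dp _ gamma0 isup cd0 cv0 td tc.
have cO : compact (closure Omega) := closure_compact nT0 OT0.
have d0 : (0 < d)%N by case: d23 => ->.
have [Kl Kl0 HKl] := form_l_bound oO cO d23 SC dr eps00 C0 W2.
pose k2 := advection_lip betaM c_d S C; pose m := Re^-1 + alphaM * C 2; pose K := Kl / eps0 + 1 + Re * m.
(* The absolute values keep the constant positive whatever the signs of alphaM
   and betaM. *)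
exists (`|k2| * (`|K| + 1) + 1); split.
  by rewrite ltr_wpDl// mulr_ge0// addr_ge0.
move=> f g G Lf bd nf ng F1 R1 ng_small _ small h w_ p_ w p w00 _ sI sD u_ u.
have ad : admissible Omega eps0 r Ceps eps (T h) (epsh h) by split; [exact: Tc|exact: dp].
have [nT OT _] := Tc h; have [Meh ehE _ _] := dp h.
(* At a point of Omega the discrete porosity takes a value in [eps0, 1], so that this
   interval is not empty and the bounds of alpha and beta are positive. *)
have [eps01 aM0 bM0] : [/\ eps0 <= 1, 0 <= alphaM & 0 <= betaM].
  have [x Ox] := Ox0; have /andP[e1 e2] := ehE x (subset_closure Ox).
  have e01 := le_trans e1 e2; have t1 : eps0 <= 1 <= (1 : R) by rewrite e01 lexx.
  have [ap al _] := Ha; have [bp bl _] := Hb; split => //.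
    by have /andP[_] := al _ t1; apply: le_trans; exact: ltW (ap _ t1).
  by have /andP[_] := bl _ t1; apply: le_trans; exact: ltW (bp _ t1).
have p26 : 1 <= (2 : R) <= 6 by apply/andP; split; lra.
have [_ C20 _ _] := SC _ p26.
have sf i : sqi (leb R d) Omega (coordf f i) by apply/in_Lp2 => //; exact: Lf.
have nf0 : 0 <= nf := dual_norm_ge0 oO cO SC d0 sf.
have [_ hG _ _ Gg] := bd.
have nG0 := normX_ge0 Omega G.
have ng0 : 0 <= ng := le_trans nG0 Gg.
have [hw hp _ _] := sD.
have hw_ i : in_X0h Omega (T h) (w_ i) by case: i => [//|i]; have [] := sI i.
have s0 := X0h_semi_ge0 oO cO SC hw.
have lw : form_l Omega (epsh h) f w <= Kl * nf * semiX Omega w by exact: HKl ad _ _ Lf (X0h_X0 hw).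
have ap := apriori_bound oO cO nT OT Meh d0 Re0 eps00 aM0 cv0 ehE Ha Hb SC (tc h) bd sD (mulr_ge0 Kl0 nf0) lw.
have m0 : 0 <= m.
  by apply: addr_ge0; [rewrite invr_ge0 ltW|exact: (mulr_ge0 aM0 (ltW C20))].
have m2 : Re^-1 <= Re^-1 + alphaM * C 2 ^+ 2.
  by rewrite lerDl; exact: (mulr_ge0 aM0 (sqr_ge0 _)).
have sR := apriori_smallness Re0 eps00 Kl0 m0 m2 cv0 nf0 nG0 Gg s0 ap ng_small.
have R10 : 0 <= R1.
  apply: mulr_ge0; first by rewrite divr_ge0 ?mulr_ge0// ltW.
  apply: addr_ge0; first exact: (addr_ge0 (mulr_ge0 (ltW eps00) nf0) (mulr_ge0 (ltW cv0) (sqr_ge0 _))).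
  by apply: mulr_ge0 => //; apply: le_trans m2; rewrite invr_ge0 ltW.
have k20 : 0 <= k2 := advection_lip_ge0 bM0 cd0 SC.
pose e i := semiX Omega (fieldB (w_ i) w).
have he i : in_X0h Omega (T h) (fieldB (w_ i) w) := X0hB oO cO (hw_ i) hw.
have e0 i : 0 <= e i := X0h_semi_ge0 oO cO SC (he i).
have eS i : e i.+1 <= 2^-1 * e i.
  apply: (smallness_half Re0 eps00 k20 (e0 i) R10 ng0 Gg sR small).
  exact: (contraction oO cO nT OT Meh d0 Re0 eps00 bM0 cd0 ehE Ha Hb SC (td h) bd sD (hw_ i) (sI i)).
have ecvg : e @ \oo --> 0 := halving_cvg0 e0 eS.
have eScvg : (fun i => e i.+1) @ \oo --> 0 by rewrite (cvg_shiftS e).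
split.
  have E i : normLp Omega 2%:E (fun x => enorm (u_ i.+1 x - u x)) = (l2 Omega (fieldB (w_ i.+1) w))%:E.
    have -> : (fun x => enorm (u_ i.+1 x - u x)) = (fun x => enorm (fieldB (w_ i.+1) w x)).
      by apply/funext => x; rewrite /u_ /u /fieldD /fieldB opprD addrACA subrr addr0.
    have [sq_ _] := sq_enorm_field oO (fun j => velocity_sq oO j (X0h_velocity oO cO SC (he i.+1))).
    exact: normLp2.
  under eq_fun do rewrite E.
  apply: EFin_cvg0; apply: (@cvg2_0le _ _ (fun i => C 2 * e i.+1)).
    by move=> i; rewrite l2_ge0 /=; exact: (X0h_l2 oO cO d0 SC (he i.+1)).
  by rewrite -[X in _ --> X](mulr0 (C 2)); apply: cvgMr.
pose B := Num.sqrt (2 * (e 0%N ^+ 2 + semiX Omega w ^+ 2)) + normX Omega G.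
have wB i : semiX Omega (w_ i) + normX Omega G <= B.
  rewrite lerD2r -[leLHS]ger0_norm ?(X0h_semi_ge0 oO cO SC (hw_ i))// -sqrtr_sqr ler_wsqrtr//.
  have := semi_triangle oO cO SC (he i) hw; rewrite fieldBK => t; apply: le_trans t _.
  exact: sum_sqr_mono (e0 i) (halving_le e0 eS i).
pose D i := gamma^-1 * ((Re^-1 + alphaM * C 2 ^+ 2 + c_v * B) * e i.+1 +
   k2 * (semiX Omega w + normX Omega G) * e i).
have Dp i : normL2 Omega (fun x => p_ i.+1 x - p x) <= D i.
  rewrite -(ler_pM2l gamma0) /D mulrA mulfV ?gt_eqF// mul1r.
  apply: le_trans (pressure_error oO cO nT OT Meh d0 Re0 eps00 aM0 bM0 ehE Ha Hb SC (td h) (tc h) bd sD (hw_ i) (sI i) (isup h)) _.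
  exact: pressure_total_mono (ltW cv0) (e0 i.+1) (wB i).
have sp i : sqi (leb R d) Omega (fun x => p_ i.+1 x - p x).
  by apply: (M0h_sq oO); apply: (M0hB oO cO _ hp); have [] := sI i.
have E i : normLp Omega 2%:E (fun x => p_ i.+1 x - p x) = (normL2 Omega (fun x => p_ i.+1 x - p x))%:E.
  by rewrite (normL2E oO (sp i)) normLp2.
under eq_fun do rewrite E.
apply: EFin_cvg0; apply: (@cvg2_0le _ _ D).
  by move=> i; rewrite Dp andbT (normL2E oO (sp i)) sqrtr_ge0.
exact: (lincomb_cvg0 _ _ _ eScvg ecvg).
Qed.
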